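(* Let $E$ be the elliptic curve $E : y^2 = x^3 - x$ over $\mathbb{Q}$ and fix $\gamma > 1$. Then for all sufficiently large $x$, \[ \#\{p \leq x : \omega(\#E(\mathbb{F}_p)) > \gamma \log\log x\} \ll_\gamma \frac{x(\log\log x)^5}{(\log x)^{2 + \gamma\log\gamma - \gamma}}. \] The same bound holds if instead $0 < \gamma < 1$ and the count is of primes $p \le x$ with $\omega(\#E(\mathbb{F}_p)) < \gamma\log\log x$.
   Context: $p$ ranges over rational primes of good reduction for $E$ (i.e. odd primes), and $E(\mathbb{F}_p)$ is the group of $\mathbb{F}_p$-points of the reduction of $E$ mod $p$. $\omega(n)$ denotes the number of distinct prime divisors of $n$. The implied constant depends only on $\gamma$. *)

(* Defs.v *)
From mathcomp Require Import all_boot all_order all_algebra.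
From mathcomp Require Import all_classical all_reals all_analysis.

Set Implicit Arguments.
Unset Strict Implicit.
Unset Printing Implicit Defensive.

Import Order.TTheory GRing.Theory Num.Theory.
Local Open Scope ring_scope.

Definition omega (n : nat) : nat := size (primes n).

(* Points of y^2 = x^3 - x over F; None is the point at infinity. *)
Definition on_curve (F : finFieldType) (P : option (F * F)) : bool :=
  if P is Some (x, y) then y ^+ 2 == x ^+ 3 - x else true.

Definition E_points (F : finFieldType) : {set option (F * F)} :=
  [set P | on_curve P].

(* The model y^2 = x^3 - x has discriminant 2 ^ 6. *)
Definition good_prime (p : nat) : bool := prime p && odd p.

(* For x >= 0, Num.truncn x is the floor of x, so the ordinals below
   (Num.truncn x).+1 are exactly the natural numbers p <= x. *)
Definition count_good_primes (R : realType) (x : R) (Q : pred nat) : nat :=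
  #|[set p : 'I_(Num.truncn x).+1 | good_prime p && Q p]|.

Definition omega_bound (R : realType) (gamma x : R) : R :=
  x * (ln (ln x)) ^+ 5 / (ln x `^ (2 + gamma * ln gamma - gamma)).

(* Main.v *)
(** For p = 3 mod 4 the curve is supersingular and #E(F_p) = p + 1; for p = 1 mod 4
    Jacobsthal sums give p = N(pi) and #E(F_p) = N(pi - 1) for a Gaussian integer pi.
    Fix y = x^(1 / (A log log x)). By Rankin's trick the orders all of whose
    relevant primes are at most y are negligible. Otherwise the order is m P with a prime
    P > y, and for a fixed cofactor m (p + 1 = m P) or mu (pi - 1 = mu rho, N(mu) = m and
    N(rho) = P) Brun's pure sieve, forbidding small prime factors both of P and of p,
    leaves O(x (log log x)^4 / (m (log x)^2)) possibilities, up to a factor depending on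
    the primes dividing m. A second use of Rankin's trick bounds the
    indicator of the condition on omega by (1 + gamma) gamma^omega(m) / (log x)^(gamma log gamma),
    and the sum of gamma^omega(m) / m over the cofactors is O((log x)^gamma).
    In the sums over cofactors the primes 3 mod 4 lead to the function [n = 1] and the
    primes 1 mod 4 to the nontrivial character modulo 4. *)

Require Import Defs.
From mathcomp Require Import all_boot all_order all_algebra.
From mathcomp Require Import all_fingroup all_solvable all_field.
From mathcomp Require Import all_classical all_reals all_analysis.
From mathcomp Require Import zify ring lra.

Import Order.TTheory GRing.Theory Num.Theory.
Local Open Scope ring_scope.

(** * The point count *)

(** Write [t = ln (ln x)]. Rankin's trick at [y = x^(1/(A t))] saves [expR (- A t)], a fixed power
    of [ln x], so [A] has to exceed the target exponent plus the cost of an Euler product. The range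
    left for [P] may then be as short as [y], and products of about [B t] primes below the sieve
    level [W] must stay under a power of it. Hence [ln W] has order [ln x / t^2], and the sieve
    factor [(ln W)^(-2)] is what yields [t^4 / (ln x)^2]. Both residue classes use one planar sieve
    and one family of sums. The arithmetic enters through a character [chi] whose partial sums of
    [chi d / d^s] lie in [[2/3, 1]] for all [s >= 1]; this stands in for the nonvanishing of
    [L(1, chi)] and gives Mertens-type bounds with explicit constants. Cruder prime sums lose a
    factor [e] in the exponent of [ln x]. That is harmless for the choice of [A] and [B], but the
    cofactor sum must have the exact exponent [gamma], so it goes through [deg p / p^s] with [s]
    just above 1. *)

Section QuadraticCharacter.
Variable F : finFieldType.
Hypothesis oddF : odd #|F|.

Let card_half : (#|F| = (#|F|./2).*2.+1)%N.
Proof. by rewrite -[LHS]odd_double_half oddF add1n. Qed.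

Let card_half_gt0 : (0 < #|F|./2)%N.
Proof. by rewrite half_gt0; apply: finNzRing_gt1. Qed.

Lemma odd_card_1_neq_N1 : (1 : F) != -1.
Proof.
rewrite -subr_eq0 opprK; apply/eqP => two0.
have oF : (#[1%R : F]%g %| #|F|)%N by rewrite -cardsT order_dvdG ?inE.
have o2 : (#[1%R : F]%g %| 2)%N by rewrite order_dvdn FinRing.zmodXgE mulr2n two0.
have g1 : gcdn #|F| 2 = 1%N by apply/eqP; rewrite -/(coprime _ _) coprimen2.
have : (#[1%R : F]%g %| gcdn #|F| 2)%N by rewrite dvdn_gcd oF o2.
rewrite g1 dvdn1 order_eq1 => /eqP /eqP; rewrite FinRing.zmod1gE.
by rewrite oner_eq0.
Qed.

(** The quadratic character in the form of Euler's criterion; [#|F|./2] is [(q - 1) / 2] as [q] is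
    odd. *)
Definition qchar (u : F) : int :=
  if u == 0 then 0 else if u ^+ #|F|./2 == 1 then 1 else -1.

Lemma qchar0 : qchar 0 = 0.
Proof. by rewrite /qchar eqxx. Qed.

Lemma qchar1 : qchar 1 = 1.
Proof. by rewrite /qchar oner_eq0 expr1n eqxx. Qed.

Lemma expf_card_pred (u : F) : u != 0 -> u ^+ (#|F|./2).*2 = 1.
Proof.
move=> u0; apply: (mulfI u0); rewrite -exprS mulr1.
by rewrite -card_half expf_card.
Qed.

Lemma expf_half (u : F) : u != 0 -> (u ^+ #|F|./2 == 1) || (u ^+ #|F|./2 == -1).
Proof. by move=> u0; rewrite -sqrf_eq1 -exprM muln2 expf_card_pred. Qed.

Lemma qcharM (u v : F) : qchar (u * v) = qchar u * qchar v.
Proof.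
rewrite /qchar mulf_eq0; case: (eqVneq u 0) => [|u0] /=; first by rewrite mul0r.
case: (eqVneq v 0) => [|v0] /=; first by rewrite mulr0.
have N1 : ((-1 : F) == 1) = false by rewrite eq_sym; apply/negbTE/odd_card_1_neq_N1.
rewrite exprMn; case/orP: (expf_half _ u0) => /eqP ->;
  case/orP: (expf_half _ v0) => /eqP ->; rewrite ?mulr1 ?mul1r ?mulrNN ?mulr1 ?eqxx ?N1 //.
Qed.

Lemma qchar_sqr (u : F) : u != 0 -> qchar (u ^+ 2) = 1.
Proof.
move=> u0; rewrite /qchar sqrf_eq0 (negbTE u0) -exprM mul2n.
by rewrite expf_card_pred // eqxx.
Qed.

Lemma qchar_sq1 (u : F) : u != 0 -> qchar u ^+ 2 = 1.
Proof. by move=> u0; rewrite expr2 -qcharM -expr2 qchar_sqr. Qed.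

Lemma qcharV (u : F) : qchar u^-1 = qchar u.
Proof.
case: (eqVneq u 0) => [->|u0]; first by rewrite invr0.
rewrite -[u^-1](_ : u * (u^-1) ^+ 2 = _); last by rewrite expr2 mulrA mulfV // mul1r.
by rewrite qcharM qchar_sqr ?invr_eq0 // mulr1.
Qed.

Lemma qcharN1 : qchar (-1) = (-1) ^+ #|F|./2.
Proof.
rewrite /qchar oppr_eq0 oner_eq0 -[X in X == 1]signr_odd -[RHS]signr_odd.
case: (odd _); rewrite ?expr0 ?eqxx // expr1 eq_sym.
by rewrite (negbTE odd_card_1_neq_N1).
Qed.

Lemma exists_primitive_root : exists g : F, ((#|F|./2).*2).-primitive_root g.
Proof.
have ch := card_half.
have h0 := card_half_gt0.
have : has ((#|F|./2).*2).-primitive_root (enum (predC1 (0 : F))).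
  apply: has_prim_root.
  - by rewrite double_gt0.
  - apply/allP => u; rewrite mem_enum !inE => u0.
    by apply/unity_rootP/expf_card_pred.
  - exact: enum_uniq.
  - by rewrite -cardE cardC1 [in leqRHS]ch.
by case/hasP => g _ Hg; exists g.
Qed.

Lemma card_sqrt (u : F) : #|[set y : F | y ^+ 2 == u]|%:Z = 1 + qchar u.
Proof.
have ch := card_half.
rewrite /qchar; case: (eqVneq u 0) => [->|u0].
  rewrite (_ : [set y : F | y ^+ 2 == 0] = [set 0]) ?cards1 ?addr0 //.
  by apply/setP => y; rewrite !inE sqrf_eq0.
have h0 := card_half_gt0.
case: ifP => Hu.
  have [g Hg] := exists_primitive_root.
  have [i Hi] := prim_rootP Hg (expf_card_pred u u0).
  (* With [g] of order [q - 1] and [u = g^i], the relation [u^((q-1)/2) = 1] makes [q - 1] divide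
     [i (q - 1) / 2]. *)
  have ev : (2 %| i)%N.
    move: Hu; rewrite Hi -exprM -(prim_order_dvd Hg).
    by move: (nat_of_ord i) => j; rewrite -mul2n dvdn_pmul2r.
  set z := g ^+ (i %/ 2)%N.
  have zu : z ^+ 2 = u by rewrite /z -exprM divnK // -Hi.
  have z0 : z != 0 by apply: contraNneq u0 => z0; rewrite -zu z0 expr0n.
  rewrite (_ : [set y : F | y ^+ 2 == u] = [set z; - z]).
    rewrite cards2 (_ : z != - z) //; apply: contra_neq odd_card_1_neq_N1 => e.
    by apply: (mulIf z0); rewrite mulN1r mul1r.
  apply/setP => y; rewrite !inE -zu eqf_sqr //.
rewrite (_ : [set y : F | y ^+ 2 == u] = finset.set0) ?cards0 ?addrN //.
apply/setP => y; rewrite !inE; apply/negbTE/eqP => yu.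
have y0 : y != 0 by apply: contraNneq u0 => y0; rewrite -yu y0 expr0n.
by move: Hu; rewrite -yu -exprM mul2n expf_card_pred // eqxx.
Qed.

Lemma sum_sqr (f : F -> int) : \sum_k f (k ^+ 2) = \sum_u (1 + qchar u) * f u.
Proof.
rewrite (partition_big (fun k : F => k ^+ 2) predT) //=.
apply: eq_bigr => u _; rewrite -card_sqrt.
rewrite (eq_bigr (fun _ => f u)); last by move=> k /eqP ->.
by rewrite big_const iter_addr addr0 -mulr_natl cardsE natz.
Qed.

Lemma sum_qchar : \sum_u qchar u = 0.
Proof.
have := sum_sqr (fun => 1); under [RHS]eq_bigr do rewrite mulr1.
by rewrite big_split /= => /eqP; rewrite -subr_eq0 opprD addrA subrr add0r oppr_eq0 => /eqP.
Qed.

(** For [a] and [b] distinct, [(a - d) (b - d)] and [(a - d) / (b - d)] have the same character, and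
    [d -> (a - d) / (b - d)] carries the complement of [b] onto the complement of 1. Since the
    character sums to 0, only [- qchar 1] remains. *)
Lemma sum_qchar_shift (a b : F) :
  \sum_d qchar ((a - d) * (b - d)) = (if a == b then #|F|%:Z else 0) - 1.
Proof.
case: eqVneq => [<-|ab].
  rewrite (bigD1 a) //= subrr mul0r qchar0 add0r.
  rewrite (eq_bigr (fun _ => 1)); last first.
    by move=> d da; rewrite -expr2 qchar_sqr // subr_eq0 eq_sym.
  rewrite big_const iter_addr addr0 natz.
  have -> : #|(fun i : F => i != a)| = #|F|.-1 by rewrite -(cardC1 a).
  by rewrite card_half; lia.
rewrite (bigD1 b) //= subrr mulr0 qchar0 !add0r.
have -> : \sum_(d | d != b) qchar ((a - d) * (b - d)) =
          \sum_(v | v != 1) qchar v.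
  rewrite (reindex_onto (fun v : F => (v * b - a) / (v - 1))
             (fun d => (a - d) / (b - d))) /=; last first.
    move=> d db; have bd : b - d != 0 by rewrite subr_eq0 eq_sym.
    have ba : a - b != 0 by rewrite subr_eq0.
    field; rewrite bd /=; apply: contraNneq ba => <-.
    by apply/eqP; ring.
  apply: eq_big => [v|v] /=.
    case: (eqVneq v 1) => [->|v1].
      rewrite subrr invr0 mulr0 !subr0; apply/negbTE/negP => /andP[b0 /eqP].
      by move/(congr1 (fun z => z * b)); rewrite mulfVK 1?eq_sym // mul1r; apply/eqP.
    have v10 : v - 1 != 0 by rewrite subr_eq0.
    have ba : a - b != 0 by rewrite subr_eq0.
    have e1 : (v * b - a) / (v - 1) - b = (b - a) / (v - 1) by field.
    apply/andP; split.
      rewrite -subr_eq0 e1 mulf_neq0 ?invr_eq0 // -opprB oppr_eq0 //.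
    have -> : b - (v * b - a) / (v - 1) = (a - b) / (v - 1) by field.
    have -> : a - (v * b - a) / (v - 1) = v * (a - b) / (v - 1) by field.
    apply/eqP; field; by rewrite v10.
  move=> /andP[vb /eqP Hv].
  rewrite -[v in RHS]Hv !qcharM qcharV //.
by have := sum_qchar; rewrite (bigD1 1) //= qchar1 => /eqP; rewrite addr_eq0 => /eqP ->; rewrite opprK.
Qed.

(** For nonzero [d], minus the trace of Frobenius of [y^2 = x^3 - d x]. *)
Definition jacobsthal (d : F) : int := \sum_x qchar (x * (x ^+ 2 - d)).

Lemma jacobsthal_scale (c k : F) : k != 0 ->
  jacobsthal (c * k ^+ 2) = qchar k * jacobsthal c.
Proof.
move=> k0; rewrite /jacobsthal (reindex_inj (mulfI k0)) mulr_sumr /=.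
apply: eq_bigr => x _.
have -> : k * x * ((k * x) ^+ 2 - c * k ^+ 2) = (k * k ^+ 2) * (x * (x ^+ 2 - c)) by ring.
by rewrite qcharM [qchar (k * _)]qcharM qchar_sqr // mulr1.
Qed.

Hypothesis ev : ~~ odd #|F|./2.

(** Expand the square and sum over [d] first: only pairs with [y = x] or [y = - x] keep a main term,
    and the two contribute equally because [-1] is a square. *)
Lemma jacobsthal_sqr_sum : \sum_d jacobsthal d ^+ 2 = 2 * #|F|%:Z * (#|F|%:Z - 1).
Proof.
have qN1 : qchar (-1) = 1 by rewrite qcharN1 -signr_odd (negbTE ev).
transitivity (\sum_x \sum_y qchar x * qchar y * \sum_d qchar ((x ^+ 2 - d) * (y ^+ 2 - d))).
  rewrite (eq_bigr (fun d => \sum_x \sum_y qchar x * qchar y *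
             qchar ((x ^+ 2 - d) * (y ^+ 2 - d)))); last first.
    move=> d _; rewrite expr2 /jacobsthal mulr_suml; apply: eq_bigr => x _.
    rewrite mulr_sumr; apply: eq_bigr => y _; rewrite !qcharM; ring.
  rewrite exchange_big; apply: eq_bigr => x _; rewrite exchange_big.
  by apply: eq_bigr => y _; rewrite mulr_sumr.
rewrite (eq_bigr (fun x => (if x == 0 then 0 else 2 * #|F|%:Z) - qchar x * \sum_y qchar y)); last first.
  move=> x _.
  rewrite (eq_bigr (fun y => (if x ^+ 2 == y ^+ 2 then qchar x * qchar y * #|F|%:Z else 0)
     - qchar x * qchar y)); last first.
    by move=> y _; rewrite sum_qchar_shift; case: ifP => _; ring.
  rewrite sumrB -mulr_sumr; congr (_ - _).
  case: (eqVneq x 0) => [->|x0].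
    by apply: big1 => y _; rewrite qchar0 !mul0r if_same.
  rewrite -big_mkcond /= (bigD1 x) //= (bigD1 (- x)) /=; last first.
    rewrite sqrrN eqxx /=; apply: contra_neq odd_card_1_neq_N1 => e.
    by apply: (mulIf x0); rewrite mulN1r mul1r.
  rewrite big1 ?addr0; last first.
    move=> y /andP[/andP[/eqP e1 e2] e3]; move: e1; move/eqP; rewrite eqf_sqr.
    by rewrite eq_sym (negbTE e2) /= -eqr_oppLR eq_sym (negbTE e3).
  rewrite -mulN1r qcharM qN1 mul1r -expr2 qchar_sq1 //; ring.
rewrite sum_qchar (bigD1 0) //= eqxx mulr0 subr0 add0r.
rewrite (eq_bigr (fun _ => 2 * #|F|%:Z)); last by move=> x /negbTE ->; rewrite mulr0 subr0.
rewrite big_const iter_addr addr0 -[LHS]mulr_natr natz.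
have -> : #|(fun i : F => i != 0)| = #|F|.-1 by rewrite -(cardC1 (0 : F)).
by congr (_ * _); rewrite card_half; lia.
Qed.

(* Up to sign, [jacobsthal] takes one value on nonzero squares and one on nonsquares,
   so the second moment determines the sum of their squares. *)
Lemma jacobsthal_sum_two_squares :
  exists n, jacobsthal 1 ^+ 2 + jacobsthal n ^+ 2 = 4 * #|F|%:Z.
Proof.
have [n Hn] : exists n, qchar n = -1.
  apply: contrapT => no; have := sum_qchar.
  rewrite (bigD1 1) //= qchar1 => /eqP; rewrite gt_eqF //.
  apply: ltr_pwDl => //; apply: sumr_ge0 => u _.
  rewrite /qchar; case: ifP => // u0; case: ifP => // u1.
  by case: no; exists u; rewrite /qchar u0 u1.
have n0 : n != 0 by apply: contra_eq_neq Hn => ->; rewrite qchar0.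
exists n.
have J0 : jacobsthal 0 = 0.
  rewrite /jacobsthal -[RHS]sum_qchar; apply: eq_bigr => x _.
  rewrite subr0 qcharM; case: (eqVneq x 0) => [->|x0]; first by rewrite qchar0 mul0r.
  by rewrite qchar_sqr // mulr1.
(* As [k] runs over [F], [k^2] hits each nonzero square twice and [n k^2] each nonsquare twice, so
   the two sums together cover every [d] twice. *)
have E : \sum_(k : F) (jacobsthal (1 * k ^+ 2) ^+ 2 + jacobsthal (n * k ^+ 2) ^+ 2)
   = 2 * (\sum_d jacobsthal d ^+ 2).
  rewrite big_split /= (sum_sqr (fun u => jacobsthal (1 * u) ^+ 2)).
  rewrite (sum_sqr (fun u => jacobsthal (n * u) ^+ 2)).
  have nV0 : n^-1 != 0 by rewrite invr_eq0.
  rewrite [X in _ + X](reindex_inj (mulfI nV0)) /= -big_split mulr_sumr /=.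
  apply: eq_bigr => d _.
  rewrite qcharM qcharV Hn mul1r mulVKf //; ring.
move: E; rewrite (bigD1 0) //= expr0n !mulr0 J0 !add0r.
rewrite (eq_bigr (fun _ => jacobsthal 1 ^+ 2 + jacobsthal n ^+ 2)); last first.
  move=> k k0; rewrite !jacobsthal_scale // !exprMn qchar_sq1 //; ring.
rewrite jacobsthal_sqr_sum big_const iter_addr addr0 -[X in X = _ -> _]mulr_natr natz.
have h0 := card_half_gt0.
have -> : #|(fun i : F => i != 0)| = #|F|.-1 by rewrite -(cardC1 (0 : F)).
have -> : #|F|.-1%:Z = #|F|%:Z - 1 by rewrite card_half; lia.
have q0 : (#|F|%:Z - 1) != 0 by rewrite card_half; lia.
move=> e; apply: (mulIf q0); rewrite e; ring.
Qed.

End QuadraticCharacter.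

Lemma card_E_points (F : finFieldType) (oddF : odd #|F|) :
  #|E_points F|%:Z = 1 + #|F|%:Z + jacobsthal F 1.
Proof.
set A := [set xy : F * F | xy.2 ^+ 2 == xy.1 ^+ 3 - xy.1].
have -> : E_points F = None |: (Some @: A).
  apply/setP => -[[x y]|]; rewrite !inE /=.
    apply/idP/imsetP => [H|[[x' y'] H [-> ->]]]; last by move: H; rewrite inE.
    by exists (x, y); rewrite ?inE.
  by [].
rewrite cardsU1 (_ : None \notin _) /=; last by apply/imsetP => -[].
rewrite card_imset; last by move=> u v [].
rewrite PoszD -addrA; congr (_ + _).
rewrite -sum1_card (eq_bigl (fun xy => predT xy.1 && (xy.2 ^+ 2 == xy.1 ^+ 3 - xy.1))); last first.
  by move=> xy; rewrite inE.
rewrite -(pair_big_dep predT (fun x y => y ^+ 2 == x ^+ 3 - x) (fun _ _ => 1%N)) /=.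
rewrite -natz natr_sum /jacobsthal -[X in X + _](_ : \sum_(x : F) 1 = _); last first.
  by rewrite big_const iter_addr addr0 natz.
rewrite -big_split /=; apply: eq_bigr => x _.
have -> : x * (x ^+ 2 - 1) = x ^+ 3 - x by ring.
by rewrite -card_sqrt // sum1_card cardsE natz.
Qed.

(** The substitution [x -> - x] negates every term of the character sum, because [-1] is a
    nonsquare. *)
Lemma card_E_points_3mod4 (F : finFieldType) :
  (#|F| %% 4 = 3)%N -> #|E_points F| = #|F|.+1.
Proof.
move=> H; have oddF : odd #|F| by lia.
have qN1 : qchar F (-1) = -1.
  rewrite qcharN1 // -signr_odd (_ : odd _ = true) //; lia.
suff J : jacobsthal F 1 = 0 by have := card_E_points F oddF; rewrite J; lia.
have : jacobsthal F 1 = - jacobsthal F 1.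
  rewrite {1}/jacobsthal (reindex_inj oppr_inj) /= /jacobsthal -sumrN.
  apply: eq_bigr => x _; rewrite sqrrN mulNr -mulN1r qcharM // qN1 mulN1r //.
by move/eqP; rewrite -subr_eq0 opprK -mulr2n mulrn_eq0 /= => /eqP.
Qed.

(** Squares modulo 4 force both Jacobsthal sums to be even, as their squares add up to [4 q]. Their
    halves are the coordinates of [pi], with the sign of [a] chosen so that [- 2 a], the first-order
    term of [N(pi - 1)], is [jacobsthal F 1]. *)
Lemma card_E_points_1mod4 (F : finFieldType) : (#|F| %% 4 = 1)%N ->
  exists a b : int, a ^+ 2 + b ^+ 2 = #|F|%:Z /\
                    #|E_points F|%:Z = (a - 1) ^+ 2 + b ^+ 2.
Proof.
move=> H; have oddF : odd #|F| by lia.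
have [|n E] := jacobsthal_sum_two_squares F oddF; first by lia.
have := card_E_points F oddF.
move: E; set u := jacobsthal F 1; set v := jacobsthal F n => E ->.
have [[a ua] [b vb]] : (exists a, u = 2 * a) /\ (exists b, v = 2 * b).
  have hu := divz_eq u 2; have hv := divz_eq v 2.
  have [ru|ru] : (u %% 2)%Z = 0 \/ (u %% 2)%Z = 1 by lia.
    have [rv|rv] : (v %% 2)%Z = 0 \/ (v %% 2)%Z = 1 by lia.
      by split; [exists (u %/ 2)%Z | exists (v %/ 2)%Z]; lia.
    by exfalso; move: E; rewrite hu hv ru rv; lia.
  have [rv|rv] : (v %% 2)%Z = 0 \/ (v %% 2)%Z = 1 by lia.
    by exfalso; move: E; rewrite hu hv ru rv; lia.
  by exfalso; move: E; rewrite hu hv ru rv; lia.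
exists (- a), b; move: E; rewrite ua vb => E; split; lia.
Qed.

(** * Euler products *)

Section EulerProducts.
Variable R : realType.
Implicit Types (f : nat -> R) (N n p e m y : nat).

Lemma ler_sum_subset (s1 s2 : seq nat) f : (forall n, 0 <= f n) ->
  uniq s1 -> {subset s1 <= s2} -> \sum_(n <- s1) f n <= \sum_(n <- s2) f n.
Proof.
move=> f0; elim: s1 s2 => [|x s1 IH] s2; first by rewrite big_nil sumr_ge0.
move=> /= /andP[xs us] sub.
have xs2 : x \in s2 by apply: sub; rewrite inE eqxx.
rewrite big_cons (perm_big _ (perm_to_rem xs2)) /= big_cons lerD2l.
apply: IH => // z zs; apply: rem_mem; last by apply: sub; rewrite inE zs orbT.
by apply: contraNneq xs => <-.
Qed.

Lemma prod_prime_recr (G : nat -> R) N :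
  \prod_(0 <= p < N.+1 | prime p) G p =
  (\prod_(0 <= p < N | prime p) G p) * (if prime N then G N else 1).
Proof. by rewrite big_mkcond big_nat_recr //= -big_mkcond. Qed.

Definition smooth y n := all (fun p => p <= y)%N (primes n).

Lemma smoothP y n : (0 < n)%N ->
  reflect (forall p, prime p -> (p %| n)%N -> (p <= y)%N) (smooth y n).
Proof.
move=> n0; apply: (iffP allP) => H p.
  by move=> pp pn; apply: H; rewrite mem_primes pp n0 pn.
by rewrite mem_primes => /and3P[pp _ pn]; apply: H.
Qed.

Lemma smooth0 n : (0 < n)%N -> smooth 0 n -> n = 1%N.
Proof.
move=> n0 /(smoothP _ _ n0) H; apply/eqP; case: (ltngtP n 1) => // n1; first by lia.
have := H _ (pdiv_prime n1) (pdiv_dvd n); have := pdiv_prime n1.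
by move/prime_gt0; lia.
Qed.

Lemma smooth_nonprime y n : ~~ prime y.+1 -> smooth y.+1 n -> smooth y n.
Proof.
move=> np /allP H; apply/allP => p pn; have := H p pn.
rewrite leq_eqVlt => /orP[/eqP e|//]; move: pn; rewrite mem_primes e.
by rewrite (negbTE np).
Qed.

Lemma smooth_prime y n : (0 < n)%N -> prime y.+1 -> smooth y.+1 n ->
  exists m e, [/\ n = (y.+1 ^ e * m)%N, (0 < m)%N, ~~ (y.+1 %| m)%N & smooth y m].
Proof.
move=> n0 pp sm; have [m cm Hn] := pfactor_coprime pp n0.
have m0 : (0 < m)%N by move: n0; rewrite Hn muln_gt0 => /andP[].
have pm : ~~ (y.+1 %| m)%N by rewrite -prime_coprime.
exists m, (logn y.+1 n); split=> //; first by rewrite mulnC.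
apply/smoothP => // q qp qm.
have : (q <= y.+1)%N by apply: (smoothP _ _ n0 sm) => //; rewrite Hn dvdn_mulr.
rewrite leq_eqVlt => /orP[/eqP e|//]; by move: pm; rewrite -e qm.
Qed.

(** A finite Euler product for submultiplicative [f]. Expanding the factors at primes up to [y]
    gives a list containing every [y]-smooth [n <= N]; exponents can stop at [N] because
    [e < p ^ e], and repetitions in the list only increase the sum. *)
Lemma sum_le_euler_product f (F : nat -> nat -> R) N :
  (forall n, 0 <= f n) -> (forall p e, 0 <= F p e) ->
  (forall p e m, prime p -> (0 < e)%N -> (0 < m)%N -> ~~ (p %| m)%N ->
     f (p ^ e * m)%N <= F p e * f m) ->
  \sum_(1 <= n < N.+1) f n <=
  f 1%N * \prod_(0 <= p < N.+1 | prime p) (1 + \sum_(1 <= e < N.+1) F p e).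
Proof.
move=> f0 F0 Ff.
suff [S HS1 HS2] : exists2 S : seq nat,
    (forall n, (0 < n <= N)%N -> smooth N n -> n \in S) &
    \sum_(n <- S) f n <=
    f 1%N * \prod_(0 <= p < N.+1 | prime p) (1 + \sum_(1 <= e < N.+1) F p e).
  apply: le_trans HS2; apply: ler_sum_subset => //; first exact: iota_uniq.
  move=> n; rewrite mem_index_iota ltnS => /andP[n0 nN]; apply: HS1; first by rewrite n0.
  by apply/smoothP => // p pp /(dvdn_leq n0) pn; apply: leq_trans nN.
suff H y : exists S : seq nat,
   [/\ forall n, n \in S -> (0 < n)%N /\ smooth y n,
    (forall n, (0 < n <= N)%N -> smooth y n -> n \in S) &
    \sum_(n <- S) f n <=
    f 1%N * \prod_(0 <= p < y.+1 | prime p) (1 + \sum_(1 <= e < N.+1) F p e)].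
  by have [S [_ H2 H3]] := H N; exists S.
elim: y => [|y [S [HS0 HS1 HS2]]].
  exists [:: 1%N]; split; first by move=> n; rewrite inE => /eqP ->.
    by move=> n /andP[n0 _] /(smooth0 _ n0) ->; rewrite inE.
  by rewrite big_seq1 big_mkcond big_nat1 /= mulr1.
have [pp|np] := boolP (prime y.+1); last first.
  exists S; split.
  - by move=> n /HS0[-> sn]; split=> //; apply/allP => p /(allP sn) /leqW.
  - by move=> n nN /(smooth_nonprime _ _ np); apply: HS1.
  - by rewrite prod_prime_recr (negbTE np) mulr1.
have cop m : m \in S -> ~~ (y.+1 %| m)%N.
  move=> /HS0[m0 /(smoothP _ _ m0) sm]; apply/negP => /(sm _ pp); by rewrite ltnn.
exists [seq (y.+1 ^ e * m)%N | e <- iota 0 N.+1, m <- S]; split.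
- move=> n /allpairsP[[e m] /= [_ mS ->]]; have [m0 sm] := HS0 _ mS.
  have n0 : (0 < y.+1 ^ e * m)%N by rewrite muln_gt0 expn_gt0.
  split=> //; apply/smoothP => // q qp; rewrite Euclid_dvdM // => /orP[|qm].
    by rewrite Euclid_dvdX // => /andP[/dvdn_leq -> //].
  by apply/leqW/(smoothP _ _ m0 sm).
- move=> n /andP[n0 nN] sn; have [m [e [Hn m0 pm sm]]] := smooth_prime _ _ n0 pp sn.
  move: nN; rewrite Hn; set k := (_ * _)%N => kN.
  have k0 : (y.+1 ^ e <= k)%N by rewrite leq_pmulr.
  apply/allpairsP; exists (e, m) => /=; split=> //.
    rewrite -[_ :: _]/(iota 0 N.+1) mem_iota /= add0n ltnS; apply: leq_trans kN; apply: leq_trans k0.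
    by apply/ltnW/ltn_expl/prime_gt1.
  apply: HS1 => //; rewrite m0 /=; apply: leq_trans kN; by rewrite leq_pmull // expn_gt0.
- rewrite big_allpairs_dep prod_prime_recr pp.
  rewrite -[iota 0 N.+1]/(0%N :: iota 1 N) big_cons /=.
  under eq_bigr do rewrite expn0 mul1n.
  rewrite mulrA mulrDr mulr1; apply: lerD => //.
  apply: (@le_trans _ _ (\sum_(1 <= e < N.+1) F y.+1 e * \sum_(m <- S) f m)).
    rewrite /index_iota subn1 /= big_seq [leRHS]big_seq; apply: ler_sum => e.
    rewrite mem_iota => /andP[e0 _]; rewrite mulr_sumr big_seq [leRHS]big_seq.
    by apply: ler_sum => m mS; apply: Ff => //; [case: (HS0 _ mS)|apply: cop].
  by rewrite -mulr_suml mulrC ler_wpM2r // sumr_ge0.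
Qed.

(** The opposite direction: the product expands over squarefree integers, and these are distinct, so
    a sum over all integers up to their maximum dominates it. *)
Lemma squarefree_product_le f (G : nat -> R) y :
  (forall n, 0 <= f n) -> (forall p, prime p -> 0 <= G p) ->
  (forall p m, prime p -> (0 < m)%N -> ~~ (p %| m)%N -> G p * f m <= f (p * m)%N) ->
  exists M, f 1%N * \prod_(0 <= p < y.+1 | prime p) (1 + G p) <=
            \sum_(1 <= n < M.+1) f n.
Proof.
move=> f0 G0 Gf.
suff [S [HS0 HS1 HS2]] : exists S : seq nat,
    [/\ forall n, n \in S -> (0 < n)%N /\ smooth y n, uniq S &
     f 1%N * \prod_(0 <= p < y.+1 | prime p) (1 + G p) <= \sum_(n <- S) f n].
  exists (\max_(n <- S) n); apply: le_trans HS2 _; apply: ler_sum_subset => //.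
  move=> n nS; rewrite mem_index_iota ltnS; have [-> _ /=] := HS0 _ nS.
  exact: leq_bigmax_seq.
elim: y => [|y [S [HS0 HS1 HS2]]].
  exists [:: 1%N]; split=> //; first by move=> n; rewrite inE => /eqP ->.
  by rewrite big_seq1 big_mkcond big_nat1 /= mulr1.
have [pp|np] := boolP (prime y.+1); last first.
  exists S; split => //.
  - by move=> n /HS0[-> sn]; split=> //; apply/allP => p /(allP sn) /leqW.
  - by rewrite prod_prime_recr (negbTE np) mulr1.
have cop m : m \in S -> ~~ (y.+1 %| m)%N.
  move=> /HS0[m0 /(smoothP _ _ m0) sm]; apply/negP => /(sm _ pp); by rewrite ltnn.
exists (S ++ [seq (y.+1 * m)%N | m <- S]); split.
- move=> n; rewrite mem_cat => /orP[/HS0[-> sn]|/mapP[m mS ->]].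
    by split=> //; apply/allP => p /(allP sn) /leqW.
  have [m0 sm] := HS0 _ mS; have n0 : (0 < y.+1 * m)%N by rewrite muln_gt0.
  split=> //; apply/smoothP => // q qp; rewrite Euclid_dvdM // => /orP[|qm].
    by move/dvdn_leq => -> //.
  by apply/leqW/(smoothP _ _ m0 sm).
- rewrite cat_uniq HS1 map_inj_uniq ?HS1 ?andbT /=; last first.
    by move=> a b /eqP; rewrite eqn_pmul2l // => /eqP.
  apply/hasPn => n /mapP[m mS ->]; apply/negP => /cop; by rewrite dvdn_mulr.
- rewrite prod_prime_recr pp mulrA mulrDr mulr1.
  rewrite big_cat big_map /=; apply: lerD => //.
  apply: (@le_trans _ _ (G y.+1 * \sum_(n <- S) f n)).
    by rewrite mulrC ler_wpM2l // G0.
  rewrite mulr_sumr big_seq [leRHS]big_seq; apply: ler_sum => m mS.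
  by apply: Gf => //; [case: (HS0 _ mS)|apply: cop].
Qed.

(* [npow s n] is n^(-s), except that [npow s 0 = 1] since [ln 0 = 0]. *)
Definition npow (s : R) (n : nat) : R := expR (- s * ln n%:R).

Lemma npow_gt0 s n : 0 < npow s n.
Proof. exact: expR_gt0. Qed.

Lemma npow1 s : npow s 1 = 1.
Proof. by rewrite /npow ln1 mulr0 expR0. Qed.

Lemma npowM s m n : (0 < m)%N -> (0 < n)%N -> npow s (m * n) = npow s m * npow s n.
Proof.
by move=> m0 n0; rewrite /npow natrM lnM ?posrE ?ltr0n // mulrDr expRD.
Qed.

Lemma npowX s p e : (0 < p)%N -> npow s (p ^ e) = npow s p ^+ e.
Proof.
move=> p0; elim: e => [|e IH]; first by rewrite expn0 npow1 expr0.
by rewrite expnS npowM ?expn_gt0 ?p0 // IH exprS.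
Qed.

Lemma npow1E n : (0 < n)%N -> npow 1 n = n%:R^-1.
Proof. by move=> n0; rewrite /npow mulN1r expRN lnK // posrE ltr0n. Qed.

Lemma npow_le s r n : (0 < n)%N -> s <= r -> npow r n <= npow s n.
Proof.
move=> n0 sr; rewrite ler_expR ler_wpM2r ?lerN2 //; apply: ln_ge0.
by rewrite ler1n.
Qed.

Lemma ln_le_sub1 (x : R) : 0 < x -> ln x <= x - 1.
Proof. by move=> x0; have := @le_ln1Dx R (x - 1); rewrite (addrC 1) subrK; apply; lra. Qed.

Lemma sum_npow_le (s : R) M : 1 < s ->
  \sum_(1 <= k < M.+1) npow s k <= 1 + 1 / (s - 1).
Proof.
move=> s1; set d := s - 1; have d0 : 0 < d by rewrite /d; lra.
(* [(1 - npow d N.+1) / d] is the integral of [u^(-s)] from 1 to [N + 1]; in this form the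
   comparison of sum and integral is an induction. *)
suff H N : \sum_(1 <= k < N.+2) npow s k <= 1 + (1 - npow d N.+1) / d.
  case: M => [|M]; first by rewrite big_geq // addr_ge0 ?divr_ge0 // ltW.
  apply: le_trans (H M) _; rewrite lerD2l ler_pM2r ?invr_gt0 //.
  by have := npow_gt0 d M.+1; lra.
elim: N => [|N IH]; first by rewrite big_nat1 !npow1 subrr mul0r addr0.
rewrite big_nat_recr //=; apply: le_trans (lerD IH (lexx _)) _.
rewrite -addrA lerD2l -subr_ge0 -(pmulr_lge0 _ d0).
have dn : d != 0 by lra.
have -> : ((1 - npow d N.+2) / d - ((1 - npow d N.+1) / d + npow s N.+2)) * d
   = npow d N.+1 - npow d N.+2 - d * npow s N.+2 by field.
have u0 : 0 < N.+2%:R :> R by rewrite ltr0n.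
have -> : npow s N.+2 = npow d N.+2 / N.+2%:R.
  rewrite -(npow1E N.+2) // /npow -expRD /d; congr expR; ring.
have -> : npow d N.+1 - npow d N.+2 - d * (npow d N.+2 / N.+2%:R) =
   npow d N.+1 - npow d N.+2 * (1 + d / N.+2%:R) by ring.
rewrite subr_ge0; apply: (@le_trans _ _ (npow d N.+2 * expR (d / N.+2%:R))).
  by rewrite ler_wpM2l ?(ltW (npow_gt0 _ _)) // expR_ge1Dx.
rewrite /npow -expRD ler_expR.
have -> : (N.+1%:R : R) = N.+2%:R * (1 - N.+2%:R^-1).
  by rewrite mulrBr mulr1 mulfV ?gt_eqF // -[N.+2%:R]natr1 addrK.
have v0 : 0 < 1 - N.+2%:R^-1 :> R by rewrite subr_gt0 invf_lt1 // ltr1n.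
rewrite lnM ?posrE //; have := ln_le_sub1 _ v0.
set v := N.+2%:R^-1; set l := ln (1 - v); set L := ln _ => H.
rewrite -subr_ge0; have -> : - d * (L + l) - (- d * L + d * v) = d * (- l - v) by ring.
by rewrite mulr_ge0 ?(ltW d0) //; lra.
Qed.

Lemma ln_le_harmonic N : ln N.+1%:R <= \sum_(1 <= k < N.+1) k%:R^-1 :> R.
Proof.
elim: N => [|N IH]; first by rewrite ln1 big_geq.
rewrite big_nat_recr //=; apply: le_trans (lerD IH (lexx _)).
have u0 : 0 < N.+1%:R :> R by rewrite ltr0n.
have -> : (N.+2%:R : R) = N.+1%:R * (1 + N.+1%:R^-1).
  by rewrite mulrDr mulr1 mulfV ?gt_eqF // -natr1.
have v0 : 0 < N.+1%:R^-1 :> R by rewrite invr_gt0.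
rewrite lnM ?posrE ?addr_gt0 // lerD2l le_ln1Dx //.
by apply: lt_trans v0; lra.
Qed.

Lemma sum_inv_sqr_le y : \sum_(0 <= p < y.+1 | prime p) (p%:R^-1) ^+ 2 <= 1 :> R.
Proof.
apply: (@le_trans _ _ (\sum_(2 <= n < y.+2) (n%:R^-1) ^+ 2)).
  rewrite -big_filter; apply: ler_sum_subset; first by move=> n; apply: sqr_ge0.
    by rewrite filter_uniq // iota_uniq.
  move=> n; rewrite mem_filter !mem_index_iota => /andP[/prime_gt1 -> /andP[_ ny]] /=.
  exact: ltnW.
suff H : \sum_(2 <= n < y.+2) (n%:R^-1) ^+ 2 <= 1 - y.+1%:R^-1 :> R.
  apply: le_trans H _; rewrite gerBl invr_ge0 //.
elim: y => [|y IH]; first by rewrite big_geq // invr1 subrr.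
rewrite big_nat_recr //=; apply: le_trans (lerD IH (lexx _)) _.
rewrite -[y.+2%:R]natr1; set u : R := y.+1%:R; have u0 : 0 < u by rewrite ltr0n.
rewrite -subr_ge0.
have -> : 1 - (u + 1)^-1 - (1 - u^-1 + (u + 1)^-1 ^+ 2) = u^-1 * (u + 1)^-1 ^+ 2.
  by field; apply/andP; split; lra.
by rewrite mulr_ge0 ?sqr_ge0 // invr_ge0 ltW.
Qed.

End EulerProducts.

(** * Divisor sums of a quadratic character *)

Section DivisorSums.
Variables (R : realType) (chi : nat -> R).
Implicit Types (N n p e m d k : nat) (s t : R).

(* Satisfied both by the indicator of 1 and by the nontrivial character modulo 4. *)
Record unit_character : Prop := UnitCharacter {
  uchar1 : chi 1%N = 1;
  ucharM : forall m n, chi (m * n)%N = chi m * chi n;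
  uchar_val : forall n, [\/ chi n = -1, chi n = 0 | chi n = 1];
  uchar_sum : forall s N, 1 <= s -> (0 < N)%N ->
    2/3 <= \sum_(1 <= d < N.+1) chi d * npow R s d <= 1 }.

Hypothesis hchi : unit_character.

(* [kappa p e] is the value of [rho] at p^e, and [deg p] its value at p. *)
Definition kappa p e : R := \sum_(j < e.+1) chi p ^+ j.
Definition rho n : R := \sum_(d <- divisors n) chi d.
Definition deg p : R := 1 + chi p.

Lemma deg_ge0 p : 0 <= deg p.
Proof. by rewrite /deg; case: (uchar_val hchi p) => ->; lra. Qed.

Lemma deg_le2 p : deg p <= 2.
Proof. by rewrite /deg; case: (uchar_val hchi p) => ->; lra. Qed.

Lemma ucharX p e : chi (p ^ e)%N = chi p ^+ e.
Proof.
elim: e => [|e IH]; first by rewrite expn0 (uchar1 hchi) expr0.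
by rewrite expnS (ucharM hchi) IH exprS.
Qed.

Lemma kappa1 p : kappa p 1 = deg p.
Proof. by rewrite /kappa !big_ord_recr big_ord0 /= add0r expr0 expr1. Qed.

Lemma kappaS p e : kappa p e.+1 = 1 + chi p * kappa p e.
Proof.
rewrite /kappa big_ord_recl expr0 mulr_sumr; congr (_ + _).
by apply: eq_bigr => i _; rewrite -exprS.
Qed.

Lemma kappa_ge0 p e : 0 <= kappa p e.
Proof.
suff : 0 <= kappa p e /\ (chi p = -1 -> kappa p e <= 1) by case.
elim: e => [|e [IH1 IH2]]; first by rewrite /kappa big_ord1 expr0; split; lra.
rewrite kappaS; case: (uchar_val hchi p) => H; rewrite H; split; lra.
Qed.

Lemma kappa_le p e : kappa p e <= e.+1%:R.
Proof.
rewrite -[X in _ <= X%:R](card_ord e.+1) -sumr_const; apply: ler_sum => j _.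
case: (uchar_val hchi p) => ->; rewrite ?expr1n //; last by rewrite expr0n; case: eqP.
by case: j => j /= _; rewrite -signr_odd; case: (odd j); rewrite ?expr0 ?expr1; lra.
Qed.

(* The constants 5/2 and 35/4 make the induction step an inequality for t <= 3/5. *)
Lemma sum_tail_le t N : 0 <= t <= 3/5 -> (0 < N)%N ->
  \sum_(2 <= e < N.+1) e.+1%:R * t ^+ e <=
  t ^+ 2 * (45/4) - t ^+ N.+1 * (5/2 * N%:R + 35/4).
Proof.
move=> /andP[t0 t1]; case: N => // N _; elim: N => [|N IH].
  by rewrite big_geq //; have := sqr_ge0 t; lra.
rewrite big_nat_recr //=; apply: le_trans (lerD IH (lexx _)) _.
rewrite (exprS _ N.+2); set z := t ^+ N.+2; have z0 : 0 <= z by apply: exprn_ge0.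
set n : R := N%:R; have n0 : 0 <= n by apply: ler0n.
have -> : (N.+1%:R : R) = n + 1 by rewrite -natr1.
have -> : (N.+2%:R : R) = n + 2 by rewrite -addn2 natrD.
have -> : (N.+3%:R : R) = n + 3 by rewrite -addn3 natrD.
rewrite -subr_ge0.
set D := (X in 0 <= X).
have -> : D = z * ((5/2 * (n + 1) + 35/4) - (n + 3) - t * (5/2 * (n + 2) + 35/4)).
  rewrite /D; ring.
apply: mulr_ge0 => //.
have : t * (5 / 2 * (n + 2) + 35 / 4) <= 3/5 * (5 / 2 * (n + 2) + 35 / 4).
  by apply: ler_wpM2r => //; lra.
lra.
Qed.

(** The linear term is kept exact, since it determines the power of the logarithm. The rest is
    bounded through [kappa p e <= e + 1], with [45/4] rounded up to 12, and is summable over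
    primes. *)
Lemma sum_kappa_le p t N : 0 <= t <= 3/5 ->
  \sum_(1 <= e < N.+1) kappa p e * t ^+ e <= deg p * t + 12 * t ^+ 2.
Proof.
move=> t01; have t0 : 0 <= t by case/andP: t01.
have t2 := sqr_ge0 t; have d0 := deg_ge0 p.
case: N => [|N]; first by rewrite big_geq // addr_ge0 ?mulr_ge0.
rewrite big_ltn // kappa1 expr1 lerD2l.
apply: le_trans (_ : \sum_(2 <= e < N.+2) e.+1%:R * t ^+ e <= _).
  by apply: ler_sum => e _; rewrite ler_wpM2r ?exprn_ge0 // kappa_le.
apply: le_trans (sum_tail_le _ _ t01 (ltn0Sn N)) _.
have : 0 <= t ^+ N.+2 * (5 / 2 * N.+1%:R + 35 / 4).
  by rewrite mulr_ge0 ?exprn_ge0 // addr_ge0 ?mulr_ge0 ?ler0n //; lra.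
set z := t ^+ 2 in t2 *; lra.
Qed.

(** By induction on [e]: the divisors of [p^(e+1) m] that do not divide [p^e m] are the [p^(e+1) d]
    with [d] dividing [m]. *)
Lemma rho_pexp p e m : prime p -> (0 < m)%N -> ~~ (p %| m)%N ->
  rho (p ^ e * m) = kappa p e * rho m.
Proof.
move=> pp m0 pm; have p0 := prime_gt0 pp.
elim: e => [|e IH]; first by rewrite expn0 mul1n /kappa big_ord1 expr0 mul1r.
have -> : kappa p e.+1 * rho m = kappa p e * rho m + chi p ^+ e.+1 * rho m.
  by rewrite /kappa big_ord_recr /= mulrDl.
rewrite -IH {1 3}/rho mulr_sumr.
have -> : \sum_(d <- divisors m) chi p ^+ e.+1 * chi d =
   \sum_(d <- [seq (p ^ e.+1 * d)%N | d <- divisors m]) chi d.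
  by rewrite big_map; apply: eq_bigr => d _; rewrite (ucharM hchi) ucharX.
rewrite /rho -big_cat; apply: perm_big.
have P0 k : (0 < p ^ k)%N by rewrite expn_gt0 p0.
have PM k : (0 < p ^ k * m)%N by rewrite muln_gt0 P0.
apply: uniq_perm; first exact: divisors_uniq.
  rewrite cat_uniq divisors_uniq map_inj_uniq ?divisors_uniq ?andbT /=; last first.
    by move=> a b /eqP; rewrite eqn_pmul2l // => /eqP.
  apply/hasPn => d /mapP[d' _ ->]; rewrite -dvdn_divisors //.
  apply/negP => /(dvdn_trans (dvdn_mulr d' (dvdnn _))).
  by rewrite expnSr dvdn_pmul2l // (negbTE pm).
move=> d; rewrite mem_cat -!dvdn_divisors //.
apply/idP/orP => [dv|[dv|/mapP[d' dv ->]]]; last first.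
- by rewrite dvdn_pmul2l // dvdn_divisors.
- by apply: dvdn_trans dv _; rewrite dvdn_pmul2r // dvdn_exp2l.
have d0 : (0 < d)%N by apply: dvdn_gt0 dv.
have [d' cd Hd] := pfactor_coprime pp d0; set k := logn p d in Hd.
have d'm : (d' %| m)%N.
  have : (d' %| p ^ e.+1 * m)%N by apply: dvdn_trans dv; rewrite Hd dvdn_mulr.
  by rewrite Gauss_dvdr // coprime_sym coprimeXl.
have : (k <= e.+1)%N.
  rewrite /k; have := dvdn_leq_log p (PM e.+1) dv.
  by rewrite lognM // pfactorK // (lognE p m) (negbTE pm) !andbF addn0.
rewrite leq_eqVlt => /orP[/eqP ke|ke].
  right; apply/mapP; exists d'; first by rewrite -dvdn_divisors.
  by rewrite Hd ke mulnC.
by left; rewrite Hd mulnC dvdn_mul // dvdn_exp2l.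
Qed.

Lemma rho1 : rho 1 = 1.
Proof. by rewrite /rho (_ : divisors 1 = [:: 1%N]) // big_seq1 (uchar1 hchi). Qed.

Lemma rho_ge0 n : 0 <= rho n.
Proof.
have [->|n0] := posnP n; first by rewrite /rho (_ : divisors 0 = [:: 1%N]) // big_seq1 (uchar1 hchi).
suff H y k : (0 < k)%N -> smooth y k -> 0 <= rho k.
  by apply: (H n) => //; apply/smoothP => // p pp /dvdn_leq; apply.
elim: y k => [|y IH] k k0; first by move/(smooth0 _ k0) => ->; rewrite rho1.
have [pp sk|np /(smooth_nonprime _ _ np)] := boolP (prime y.+1); last exact: IH.
have [m [e [-> m0 pm sm]]] := smooth_prime _ _ k0 pp sk.
by rewrite rho_pexp // mulr_ge0 ?kappa_ge0 // IH.
Qed.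

(* By [uchar_sum] the inner sums lie in [2/3, 1], so the sum of [rho n / n^s] is
   comparable to that of [1 / n^s]. *)
Lemma sum_rho s M : \sum_(1 <= n < M.+1) rho n * npow R s n =
  \sum_(1 <= k < M.+1) npow R s k * \sum_(1 <= d < (M %/ k).+1) chi d * npow R s d.
Proof.
transitivity (\sum_(1 <= n < M.+1) \sum_(1 <= k < M.+1) \sum_(1 <= d < M.+1)
   (if (d * k == n)%N then npow R s k * (chi d * npow R s d) else 0)).
  rewrite big_seq [RHS]big_seq; apply: eq_bigr => n; rewrite mem_index_iota => /andP[n0 nM].
  rewrite exchange_big /= /rho mulr_suml.
  transitivity (\sum_(1 <= d < M.+1 | d \in divisors n) chi d * npow R s n).
    rewrite -[RHS]big_filter; apply: perm_big; apply: uniq_perm.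
    - exact: divisors_uniq.
    - by rewrite filter_uniq // iota_uniq.
    - move=> d; rewrite mem_filter mem_index_iota; case: (boolP (d \in _)) => //= dn.
      rewrite -dvdn_divisors // in dn; rewrite (dvdn_gt0 n0 dn) /= ltnS.
      by apply/esym; apply: leq_trans (dvdn_leq n0 dn) _.
  rewrite big_mkcond big_seq [RHS]big_seq; apply: eq_bigr => d.
  rewrite mem_index_iota => /andP[d0 dM]; rewrite -dvdn_divisors //.
  case: ifP => [/dvdnP[k nk]|dn]; last first.
    rewrite big1_seq // => k _; case: eqP => // e; by rewrite -e dvdn_mulr in dn.
  have k0 : (0 < k)%N by move: n0; rewrite nk muln_gt0 => /andP[].
  rewrite {}nk in n0 nM *; rewrite (bigD1_seq k) ?iota_uniq //=; last first.
    by rewrite mem_index_iota k0 /=; apply: leq_trans nM; rewrite ltnS leq_pmulr.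
  rewrite (mulnC d k) eqxx big1 ?addr0; last first.
    move=> i ik; case: eqP => // e; move: ik.
    by rewrite -(eqn_pmul2l d0) e mulnC eqxx.
  by rewrite npowM //; ring.
rewrite exchange_big /= big_seq [RHS]big_seq; apply: eq_bigr => k; rewrite mem_index_iota => /andP[k0 kM].
rewrite exchange_big mulr_sumr /=.
rewrite [RHS](big_nat_widen _ _ M.+1) ?ltnS ?leq_div // [RHS]big_mkcond.
rewrite big_seq [RHS]big_seq; apply: eq_bigr => d; rewrite mem_index_iota => /andP[d0 dM].
rewrite ltnS leq_divRL //; case: leqP => dk.
  rewrite (bigD1_seq (d * k)%N) ?iota_uniq //=; last first.
    by rewrite mem_index_iota muln_gt0 d0 k0.
  by rewrite eqxx big1 ?addr0 // => i ik; rewrite eq_sym (negbTE ik).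
rewrite big1_seq // => n; rewrite mem_index_iota => /andP[_ /andP[_ nM]].
by case: eqP => // e; move: nM; rewrite -e ltnS leqNgt dk.
Qed.

Lemma prime_inv_le p : prime p -> 0 <= (p%:R^-1 : R) <= 1/2.
Proof.
move=> /prime_gt1 p1; rewrite invr_ge0 ler0n /= div1r lef_pV2 ?posrE ?ltr0n ?(ltnW p1) //.
by rewrite ler_nat.
Qed.

Lemma expR_ge_1DB (u : R) : 0 <= u -> expR (u - u ^+ 2) <= 1 + u.
Proof.
move=> u0; have u1 : 0 < 1 + u by lra.
rewrite -[leRHS]lnK ?posrE // ler_expR.
have := ln_le_sub1 R (1 + u)^-1; rewrite invr_gt0 => /(_ u1); rewrite lnV ?posrE //.
suff : u - u ^+ 2 <= 1 - (1 + u)^-1 by lra.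
rewrite -subr_ge0.
have -> : 1 - (1 + u)^-1 - (u - u ^+ 2) = u ^+ 3 / (1 + u) by field; lra.
by rewrite divr_ge0 ?exprn_ge0 // ltW.
Qed.

Lemma ler_expR_prod (F G : nat -> R) N :
  (forall p, prime p -> 0 <= F p <= expR (G p)) ->
  \prod_(0 <= p < N | prime p) F p <= expR (\sum_(0 <= p < N | prime p) G p).
Proof.
move=> H; elim: N => [|N IH]; first by rewrite !big_geq // expR0.
rewrite big_mkcond [X in expR X]big_mkcond /= !big_nat_recr //= -!big_mkcond expRD /=.
case: ifP => pN; last by rewrite expR0 !mulr1.
have /andP[a b] := H _ pN.
by apply: ler_pM => //; apply: prodr_ge0 => p /H/andP[].
Qed.

Lemma expR_prod_ler (F G : nat -> R) N :
  (forall p, prime p -> expR (G p) <= F p) ->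
  expR (\sum_(0 <= p < N | prime p) G p) <= \prod_(0 <= p < N | prime p) F p.
Proof.
move=> H; elim: N => [|N IH]; first by rewrite !big_geq // expR0.
rewrite big_mkcond [leRHS]big_mkcond /= !big_nat_recr //= -!big_mkcond expRD /=.
case: ifP => pN; last by rewrite expR0 !mulr1.
by apply: ler_pM => //; rewrite ?expR_ge0 // H.
Qed.

(** The upper half of a Mertens estimate. The product of the [1 + deg p / p^s] is at most a sum of
    [rho n / n^s], hence at most a zeta sum. Taking logarithms costs the squares of the
    [deg p / p^s], which sum to at most 4. *)
Lemma sum_deg_npow_le s y : 1 < s ->
  \sum_(0 <= p < y.+1 | prime p) deg p * npow R s p <= ln (1 + 1 / (s - 1)) + 4.
Proof.
move=> s1.
have [|||M HM] := squarefree_product_le R (fun n => rho n * npow R s n)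
  (fun p => deg p * npow R s p) y.
- by move=> n; rewrite mulr_ge0 ?rho_ge0 // ltW ?npow_gt0.
- by move=> p _; rewrite mulr_ge0 ?deg_ge0 // ltW ?npow_gt0.
- move=> p m pp m0 pm; have p0 := prime_gt0 pp.
  have := rho_pexp p 1 m pp m0 pm; rewrite expn1 kappa1 npowM // => ->.
  by rewrite le_eqVlt; apply/orP; left; apply/eqP; ring.
rewrite rho1 npow1 !mul1r in HM.
have H2 : \sum_(1 <= n < M.+1) rho n * npow R s n <= 1 + 1 / (s - 1).
  rewrite sum_rho; apply: le_trans (sum_npow_le R s M s1).
  rewrite big_seq [leRHS]big_seq; apply: ler_sum => k; rewrite mem_index_iota => /andP[k0 kM].
  rewrite -[leRHS]mulr1 ler_wpM2l ?(ltW (npow_gt0 _ _ _)) //.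
  have Mk : (0 < M %/ k)%N by rewrite divn_gt0.
  by have /andP[] := uchar_sum hchi s (M %/ k) (ltW s1) Mk.
have s0 : 0 < 1 + 1 / (s - 1) by rewrite addr_gt0 ?divr_gt0 //; lra.
have : \sum_(0 <= p < y.+1 | prime p) (deg p * npow R s p - (deg p * npow R s p) ^+ 2)
   <= ln (1 + 1 / (s - 1)).
  rewrite -ler_expR lnK ?posrE //; apply: le_trans H2; apply: le_trans HM.
  apply: expR_prod_ler => p pp; apply: expR_ge_1DB.
  by rewrite mulr_ge0 ?deg_ge0 // ltW ?npow_gt0.
rewrite sumrB.
suff : \sum_(0 <= p < y.+1 | prime p) (deg p * npow R s p) ^+ 2 <= 4 by lra.
apply: le_trans (_ : \sum_(0 <= p < y.+1 | prime p) 4 * (p%:R^-1) ^+ 2 <= _).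
  apply: ler_sum => p pp; rewrite exprMn; apply: ler_pM; rewrite ?sqr_ge0 //.
    have := deg_le2 p; have := deg_ge0 p; nra.
  rewrite -npow1E ?prime_gt0 // lerXn2r ?nnegrE ?(ltW (npow_gt0 _ _ _)) //.
  by apply: npow_le; rewrite ?prime_gt0 // ltW.
by rewrite -mulr_sumr; have := sum_inv_sqr_le R y; lra.
Qed.

(** The lower half, at [s = 1]: the sum of [rho n / n] is at least [2/3] of a harmonic sum and is
    bounded above by an Euler product. The constant 13 is 12 for the prime powers plus 1 for
    [ln (2/3) >= -1]. *)
Lemma sum_deg_inv_ge N : (2 < N)%N ->
  ln (ln N%:R) - 13 <= \sum_(0 <= p < N.+1 | prime p) deg p / p%:R.
Proof.
move=> N2; have N0 : (0 < N)%N by lia.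
have lN : 0 < ln N%:R :> R by apply: ln_gt0; rewrite ltr1n; lia.
have := @sum_le_euler_product R (fun n => rho n * npow R 1 n)
   (fun p e => kappa p e * npow R 1 p ^+ e) N.
rewrite rho1 npow1 !mul1r => H.
have {}H : \sum_(1 <= n < N.+1) rho n * npow R 1 n <=
    expR (\sum_(0 <= p < N.+1 | prime p) (deg p / p%:R + 12 * (p%:R^-1) ^+ 2)).
  apply: le_trans (H _ _ _) _.
  - by move=> n; rewrite mulr_ge0 ?rho_ge0 // ltW ?npow_gt0.
  - by move=> p e; rewrite mulr_ge0 ?kappa_ge0 // exprn_ge0 // ltW ?npow_gt0.
  - move=> p e m pp e0 m0 pm; have p0 := prime_gt0 pp.
    rewrite rho_pexp // npowM ?expn_gt0 ?p0 // npowX //.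
    by rewrite le_eqVlt; apply/orP; left; apply/eqP; ring.
  - apply: ler_expR_prod => p pp; have p0 := prime_gt0 pp; apply/andP; split.
      rewrite addr_ge0 // sumr_ge0 // => e _.
      by rewrite mulr_ge0 ?kappa_ge0 // exprn_ge0 // ltW ?npow_gt0.
    apply: le_trans (expR_ge1Dx _); rewrite lerD2l npow1E //.
    apply: sum_kappa_le; have := prime_inv_le p pp; lra.
rewrite sum_rho in H.
have H2 : 2/3 * ln N%:R <= \sum_(1 <= k < N.+1)
     npow R 1 k * (\sum_(1 <= d < (N %/ k).+1) chi d * npow R 1 d).
  apply: (@le_trans _ _ (\sum_(1 <= k < N.+1) 2/3 * k%:R^-1)).
    rewrite -mulr_sumr ler_wpM2l //; apply: le_trans (ln_le_harmonic R N).
    by rewrite ler_ln ?posrE ?ltr0n // ler_nat.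
  rewrite big_seq [leRHS]big_seq; apply: ler_sum => k; rewrite mem_index_iota => /andP[k0 kM].
  rewrite npow1E // mulrC ler_wpM2l ?invr_ge0 //.
  have Mk : (0 < N %/ k)%N by rewrite divn_gt0.
  by have /andP[] := uchar_sum hchi 1 (N %/ k) (lexx _) Mk.
have p23 : 0 < 2/3 * ln N%:R :> R by apply: mulr_gt0 => //; lra.
have := le_trans H2 H; rewrite -[X in X <= _ -> _](@lnK R) // ler_expR.
have -> : ln (2/3 * ln N%:R) = ln (2/3) + ln (ln N%:R) :> R.
  by rewrite lnM // posrE; lra.
have l23 : -1 <= ln (2/3) :> R.
  rewrite -ler_expR lnK ?posrE; last by lra.
  rewrite expRN; apply: le_trans (_ : 2^-1 <= _); last by lra.
  rewrite lef_pV2 ?posrE ?expR_gt0 //; have := expR_ge1Dx (1 : R); lra.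
rewrite big_split /= -mulr_sumr; have := sum_inv_sqr_le R N; lra.
Qed.

End DivisorSums.

(** * Brun's pure sieve *)

Section BoxCounting.

Lemma card_residue L d a : (a < d)%N ->
  (\sum_(u < L) (u %% d == a) = (L + (d - a.+1)) %/ d)%N.
Proof.
move=> ad; have d0 : (0 < d)%N by lia.
elim: L => [|L IH]; first by rewrite big_ord0 add0n divn_small //; lia.
rewrite big_ord_recr /= IH addSn divnS // addnC; congr (_ + _)%N.
have -> : (L + (d - a.+1)).+1 = (L + (d - a))%N by lia.
congr nat_of_bool; apply/idP/idP => [/eqP e|].
  rewrite (divn_eq L d) e -addnA subnKC ?(ltnW ad) // dvdn_add ?dvdn_mull //.
rewrite {1}(divn_eq L d) -addnA dvdn_addr ?dvdn_mull // => /dvdnP[k].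
have := ltn_pmod L d0; move: (L %% d)%N => r rd e.
have : k = 1%N by case: k e => [|[|k]] //=; [lia|nia].
by move=> k1; move: e; rewrite k1; lia.
Qed.

Lemma sum_crt (V : nmodType) (h : nat -> nat -> V) d1 d2 : coprime d1 d2 ->
  (0 < d1)%N -> (0 < d2)%N ->
  \sum_(u < d1 * d2) h (u %% d1)%N (u %% d2)%N = \sum_(a < d1) \sum_(b < d2) h a b.
Proof.
move=> co d10 d20; rewrite pair_bigA /=.
pose f (u : 'I_(d1 * d2)) : 'I_d1 * 'I_d2 :=
  (Ordinal (ltn_pmod u d10), Ordinal (ltn_pmod u d20)).
rewrite (reindex f) //=; apply: onW_bij; apply: inj_card_bij; last first.
  by rewrite card_prod !card_ord.
move=> u v [/eqP e1 /eqP e2]; apply/val_inj => /=.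
have : (u == v %[mod d1 * d2])%N by rewrite chinese_remainder // e1 e2.
by rewrite !modn_small // => /eqP.
Qed.

Lemma sum_crt2 (f g : nat -> nat -> nat) d1 d2 : coprime d1 d2 ->
  (0 < d1)%N -> (0 < d2)%N ->
  (forall u v, f (u %% d1)%N (v %% d1)%N = f u v) ->
  (forall u v, g (u %% d2)%N (v %% d2)%N = g u v) ->
  (\sum_(u < d1 * d2) \sum_(v < d1 * d2) f u v * g u v =
   (\sum_(u < d1) \sum_(v < d1) f u v) * (\sum_(u < d2) \sum_(v < d2) g u v))%N.
Proof.
move=> co d10 d20 pf pg.
transitivity (\sum_(u < d1 * d2) \sum_(a < d1) \sum_(b < d2)
   f (u %% d1) a * g (u %% d2) b)%N.
  apply: eq_bigr => u _.
  rewrite -(sum_crt _ (fun a b => f (u %% d1) a * g (u %% d2) b)%N) //.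
  by apply: eq_bigr => v _; rewrite pf pg.
rewrite (sum_crt _ (fun a' b' => \sum_(a < d1) \sum_(b < d2) f a' a * g b' b)%N) //.
rewrite big_distrlr /=; apply: eq_bigr => a' _; apply: eq_bigr => b' _.
by rewrite big_distrlr.
Qed.

Lemma sum_residues (h : nat -> nat -> nat) L d : (0 < d)%N ->
  (forall u v, h (u %% d)%N (v %% d)%N = h u v) ->
  (\sum_(u < L) \sum_(v < L) h u v =
   \sum_(a < d) \sum_(b < d) h a b *
     ((\sum_(u < L) (u %% d == a)) * (\sum_(v < L) (v %% d == b))))%N.
Proof.
move=> d0 ph.
have one (k : nat -> nat) : (forall u, k (u %% d)%N = k u) ->
   (\sum_(u < L) k u = \sum_(a < d) k a * \sum_(u < L) (u %% d == a))%N.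
  move=> pk; under [RHS]eq_bigr do rewrite big_distrr.
  rewrite exchange_big /=; apply: eq_bigr => u _.
  rewrite (bigD1 (Ordinal (ltn_pmod u d0))) //= eqxx muln1 pk big1 ?addn0 //.
  by move=> a; rewrite -val_eqE /= eq_sym => /negbTE ->; rewrite muln0.
rewrite (one (fun u => \sum_(v < L) h u v)%N); last first.
  move=> u; apply: eq_bigr => v _; by rewrite -ph modn_mod ph.
apply: eq_bigr => a _; rewrite (one (h a)); last first.
  by move=> v; rewrite -ph modn_mod ph.
rewrite big_distrl; apply: eq_bigr => b _ /=; lia.
Qed.

End BoxCounting.

(** * Truncated inclusion-exclusion on a square box *)

Section BrunSieve.
Variables (R : realType) (W L K : nat) (Om : nat -> nat -> nat -> bool).
Hypothesis W0 : (0 < W)%N.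
Hypothesis evK : ~~ odd K.
Hypothesis Om_prime : forall q u v, Om q u v -> prime q && (q <= W)%N.
Hypothesis Om_mod : forall q u v, Om q (u %% q) (v %% q) = Om q u v.

Definition nbad q : nat := (\sum_(u < q) \sum_(v < q) Om q u v)%N.
Definition dens q : R := (nbad q)%:R / q%:R ^+ 2.
Definition unsifted : nat :=
  (\sum_(u < L) \sum_(v < L) ~~ [exists q : 'I_W.+1, Om q u v])%N.

(** The worst case below is four lines modulo [q]: two linear factors for each of the norms of [rho]
    and [1 + mu rho]. *)
Hypothesis nbad_le : forall q, (nbad q <= 4 * q)%N.

Lemma nbad_nonprime q : ~~ (prime q && (q <= W)%N) -> nbad q = 0%N.
Proof.
move=> nq; rewrite /nbad big1 // => u _; rewrite big1 // => v _.
by case: (boolP (Om q u v)) => // /Om_prime e; rewrite e in nq.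
Qed.

Lemma dens_ge0 q : 0 <= dens q.
Proof. by rewrite /dens divr_ge0 ?sqr_ge0. Qed.

Lemma dens_le q : dens q <= 4 / q%:R.
Proof.
have [->|q0] := posnP q; first by rewrite /dens invr0 expr0n invr0 !mulr0.
rewrite /dens ler_pdivrMr ?exprn_gt0 ?ltr0n //.
rewrite expr2 mulrA divfK ?pnatr_eq0 -?lt0n // -natrM ler_nat //.
Qed.

Lemma count_crt (s : seq nat) : uniq s -> {in s, forall q, prime q && (q <= W)%N} ->
  (\sum_(u < \prod_(q <- s) q) \sum_(v < \prod_(q <- s) q) all (fun q => Om q u v) s =
   \prod_(q <- s) nbad q)%N.
Proof.
elim: s => [|q s IH] /=; first by rewrite !big_nil !big_ord1.
move=> /andP[qs us] ps; rewrite !big_cons.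
have ps' : {in s, forall q, prime q && (q <= W)%N}.
  by move=> z zs; apply: ps; rewrite inE zs orbT.
have /andP[pq _] := ps q (mem_head _ _).
have Ps0 : (0 < \prod_(z <- s) z)%N.
  by rewrite big_seq prodn_cond_gt0 // => z /ps'/andP[/prime_gt0 ->].
rewrite -IH // -[RHS](sum_crt2 (fun u v => nat_of_bool (Om q u v))
  (fun u v => nat_of_bool (all (fun z => Om z u v) s))) ?Ps0 ?prime_gt0 //.
- by apply: eq_bigr => u _; apply: eq_bigr => v _; rewrite mulnb.
- rewrite prime_coprime // big_seq; apply/negP => H.
  have {H} : (q %| \prod_(z <- s | z \in s) z)%N := H.
  have : all (fun z => ~~ (q %| z)%N) s.
    apply/allP => z zs; have /andP[pz _] := ps' z zs.
    by rewrite dvdn_prime2 //; apply: contraNneq qs => ->.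
  rewrite -big_seq; elim: (s) => [|z s' IHs] /=; first by rewrite big_nil Euclid_dvd1.
  by move=> /andP[z1 z2]; rewrite big_cons Euclid_dvdM // (negbTE z1) /=; apply: IHs.
- by move=> u v; rewrite Om_mod.
- move=> u v; congr nat_of_bool; apply: eq_in_all => z zs.
  have zd : (z %| \prod_(y <- s) y)%N.
    by rewrite (big_rem z) //= dvdn_mulr.
  by rewrite -Om_mod !modn_dvdm // Om_mod.
Qed.

(** By the Chinese remainder theorem at most [4^k d] classes modulo the product [d] are bad, where
    [k] is the number of primes. Each coordinate meets a class [L / d] times up to an error 1, so
    one class contributes an error of at most [2 L / d + 1]. *)
Lemma count_box (s : seq nat) : uniq s -> {in s, forall q, prime q && (q <= W)%N} ->
  `| (\sum_(u < L) \sum_(v < L) all (fun q => Om q u v) s)%N%:R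
     - L%:R ^+ 2 * \prod_(q <- s) dens q | <=
  4 ^+ size s * (2 * L%:R + W%:R ^+ size s) :> R.
Proof.
move=> us ps; set d := (\prod_(q <- s) q)%N.
have d0 : (0 < d)%N by rewrite /d big_seq prodn_cond_gt0 // => z /ps/andP[/prime_gt0 ->].
have d0R : 0 < d%:R :> R by rewrite ltr0n.
have per u v : all (fun q => Om q (u %% d)%N (v %% d)%N) s = all (fun q => Om q u v) s.
  apply: eq_in_all => z zs; have zd : (z %| d)%N by rewrite /d (big_rem z) //= dvdn_mulr.
  by rewrite -Om_mod !modn_dvdm // Om_mod.
rewrite (sum_residues (fun u v => all (fun q => Om q u v) s) _ _ d0); last first.
  by move=> u v; rewrite per.
have -> : \prod_(q <- s) dens q =
   (\sum_(a < d) \sum_(b < d) all (fun q => Om q a b) s)%N%:R / d%:R ^+ 2 :> R.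
  rewrite count_crt // /d !natr_prod -prodrXl -prodf_div //.
rewrite natr_sum.
have -> : L%:R ^+ 2 * ((\sum_(a < d) \sum_(b < d) all (fun q => Om q a b) s)%N%:R
   / d%:R ^+ 2) = \sum_(a < d) \sum_(b < d) (all (fun q => Om q a b) s)%:R * (L%:R / d%:R) ^+ 2 :> R.
  rewrite natr_sum mulr_suml mulr_sumr; apply: eq_bigr => a _.
  rewrite natr_sum mulr_suml mulr_sumr; apply: eq_bigr => b _.
  by rewrite expr_div_n; ring.
rewrite -sumrB.
have res a : (a < d)%N -> `| (\sum_(u < L) (u %% d == a))%N%:R - L%:R / d%:R | <= 1 :> R.
  move=> ad; rewrite card_residue //.
  set M := (L + _)%N; have H := divn_eq M d; have H2 := ltn_pmod M d0.
  set k := (M %/ d)%N in H *.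
  have lo : (L < k * d + d)%N by rewrite /M in H H2; lia.
  have hi : (k * d <= L + d)%N by rewrite /M in H H2; lia.
  rewrite ler_distl; apply/andP; split.
    rewrite lerBlDr -[X in _ <= _ + X](mulfV (lt0r_neq0 d0R)) ler_pdivrMr //.
    by rewrite mulrDl mulfVK ?lt0r_neq0 // -natrM -natrD ler_nat ltnW.
  rewrite -(ler_pM2r d0R) mulrDl mul1r divfK ?lt0r_neq0 // -natrM -natrD ler_nat //.
apply: (@le_trans _ _ (\sum_(a < d) \sum_(b < d) (all (fun q => Om q a b) s)%:R *
   (2 * (L%:R / d%:R) + 1))).
  apply: le_trans (ler_norm_sum _ _ _) _; apply: ler_sum => a _.
  rewrite natr_sum -sumrB; apply: le_trans (ler_norm_sum _ _ _) _; apply: ler_sum => b _.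
  rewrite natrM -mulrBr normrM ger0_norm // ler_wpM2l // natrM.
  have := res a (ltn_ord a); have := res b (ltn_ord b).
  set x : R := (\sum_(u < L) (u %% d == a))%N%:R; set y : R := (\sum_(v < L) (v %% d == b))%N%:R.
  set l : R := L%:R / d%:R => h1 h2.
  have l0 : 0 <= l by rewrite divr_ge0.
  clearbody l x y.
  have -> : x * y - l ^+ 2 = (x - l) * (y - l) + l * (x - l) + l * (y - l) by ring.
  apply: le_trans (ler_normD _ _) _; apply: le_trans (lerD (ler_normD _ _) (lexx _)) _.
  rewrite !normrM (ger0_norm l0).
  have n1 := normr_ge0 (x - l); have n2 := normr_ge0 (y - l).
  have := ler_pM n1 n2 h2 h1; have := ler_wpM2l l0 h1; have := ler_wpM2l l0 h2; lra.
under eq_bigr do rewrite -mulr_suml.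
rewrite -mulr_suml.
have -> : \sum_(i < d) \sum_(i0 < d) (all (fun q => Om q i i0) s)%:R =
    (\prod_(q <- s) nbad q)%N%:R :> R.
  by rewrite -count_crt // natr_sum; apply: eq_bigr => a _; rewrite natr_sum.
have le1 : ((\prod_(q <- s) nbad q)%N%:R <= 4 ^+ size s * d%:R :> R).
  rewrite /d -natrX -natrM ler_nat; elim: (s) => [|q s' IH] /=; first by rewrite !big_nil.
  rewrite !big_cons expnS; have := leq_mul (nbad_le q) IH; lia.
have le2 : d%:R <= W%:R ^+ size s :> R.
  rewrite -natrX ler_nat /d; elim: (s) ps => [|q s' IH] ps /=; first by rewrite big_nil.
  rewrite big_cons expnS leq_mul //; first by have /andP[] := ps q (mem_head _ _).
  by apply: IH => z zs; apply: ps; rewrite inE zs orbT.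
apply: le_trans (ler_wpM2r _ le1) _; first by rewrite addr_ge0 // mulr_ge0 // divr_ge0.
rewrite -mulrA ler_wpM2l ?exprn_ge0 //.
have -> : d%:R * (2 * (L%:R / d%:R) + 1) = 2 * L%:R + d%:R :> R by field; lra.
by rewrite lerD2l.
Qed.

Lemma alternating_binomial b k :
  \sum_(j < k.+1) (-1) ^+ j * 'C(b.+1, j)%:R = (-1) ^+ k * 'C(b, k)%:R :> R.
Proof.
elim: k => [|k IH]; first by rewrite big_ord1 !bin0.
rewrite big_ord_recr /= IH binS natrD exprS; ring.
Qed.

(** Grouped by size, the sum is a partial alternating sum of binomials, equal to
    [(-1)^K C(b - 1, K)] when [B] has [b > 0] elements; this is nonnegative as [K] is even. *)
Lemma bonferroni (T : finType) (B : {set T}) :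
  (B == finset.set0)%:R <= \sum_(I : {set T} | (#|I| <= K)%N && (I \subset B)) (-1) ^+ #|I| :> R.
Proof.
have -> : \sum_(I : {set T} | (#|I| <= K)%N && (I \subset B)) (-1) ^+ #|I| =
    \sum_(j < K.+1) (-1) ^+ j * 'C(#|B|, j)%:R :> R.
  rewrite (partition_big (fun I : {set T} => inord #|I| : 'I_K.+1) predT) //=.
  apply: eq_bigr => j _.
  rewrite (eq_bigl (fun I : {set T} => I \in [set A : {set T} | A \subset B & #|A| == j])); last first.
    move=> I; rewrite inE; case: (I \subset B); rewrite ?andbF //= andbT.
    apply/andP/eqP => [[IK /eqP <-]|->]; first by rewrite inordK.
    by rewrite -ltnS ltn_ord inord_val.
  rewrite (eq_bigr (fun _ => (-1) ^+ j)); last by move=> I; rewrite inE => /andP[_ /eqP ->].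
  by rewrite sumr_const cards_draws mulr_natr.
rewrite -cards_eq0; case: #|B| => [|b] /=.
  rewrite big_ord_recl big1 ?bin0 ?addr0 ?expr0 ?mulr1 // => i _.
  by rewrite bin_small // mulr0.
by rewrite alternating_binomial -signr_odd (negbTE evK) expr0 mul1r.
Qed.

Lemma sum_sets_prod (T : finType) (g : T -> R) :
  \sum_(I : {set T}) \prod_(q in I) g q = \prod_q (1 + g q).
Proof.
under [RHS]eq_bigr do rewrite addrC.
rewrite bigA_distr; apply: eq_bigr => I _; rewrite big_mkcond /=.
by apply: eq_bigr.
Qed.

Lemma count_subsets (I : {set 'I_W.+1}) : (#|I| <= K)%N ->
  `| (\sum_(u < L) \sum_(v < L) (I \subset [set q : 'I_W.+1 | Om q u v]))%N%:R
     - L%:R ^+ 2 * \prod_(q in I) dens q | <= 4 ^+ K * (2 * L%:R + W%:R ^+ K) :> R.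
Proof.
move=> IK.
have rhs0 : 0 <= 4 ^+ K * (2 * L%:R + W%:R ^+ K) :> R.
  by rewrite mulr_ge0 ?exprn_ge0 // addr_ge0 ?mulr_ge0 ?exprn_ge0.
(* The sets [I] may contain nonprime indices; then both the count and the product of densities are
   0. *)
have [/forall_inP ps|] := boolP [forall q in I, prime (val q)]; last first.
  rewrite negb_forall_in => /exists_inP[q qI nq].
  have nq' : ~~ (prime q && (q <= W)%N) by rewrite (negbTE nq).
  rewrite (bigD1 q) //= /dens (nbad_nonprime _ nq') mul0r mul0r mulr0 subr0.
  rewrite big1 ?normr0 // => u _; rewrite big1 // => v _.
  case: (boolP (_ \subset _)) => // /fintype.subsetP/(_ q qI); rewrite inE => /Om_prime.
  by rewrite (negbTE nq').
set s := [seq val q | q <- enum I].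
have us : uniq s by rewrite map_inj_uniq ?enum_uniq //; apply: val_inj.
have pss : {in s, forall q, prime q && (q <= W)%N}.
  by move=> _ /mapP[q qI ->]; rewrite mem_enum in qI; rewrite ps // -ltnS ltn_ord.
have szs : size s = #|I| by rewrite size_map -cardE.
have -> : \prod_(q in I) dens q = \prod_(q <- s) dens q by rewrite big_map big_enum.
have -> : (\sum_(u < L) \sum_(v < L) (I \subset [set q : 'I_W.+1 | Om q u v]))%N =
   (\sum_(u < L) \sum_(v < L) all (fun q => Om q u v) s)%N.
  apply: eq_bigr => u _; apply: eq_bigr => v _; congr nat_of_bool.
  apply/fintype.subsetP/allP => [H _ /mapP[q qI ->]|H q qI].
    by rewrite mem_enum in qI; have := H q qI; rewrite inE.
  by rewrite inE; apply: H; apply: map_f; rewrite mem_enum.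
apply: le_trans (count_box s us pss) _; rewrite szs.
apply: ler_pM; rewrite ?exprn_ge0 ?addr_ge0 ?mulr_ge0 ?exprn_ge0 //.
  by rewrite ler_eXn2l // ltr1n.
by rewrite lerD2l ler_weXn2l // ler1n.
Qed.

(** Give each set the weight [W^(K - #|I|)], which is at least 1 for those counted. Summed over all
    sets this is [W^K (1 + 1/W)^(W+1)]. *)
Lemma card_small_subsets :
  #|[set I : {set 'I_W.+1} | (#|I| <= K)%N]|%:R <= W%:R ^+ K * expR 2 :> R.
Proof.
have W0R : 0 < W%:R :> R by rewrite ltr0n.
rewrite -sum1_card natr_sum.
apply: (@le_trans _ _ (\sum_(I : {set 'I_W.+1}) W%:R ^+ K * \prod_(q in I) W%:R^-1)).
  rewrite big_mkcond; apply: ler_sum => I _; rewrite inE prodr_const.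
  case: ifP => [IK|_]; last by rewrite mulr_ge0 ?exprn_ge0 // invr_ge0 ltW.
  rewrite -(subnK IK) exprD exprVn -mulrA mulfV ?mulr1; last by rewrite expf_neq0 ?lt0r_neq0.
  by rewrite exprn_ege1 // ler1n.
rewrite -mulr_sumr ler_wpM2l ?exprn_ge0 ?(ltW W0R) //.
rewrite (sum_sets_prod _ (fun=> W%:R^-1)) prodr_const card_ord.
apply: (@le_trans _ _ (expR W%:R^-1 ^+ W.+1)).
  by rewrite lerXn2r ?nnegrE ?expR_ge0 ?expR_ge1Dx // addr_ge0 // invr_ge0 ltW.
rewrite -expRM_natl ler_expR -natr1 mulrDl mul1r mulfV ?lt0r_neq0 //.
have : W%:R^-1 <= 1 :> R by rewrite invf_le1 // ler1n.
lra.
Qed.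

(** The last line collects the errors of the box counts. Completing the truncated sum of densities
    to a full product introduces the sets with more than [K] elements; weighting them by
    [expR (#|I| - K) >= 1] gives the second product. *)
Lemma brun_sieve : unsifted%:R <=
  L%:R ^+ 2 * (\prod_(q < W.+1) (1 - dens q)
               + expR (- K%:R) * \prod_(q < W.+1) (1 + expR 1 * dens q))
  + expR 2 * (4 * W%:R) ^+ K * (2 * L%:R + W%:R ^+ K) :> R.
Proof.
pose bad (u v : nat) := [set q : 'I_W.+1 | Om q u v].
pose c (I : {set 'I_W.+1}) : nat := (\sum_(u < L) \sum_(v < L) (I \subset bad u v))%N.
pose g (I : {set 'I_W.+1}) : R := \prod_(q in I) dens q.
have g0 I : 0 <= g I by apply: prodr_ge0 => q _; apply: dens_ge0.
have step1 : unsifted%:R <= \sum_(I : {set 'I_W.+1} | (#|I| <= K)%N) (-1) ^+ #|I| * (c I)%:R :> R.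
  have -> : \sum_(I : {set 'I_W.+1} | (#|I| <= K)%N) (-1) ^+ #|I| * (c I)%:R =
     \sum_(u < L) \sum_(v < L) \sum_(I : {set 'I_W.+1} | (#|I| <= K)%N && (I \subset bad u v)) (-1) ^+ #|I| :> R.
    rewrite (eq_bigr (fun I : {set 'I_W.+1} => \sum_(u < L) \sum_(v < L)
        (if I \subset bad u v then (-1) ^+ #|I| else 0))); last first.
      move=> I _; rewrite natr_sum mulr_sumr; apply: eq_bigr => u _.
      rewrite natr_sum mulr_sumr; apply: eq_bigr => v _.
      by case: ifP => _; rewrite ?mulr1 ?mulr0.
    rewrite exchange_big; apply: eq_bigr => u _; rewrite exchange_big /=; apply: eq_bigr => v _.
    by rewrite -big_mkcondr.
  rewrite natr_sum; apply: ler_sum => u _; rewrite natr_sum; apply: ler_sum => v _.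
  apply: le_trans (bonferroni _ (bad u v)); rewrite ler_nat.
  rewrite (_ : ~~ _ = (bad u v == finset.set0)) //.
  apply/existsPn/eqP => [H|H q]; last first.
    apply/negP => Hq; have : q \in bad u v by rewrite inE.
    by rewrite H inE.
  by apply/setP => q; rewrite !inE; apply/negbTE.
have step2 : \sum_(I : {set 'I_W.+1} | (#|I| <= K)%N) (-1) ^+ #|I| * (c I)%:R <=
   L%:R ^+ 2 * \sum_(I : {set 'I_W.+1} | (#|I| <= K)%N) (-1) ^+ #|I| * g I +
   expR 2 * (4 * W%:R) ^+ K * (2 * L%:R + W%:R ^+ K) :> R.
  apply: (@le_trans _ _ (\sum_(I : {set 'I_W.+1} | (#|I| <= K)%N)
     (L%:R ^+ 2 * ((-1) ^+ #|I| * g I) + 4 ^+ K * (2 * L%:R + W%:R ^+ K)))).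
    apply: ler_sum => I IK; rewrite -lerBlDl.
    have -> : (-1) ^+ #|I| * (c I)%:R - L%:R ^+ 2 * ((-1) ^+ #|I| * g I) =
       (-1) ^+ #|I| * ((c I)%:R - L%:R ^+ 2 * g I) :> R by ring.
    apply: le_trans (ler_norm _) _; rewrite normrM normrX normrN1 expr1n mul1r.
    exact: count_subsets.
  rewrite big_split /= -mulr_sumr lerD2l sumr_const -[X in X <= _]mulr_natl.
  rewrite [(4 * W%:R) ^+ K]exprMn; have := card_small_subsets; rewrite cardsE => H.
  have := ler_wpM2r (_ : 0 <= 4 ^+ K * (2 * L%:R + W%:R ^+ K)) H.
  rewrite mulr_ge0 ?exprn_ge0 ?addr_ge0 ?mulr_ge0 ?exprn_ge0 // => /(_ isT) H2.
  by apply: le_trans H2 _; rewrite le_eqVlt; apply/orP; left; apply/eqP; ring.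
apply: le_trans step1 _; apply: le_trans step2 _; rewrite lerD2r.
rewrite ler_wpM2l ?sqr_ge0 //.
have -> : \prod_(q < W.+1) (1 - dens q) = \sum_(I : {set 'I_W.+1}) (-1) ^+ #|I| * g I.
  rewrite -(sum_sets_prod _ (fun q : 'I_W.+1 => - dens q)); apply: eq_bigr => I _.
  by rewrite prodrN.
rewrite [in leRHS](bigID (fun I : {set 'I_W.+1} => (#|I| <= K)%N)) /= -addrA lerDl.
rewrite -(sum_sets_prod _ (fun q : 'I_W.+1 => expR 1 * dens q)) mulr_sumr.
rewrite [X in _ <= _ + X](bigID (fun I : {set 'I_W.+1} => (#|I| <= K)%N)) /=.
rewrite addrCA -big_split /=; apply: addr_ge0.
  apply: sumr_ge0 => I _; rewrite mulr_ge0 ?expR_ge0 //.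
  by apply: prodr_ge0 => q _; rewrite mulr_ge0 ?expR_ge0 ?dens_ge0.
apply: sumr_ge0 => I; rewrite -ltnNge => IK.
rewrite big_split /= prodr_const -expRM_natl mulr1 mulrA -expRD -/(g I) -mulrDl.
rewrite mulr_ge0 //.
have : 1 <= expR (- K%:R + #|I|%:R) :> R by rewrite -[X in X <= _]expR0 ler_expR addrC subr_ge0 ler_nat ltnW.
by rewrite -signr_odd; case: (odd _); rewrite ?expr0 ?expr1; lra.
Qed.

End BrunSieve.

(** * Gaussian integers *)

Section TrivialAndQuarticCharacters.
Variable R : realType.

(** Here [rho] is constantly 1 and [deg] is 1 at every prime, so the general bounds become those for
    zeta sums. *)
Definition chi1 (n : nat) : R := (n == 1%N)%:R.

Lemma unit_character_chi1 : unit_character R chi1.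
Proof.
split.
- by [].
- by move=> m n; rewrite /chi1 muln_eq1; do 2 case: (_ == _); rewrite ?mulr0 ?mul0r ?mulr1.
- by move=> n; rewrite /chi1; case: (_ == _); [apply: Or33|apply: Or32].
- move=> s N s1 N0; rewrite big_ltn // npow1 mulr1 big1_seq ?addr0; first by rewrite /chi1 /=; lra.
  move=> d; rewrite mem_index_iota => /andP[_ /andP[d1 _]].
  by rewrite /chi1 (_ : (d == 1%N) = false) ?mul0r //; apply/eqP; lia.
Qed.

(** The character of [Q(i)]: for [n > 0], [4 * rho n] is the number of representations of [n] as a
    sum of two squares. *)
Definition chi4 (n : nat) : R :=
  if (n %% 4 == 1)%N then 1 else if (n %% 4 == 3)%N then -1 else 0.

Lemma unit_character_chi4 : unit_character R chi4.
Proof.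
split.
- by [].
- move=> m n; rewrite /chi4 -modnMm.
  have : (m %% 4 < 4)%N by rewrite ltn_mod.
  have : (n %% 4 < 4)%N by rewrite ltn_mod.
  case: (m %% 4)%N => [|[|[|[|//]]]]; case: (n %% 4)%N => [|[|[|[|//]]]] _ _ /=;
  by rewrite ?mulr0 ?mul0r ?mulr1 ?mul1r ?mulrNN ?mulr1.
- move=> n; rewrite /chi4; case: ifP => _; first exact: Or33.
  by case: ifP => _; [apply: Or31|apply: Or32].
- move=> s N s1 N0.
  pose S M := \sum_(1 <= d < M.+1) chi4 d * npow R s d.
  have SS M : S M.+1 = S M + chi4 M.+1 * npow R s M.+1 by rewrite /S big_nat_recr.
  have dec M M' : (0 < M <= M')%N -> npow R s M' <= npow R s M.
    move=> /andP[M0 MM]; rewrite ler_expR !mulNr lerN2 ler_wpM2l //; first by lra.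
    by rewrite ler_ln ?posrE ?ltr0n ?ler_nat //; lia.
  have c k : [/\ chi4 (4 * k).+1 = 1, chi4 (4 * k).+2 = 0,
                 chi4 (4 * k).+3 = -1 & chi4 (4 * k).+4 = 0].
    have [e1 e2 e3 e4] : [/\ ((4 * k).+1 %% 4 = 1)%N, ((4 * k).+2 %% 4 = 2)%N,
      ((4 * k).+3 %% 4 = 3)%N & ((4 * k).+4 %% 4 = 0)%N] by split; lia.
    by rewrite /chi4 e1 e2 e3 e4.
  (* The partial sums alternate with decreasing steps: those ending in a positive term decrease from
     1, those ending in a negative one increase from [1 - 3^(-s) >= 2/3]. *)
  have P k : S (4 * k)%N + npow R s (4 * k).+1 <= 1 /\
     2/3 <= S (4 * k)%N + npow R s (4 * k).+1 - npow R s (4 * k).+3.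
    elim: k => [|k [I1 I2]].
      rewrite muln0 /S big_geq // npow1 add0r; split=> //.
      have := npow_le R 1 s 3 isT s1; rewrite npow1E //.
      have -> : (3%:R^-1 : R) = 1/3 by rewrite div1r.
      lra.
    have [c1 c2 c3 c4] := c k.
    have -> : (4 * k.+1)%N = (4 * k).+4 by lia.
    rewrite !SS c1 c2 c3 c4; set a1 := npow R s (4 * k).+1 in I1 I2 *; set a3 := npow R s (4 * k).+3 in I1 I2 *.
    have d1 : npow R s (4 * k).+4.+3 <= npow R s (4 * k).+4.+1 by apply: dec; lia.
    have d2 : npow R s (4 * k).+4.+1 <= a3 by apply: dec; lia.
    split; lra.
  rewrite -/(S N); have HN := divn_eq N 4; have := ltn_pmod N (isT : (0 < 4)%N).
  set k := (N %/ 4)%N in HN; move: HN; move: (N %% 4)%N => r HN r4.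
  have [I1 I2] := P k; have [c1 c2 c3 c4] := c k.
  have p1 := npow_gt0 R s (4 * k).+1; have p3 := npow_gt0 R s (4 * k).+3.
  case: r HN r4 => [|[|[|[|//]]]] HN _.
  - case: k HN I1 I2 p1 p3 c1 c2 c3 c4 => [|k] HN _ _ _ _ _ _ _ _; first by lia.
    have [c1 c2 c3 c4] := c k; have [J1 J2] := P k.
    have -> : N = (4 * k).+4 by lia.
    rewrite !SS c1 c2 c3 c4; have := npow_gt0 R s (4 * k).+3; lra.
  - have -> : N = (4 * k).+1 by lia.
    rewrite !SS c1; lra.
  - have -> : N = (4 * k).+2 by lia.
    rewrite !SS c1 c2; lra.
  - have -> : N = (4 * k).+3 by lia.
    rewrite !SS c1 c2 c3; lra.
Qed.

End TrivialAndQuarticCharacters.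

(** * Divisibility in Z[i] and representation numbers *)

Section GaussianIntegers.
Implicit Types (z w : int * int) (n m p e : nat).

Definition gmul z w : int * int := (z.1 * w.1 - z.2 * w.2, z.1 * w.2 + z.2 * w.1).
Definition gnorm z : int := z.1 ^+ 2 + z.2 ^+ 2.
Definition gconj z : int * int := (z.1, - z.2).

Lemma gmulC : commutative gmul.
Proof. by move=> [a b] [c d]; congr (_, _) => /=; ring. Qed.

Lemma gmulA : associative gmul.
Proof. by move=> [a b] [c d] [e f]; congr (_, _) => /=; ring. Qed.

Lemma gnormM z w : gnorm (gmul z w) = gnorm z * gnorm w.
Proof. by case: z w => [a b] [c d]; rewrite /gnorm /=; ring. Qed.

Lemma gnorm_conj z : gnorm (gconj z) = gnorm z.
Proof. by rewrite /gnorm /= sqrrN. Qed.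

Definition irange n : seq int := [seq (i%:Z - n%:Z) | i <- iota 0 (2 * n).+1].
Definition reps n : seq (int * int) :=
  [seq z <- [seq (a, b) | a <- irange n, b <- irange n] | gnorm z == n%:Z].

Lemma mem_irange n (a : int) : (a \in irange n) = (- n%:Z <= a <= n%:Z).
Proof.
apply/mapP/idP => [[i]|H]; first by rewrite mem_iota => Hi ->; lia.
exists (absz (a + n%:Z)); last by lia.
by rewrite mem_iota; lia.
Qed.

Lemma mem_reps n z : (z \in reps n) = (gnorm z == n%:Z).
Proof.
case: z => a b; rewrite mem_filter; apply: andb_idr => /eqP H.
have {}H : a ^+ 2 + b ^+ 2 = n%:Z := H.
by apply/allpairsP; exists (a, b); split; rewrite ?mem_irange //=; nia.
Qed.

Lemma uniq_reps n : uniq (reps n).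
Proof.
have u : uniq (irange n) by rewrite map_inj_uniq ?iota_uniq // => i j; lia.
by rewrite filter_uniq // allpairs_uniq // => -[a b] [c d].
Qed.

Definition nreps n := size (reps n).

Lemma nreps_le (f : int * int -> int * int) n m :
  (forall z, gnorm z = n%:Z -> exists2 w, gnorm w = m%:Z & z = f w) ->
  (nreps n <= nreps m)%N.
Proof.
move=> H; rewrite /nreps -[X in (_ <= X)%N](size_map f); apply: uniq_leq_size; first exact: uniq_reps.
move=> z; rewrite mem_reps => /eqP/H[w wm ->]; apply: map_f.
by rewrite mem_reps wm.
Qed.

(** A Gaussian integer of even norm is a multiple of [1 + i]. *)
Lemma nreps_double m : (nreps (2 * m) <= nreps m)%N.
Proof.
apply: (nreps_le (gmul (1, 1))) => -[a b]; rewrite /gnorm /= => H.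
have [k ka] : exists k, a = b + 2 * k.
  exists ((a - b) %/ 2)%Z; have := divz_eq (a - b) 2.
  have [e|e] : ((a - b) %% 2)%Z = 0 \/ ((a - b) %% 2)%Z = 1 by lia.
    by rewrite e; lia.
  rewrite e => Hab; exfalso; have := congr1 (fun z : int => z) H.
  have -> : a = b + 2 * ((a - b) %/ 2)%Z + 1 by lia.
  by move: (_ %/ _)%Z => k; lia.
exists (b + k, - k); last by rewrite /gmul /= ka; congr (_, _); ring.
by rewrite /= ; nia.
Qed.

(** Otherwise a quotient of the coordinates would be a square root of [-1] modulo [p]. *)
Lemma dvdn_gnorm_3mod4 p z : prime p -> (p %% 4 = 3)%N -> (p %| gnorm z)%Z ->
  (p %| z.1)%Z /\ (p %| z.2)%Z.
Proof.
move=> pp p3; case: z => a b /=; have pc := pchar_Fp pp.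
rewrite !(dvdz_pcharf pc) /gnorm /= rmorphD !rmorphXn /=.
set x := a%:~R : 'F_p; set y := b%:~R : 'F_p.
have card : #|'F_p| = p by apply: card_Fp.
suff H (u v : 'F_p) : u ^+ 2 + v ^+ 2 == 0 -> v == 0.
  by move=> h; split; [apply: (H y); rewrite addrC|apply: (H x)].
move=> uv; case: (eqVneq v 0) => // v0; exfalso.
have oddp : odd #|'F_p| by rewrite card; lia.
have q1 : qchar 'F_p (-1) = 1.
  have -> : -1 = (u / v) ^+ 2 :> 'F_p.
    rewrite expr_div_n; move: uv; rewrite addr_eq0 => /eqP ->.
    by rewrite mulNr divff // expf_neq0.
  apply: qchar_sqr => //; apply/eqP => uv0; move: uv.
  have u0 : u = 0 by rewrite -(divfK v0 u) uv0 mul0r.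
  by rewrite u0 expr0n add0r sqrf_eq0; apply/negP.
move: q1; rewrite qcharN1 // card -signr_odd (_ : odd p./2 = true) //; lia.
Qed.

Lemma nreps_3mod4 p m : prime p -> (p %% 4 = 3)%N -> (nreps (p ^ 2 * m) <= nreps m)%N.
Proof.
move=> pp p3; have p0 := prime_gt0 pp.
apply: (nreps_le (fun w => (p%:Z * w.1, p%:Z * w.2))) => z Hz.
have [] := dvdn_gnorm_3mod4 p z pp p3.
  by rewrite Hz PoszM; apply: dvdz_mulr; rewrite expnS PoszM dvdz_mulr.
move=> /dvdzP[a Ha] /dvdzP[b Hb]; exists (a, b); last by case: z Ha Hb Hz => /= ? ? -> -> _; congr (_, _); lia.
have pz : p%:Z != 0 by lia.
apply: (mulfI (mulf_neq0 pz pz)); move: Hz; rewrite /gnorm /= Ha Hb PoszM -mulnn PoszM => <-; ring.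
Qed.

Lemma nreps_3mod4_odd p m : prime p -> (p %% 4 = 3)%N -> ~~ (p %| m)%N ->
  nreps (p * m) = 0%N.
Proof.
move=> pp p3 pm; apply/eqP; rewrite /nreps -leqn0 leqNgt -has_predT.
apply/negP => /hasP[z]; rewrite mem_reps => /eqP Hz _.
have [] := dvdn_gnorm_3mod4 p z pp p3; first by rewrite Hz PoszM dvdz_mulr.
move=> /dvdzP[a Ha] /dvdzP[b Hb]; move: Hz; rewrite /gnorm Ha Hb => Hz.
have p0 := prime_gt0 pp; have pz : p%:Z != 0 by lia.
have : m%:Z = (a ^+ 2 + b ^+ 2) * p%:Z.
  by apply: (mulfI pz); rewrite -PoszM -Hz; ring.
move=> e; have : (p %| m%:Z)%Z by rewrite e dvdz_mull.
by rewrite dvdzE /= (negbTE pm).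
Qed.

(** Fermat's theorem is a by-product of the Jacobsthal sums over ['F_p]. *)
Lemma prime_1mod4_sum_two_squares p : prime p -> (p %% 4 = 1)%N ->
  exists c d : nat, gnorm (c%:Z, d%:Z) = p%:Z.
Proof.
move=> pp p1; have card := card_Fp pp.
have [a [b [H _]]] : exists a b : int, a ^+ 2 + b ^+ 2 = #|'F_p|%:Z /\
      #|E_points 'F_p|%:Z = (a - 1) ^+ 2 + b ^+ 2.
  by apply: card_E_points_1mod4; rewrite card.
by exists `|a|%N, `|b|%N; rewrite /gnorm /= -card -H; nia.
Qed.

(** This stands in for unique factorization. One of [a c + b d] and [a c - b d], the real parts of
    [z] times the conjugate of [w] and of [z w], is divisible by [p]. The square of the matching
    imaginary part is then divisible by [p] too, so that product is [p z'], and [p = N(w)]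
    cancels. *)
Lemma gauss_prime_divides p w z : prime p -> gnorm w = p%:Z -> (p %| gnorm z)%Z ->
  exists z', z = gmul w z' \/ z = gmul (gconj w) z'.
Proof.
move=> pp wp pz; have p0 := prime_gt0 pp; have pnz : p%:Z != 0 by lia.
case: w z wp pz => [c d] [a b]; rewrite /gnorm /= => wp pz.
have key (d' : int) : d' ^+ 2 = d ^+ 2 -> (p %| a * c + b * d')%Z ->
    exists z', (a, b) = gmul (c, d') z'.
  move=> dd /dvdzP[u Hu].
  have : (p %| (b * c - a * d') ^+ 2)%Z.
    have -> : (b * c - a * d') ^+ 2 = (a ^+ 2 + b ^+ 2) * (c ^+ 2 + d' ^+ 2) - (a * c + b * d') ^+ 2 by ring.
    by rewrite dd wp Hu rpredB // ?dvdz_mull // exprMn dvdz_mull // dvdz_exp.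
  rewrite expr2 dvdzE abszM Euclid_dvdM // orbb -dvdzE => /dvdzP[v Hv].
  exists (u, v); rewrite /gmul /=; congr (_, _); apply: (mulIf pnz).
    have -> : (c * u - d' * v) * p%:Z = c * (u * p%:Z) - d' * (v * p%:Z) by ring.
    by rewrite -Hu -Hv -wp -dd; ring.
  have -> : (c * v + d' * u) * p%:Z = c * (v * p%:Z) + d' * (u * p%:Z) by ring.
  by rewrite -Hu -Hv -wp -dd; ring.
have : (p %| (a * c + b * d) * (a * c + b * - d))%Z.
  have -> : (a * c + b * d) * (a * c + b * - d) =
     a ^+ 2 * (c ^+ 2 + d ^+ 2) - d ^+ 2 * (a ^+ 2 + b ^+ 2) by ring.
  by rewrite wp rpredB // dvdz_mull.
rewrite dvdzE abszM Euclid_dvdM // => /orP[h|h].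
  by have [z' Hz] := key d erefl h; exists z'; left.
have [z' Hz] := key (- d) (sqrrN d) h; by exists z'; right.
Qed.

(** The prime factor is given nonnegative coordinates because the sieve works on the box [[0, L)^2].
    In the conjugate case [c - i d = - i (d + i c)], and the unit moves into the cofactor. *)
Lemma gauss_factor p m z : prime p -> (p %% 4 = 1)%N -> gnorm z = (m * p)%N%:Z ->
  exists w (c d : nat), [/\ gnorm (c%:Z, d%:Z) = p%:Z, gnorm w = m%:Z &
                           z = gmul w (c%:Z, d%:Z)].
Proof.
move=> pp p1 Hz; have [c [d cd]] := prime_1mod4_sum_two_squares p pp p1.
have p0 := prime_gt0 pp; have pnz : p%:Z != 0 by lia.
have nw w : gnorm (gmul w (c%:Z, d%:Z)) = (m * p)%N%:Z -> gnorm w = m%:Z.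
  by rewrite gnormM cd PoszM => /(mulIf pnz).
have [|z' [e|e]] := gauss_prime_divides p (c%:Z, d%:Z) z pp cd; first by rewrite Hz PoszM dvdz_mull.
  exists z', c, d; rewrite e gmulC; split=> //; apply: nw.
  by rewrite -gmulC -e.
have e2 : z = gmul (gmul (0, -1) z') (d%:Z, c%:Z).
  by rewrite e /gmul /=; congr (_, _); ring.
have dc : gnorm (d%:Z, c%:Z) = p%:Z by rewrite -cd /gnorm /= addrC.
exists (gmul (0, -1) z'), d, c; split=> //.
by apply: (mulIf pnz); rewrite -{1}dc -gnormM -e2 Hz PoszM.
Qed.

Definition gexp w k : int * int := iter k (gmul w) (1, 0).

(** [i] records how many of the [e] factors of norm [p] are [w] rather than its conjugate. Units
    stay inside [z'], so they add nothing to the [e + 1] choices. *)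
Lemma reps_1mod4 p w m e z : prime p -> gnorm w = p%:Z -> gnorm z = (p ^ e * m)%N%:Z ->
  exists i z', [/\ (i <= e)%N, gnorm z' = m%:Z &
    z = gmul (gmul (gexp w i) (gexp (gconj w) (e - i))) z'].
Proof.
move=> pp wp; have p0 := prime_gt0 pp; have pnz : p%:Z != 0 by lia.
elim: e z => [|e IH] z Hz.
  exists 0%N, z; rewrite Hz mul1n; split=> //.
  by case: z {Hz} => a b; rewrite /gmul /=; congr (_, _); ring.
have [|z' [E|E]] := gauss_prime_divides p w z pp wp.
- by rewrite Hz expnS -mulnA PoszM dvdz_mulr.
- have /IH[i [z2 [Hi Hz2 E2]]] : gnorm z' = (p ^ e * m)%N%:Z.
    by apply: (mulfI pnz); rewrite -{1}wp -gnormM -E Hz expnS -mulnA PoszM.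
  exists i.+1, z2; split=> //.
  by rewrite E E2 subSS /= !gmulA.
- have /IH[i [z2 [Hi Hz2 E2]]] : gnorm z' = (p ^ e * m)%N%:Z.
    by apply: (mulfI pnz); rewrite -{1}wp -(gnorm_conj w) -gnormM -E Hz expnS -mulnA PoszM.
  exists i, z2; split=> //; first exact: leqW.
  rewrite E E2 subSn //=.
  by rewrite [in RHS](gmulA (gexp w i)) [in RHS](gmulC (gexp w i)) !gmulA.
Qed.

Lemma nreps_1mod4 p e m : prime p -> (p %% 4 = 1)%N -> (nreps (p ^ e * m) <= e.+1 * nreps m)%N.
Proof.
move=> pp p1; have [c [d cd]] := prime_1mod4_sum_two_squares p pp p1.
pose w : int * int := (c%:Z, d%:Z).
pose U := [seq gmul (gmul (gexp w i) (gexp (gconj w) (e - i))) z' | i <- iota 0 e.+1, z' <- reps m].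
have -> : (e.+1 * nreps m = size U)%N by rewrite size_allpairs size_iota.
apply: uniq_leq_size; first exact: uniq_reps.
move=> z; rewrite mem_reps => /eqP /(reps_1mod4 _ w _ _ _ pp cd)[i [z' [ie Hz' ->]]].
by apply/allpairsP; exists (i, z'); rewrite mem_iota mem_reps Hz'; split.
Qed.

(** The local factor follows the splitting of [p] in Z[i]: [e + 1] if split, 1 or 0 by the parity of
    [e] if inert, 1 if ramified. *)
Lemma nreps_pexp (R : realType) p e m : prime p -> ~~ (p %| m)%N ->
  (nreps (p ^ e * m))%:R <= kappa R (chi4 R) p e * (nreps m)%:R.
Proof.
move=> pp pm.
have [p1|p1] := eqVneq (p %% 4)%N 1%N.
  have -> : kappa R (chi4 R) p e = e.+1%:R.
    rewrite /kappa /chi4 p1 eqxx; under eq_bigr do rewrite expr1n.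
    by rewrite sumr_const card_ord.
  by rewrite -natrM ler_nat; apply: nreps_1mod4.
have [p3|p3] := eqVneq (p %% 4)%N 3%N.
  have [k Hk] : exists k, e = k.*2 \/ e = k.*2.+1.
    by exists e./2; have := odd_double_half e; case: (odd e); lia.
  have kap j : kappa R (chi4 R) p j = (~~ odd j)%:R.
    elim: j => [|j IH]; first by rewrite /kappa big_ord1 expr0.
    by rewrite kappaS IH /chi4 p3 /=; case: (odd j) => /=; ring.
  have iter_le j n : (nreps (p ^ j.*2 * n) <= nreps n)%N.
    elim: j => [|j IH]; first by rewrite mul1n.
    by rewrite doubleS -addn2 addnC expnD -mulnA; apply: leq_trans (nreps_3mod4 _ _ pp p3) IH.
  rewrite kap; case: Hk => ->; rewrite /= odd_double /= ?mul1r ?mul0r ?ler_nat //.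
  have := iter_le k (p * m)%N; rewrite (nreps_3mod4_odd p m) // leqn0 mulnA -expnSr => /eqP ->.
  by [].
have p2 : p = 2%N.
  suff : (2 %| p)%N by rewrite dvdn_prime2 // => /eqP.
  have := divn_eq p 4; have := ltn_pmod p (isT : (0 < 4)%N).
  by move: p1 p3; case: (p %% 4)%N => [|[|[|[|//]]]] //= _ _ _ e1; rewrite e1; lia.
have -> : kappa R (chi4 R) p e = 1.
  by case: e => [|e]; rewrite ?kappaS /kappa ?big_ord1 ?expr0 // /chi4 p2 /= mul0r addr0.
rewrite mul1r ler_nat p2; elim: e => [|e IH]; first by rewrite mul1n.
by rewrite expnS -mulnA; apply: leq_trans (nreps_double _) IH.
Qed.

End GaussianIntegers.

(** * Weighted sums over integers *)

Section WeightedSums.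
Variables (R : realType) (chi : nat -> R) (K : nat -> nat).
Hypothesis hchi : unit_character R chi.
Hypothesis HK : forall p e m, prime p -> ~~ (p %| m)%N ->
  (K (p ^ e * m))%:R <= kappa R chi p e * (K m)%:R.
Local Notation E := (expR 1 : R).

(** For [p <= Y] and [s = 1 + 1 / ln Y] one has [1 / p <= e / p^s]. The factor [e] lost here is one
    of the two in each [E ^+ 2] of the constants below. *)
Lemma sum_prime_inv_le Y : (1 < Y)%N ->
  \sum_(0 <= p < Y.+1 | prime p) p%:R^-1 <= E * (ln (1 + ln Y%:R) + 4).
Proof.
move=> Y1; have lY : 0 < ln Y%:R :> R by rewrite ln_gt0 // ltr1n.
pose s : R := 1 + (ln Y%:R)^-1.
have s1 : 1 < s by rewrite /s ltrDl invr_gt0.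
have := sum_deg_npow_le R (chi1 R) (unit_character_chi1 R) s Y s1.
have -> : 1 / (s - 1) = ln Y%:R by rewrite /s addrAC subrr add0r div1r invrK.
move=> H; have E0 : 0 < E by exact: expR_gt0.
apply: le_trans (ler_wpM2l (ltW E0) H); rewrite mulr_sumr.
rewrite big_nat_cond [leRHS]big_nat_cond; apply: ler_sum => p /andP[/andP[_ pY] pp].
have p0 := prime_gt0 pp.
rewrite /deg /chi1 (_ : (p == 1%N) = false); last by apply/eqP => p1; rewrite p1 in pp.
rewrite addr0 mul1r -npow1E // /npow -expRD ler_expR /s.
have -> : 1 + - (1 + (ln Y%:R)^-1) * ln p%:R = -1 * ln p%:R + (1 - ln p%:R / ln Y%:R) :> R by ring.
rewrite lerDl subr_ge0 ler_pdivrMr // mul1r ler_ln ?posrE ?ltr0n ?ler_nat //.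
by move: pY; lia.
Qed.

(* Primes with [deg p = 0] are left unrestricted: in the Gaussian case these are the
   primes 3 mod 4, which divide a norm to an even power only. *)
Definition chi_smooth Y n := all (fun p => (deg R chi p == 0) || (p <= Y)%N) (primes n).

Lemma primes_pexp p e m : prime p -> (0 < e)%N -> (0 < m)%N -> ~~ (p %| m)%N ->
  perm_eq (primes (p ^ e * m)) (p :: primes m).
Proof.
move=> pp e0 m0 pm; apply: uniq_perm; first exact: primes_uniq.
  by rewrite /= primes_uniq andbT mem_primes (negbTE pm) !andbF.
have pe0 : (0 < p ^ e)%N by rewrite expn_gt0 prime_gt0.
by move=> q; rewrite primesM // primesX // primes_prime // !inE.
Qed.

Lemma sum_smooth_le X Y (eta : R) : (0 < X)%N -> 0 < eta <= 1/4 -> eta * ln Y%:R <= 1 ->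
  \sum_(1 <= n < X.+1 | chi_smooth Y n) (K n)%:R <=
  expR ((1 - eta) * ln X%:R) *
  ((K 1)%:R * expR (2 * E * \sum_(0 <= p < Y.+1 | prime p) p%:R^-1 + 36)).
Proof.
move=> X0 /andP[eta0 eta4] etaY.
(* Rankin's trick: 1 <= (X / n)^(1 - eta) for n <= X. *)
pose s := 1 - eta.
pose f n : R := (chi_smooth Y n)%:R * (K n)%:R * npow R s n.
pose F p e : R := ((deg R chi p == 0) || (p <= Y)%N)%:R * (kappa R chi p e * npow R s p ^+ e).
have E0 : 0 < E by exact: expR_gt0.
have f0 n : 0 <= f n by rewrite /f !mulr_ge0 // ltW ?npow_gt0.
have F0 p e : 0 <= F p e.
  by rewrite /F mulr_ge0 // mulr_ge0 ?kappa_ge0 // exprn_ge0 // ltW ?npow_gt0.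
apply: (@le_trans _ _ (expR (s * ln X%:R) * \sum_(1 <= n < X.+1) f n)).
  rewrite mulr_sumr big_mkcond big_seq [leRHS]big_seq; apply: ler_sum => n.
  rewrite mem_index_iota => /andP[n0 nX]; case: ifP => [sn|_]; last first.
    by rewrite mulr_ge0 ?expR_ge0.
  rewrite /f sn mul1r mulrCA -[leLHS]mulr1 ler_wpM2l // /npow -expRD.
  rewrite -[leLHS]expR0 ler_expR mulNr subr_ge0 ler_wpM2l //; first by rewrite /s; lra.
  by rewrite ler_ln ?posrE ?ltr0n // ler_nat.
rewrite ler_wpM2l ?expR_ge0 //.
have f1 : f 1%N = (K 1)%:R by rewrite /f npow1 /chi_smooth /= mul1r mulr1.
have Ff p e m : prime p -> (0 < e)%N -> (0 < m)%N -> ~~ (p %| m)%N ->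
    f (p ^ e * m)%N <= F p e * f m.
  move=> pp e0 m0 pm; have p0 := prime_gt0 pp.
  have pe0 : (0 < p ^ e)%N by rewrite expn_gt0 p0.
  rewrite /f /F.
  have -> : chi_smooth Y (p ^ e * m) = ((deg R chi p == 0) || (p <= Y)%N) && chi_smooth Y m.
    by rewrite /chi_smooth (perm_all _ (primes_pexp p e m pp e0 m0 pm)).
  rewrite npowM // npowX //.
  case: (_ || _); case: (chi_smooth Y m) => /=; rewrite ?mul0r ?mulr0 ?mul1r //.
  have -> : kappa R chi p e * npow R s p ^+ e * ((K m)%:R * npow R s m) =
     kappa R chi p e * (K m)%:R * (npow R s p ^+ e * npow R s m) by ring.
  rewrite ler_wpM2r ?HK // mulr_ge0 ?exprn_ge0 // ltW ?npow_gt0 //.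
apply: le_trans (sum_le_euler_product R f F X f0 F0 Ff) _; rewrite f1 ler_wpM2l //.
pose G p : R := (if (p <= Y)%N then 2 * E * p%:R^-1 else 0) + 12 * npow R s p ^+ 2.
apply: (@le_trans _ _ (expR (\sum_(0 <= p < X.+1 | prime p) G p))).
  apply: ler_expR_prod => p pp; have p0 := prime_gt0 pp.
  have t0 := npow_gt0 R s p; set t := npow R s p in t0 *.
  apply/andP; split; first by rewrite addr_ge0 // sumr_ge0.
  apply: le_trans (expR_ge1Dx _); rewrite lerD2l.
  have G0 : 0 <= G p.
    rewrite /G addr_ge0 //; last by rewrite mulr_ge0 // sqr_ge0.
    by case: ifP => // _; rewrite mulr_ge0 ?invr_ge0 // mulr_ge0 // ltW.
  rewrite /F; have [al|_] := boolP (_ || _); last first.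
    by rewrite big1 // => e _; rewrite mul0r.
  under eq_bigr do rewrite mul1r.
  (* [eta <= 1/4] is chosen for this: [2^(-3/4)] is just below [3/5], as [1/8 <= (3/5)^4]. *)
  have t35 : 0 <= t <= 3/5.
    rewrite (ltW t0) /=; apply: (@le_trans _ _ (npow R (3/4) 2)).
      apply: (@le_trans _ _ (npow R (3/4) p)); first by apply: npow_le => //; rewrite /s; lra.
      rewrite ler_expR !mulNr lerN2 ler_wpM2l //.
      by rewrite ler_ln ?posrE ?ltr0n // ler_nat prime_gt1.
    have n0 : 0 <= npow R (3/4) 2 by rewrite ltW ?npow_gt0.
    rewrite -(@ler_pXn2r _ 4) ?nnegrE //.
    have -> : npow R (3/4) 2 ^+ 4 = npow R 1 2 ^+ 3.
      by rewrite /npow -!expRM_natl; congr expR; lra.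
    by rewrite npow1E // ; lra.
  apply: le_trans (sum_kappa_le R chi hchi p t X t35) _; rewrite /G -/t lerD2r.
  have d0 := deg_ge0 R chi hchi p; have d2 := deg_le2 R chi hchi p.
  case: ifP al => [pY _|pY]; last by rewrite orbF => /eqP ->; rewrite mul0r.
  apply: (@le_trans _ _ (2 * t)); first by rewrite ler_wpM2r // ltW.
  rewrite -mulrA ler_wpM2l // -npow1E // /t /npow -expRD ler_expR /s.
  have -> : - (1 - eta) * ln p%:R = - ln p%:R + eta * ln p%:R by ring.
  rewrite mulN1r addrC lerD2r; apply: le_trans etaY; rewrite ler_wpM2l ?(ltW eta0) //.
  by rewrite ler_ln ?posrE ?ltr0n ?ler_nat //; apply: leq_trans pY.
rewrite ler_expR big_split /=; apply: lerD.
  rewrite -big_mkcondr mulr_sumr -big_filter -[leRHS]big_filter.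
  have := ler_sum_subset R [seq i <- index_iota 0 X.+1 | prime i && (i <= Y)%N]
    [seq i <- index_iota 0 Y.+1 | prime i] (fun i => 2 * E * i%:R^-1).
  apply.
  - by move=> n; rewrite mulr_ge0 ?invr_ge0 // mulr_ge0 // ltW.
  - by rewrite filter_uniq // iota_uniq.
  - by move=> n; rewrite !mem_filter !mem_index_iota => /andP[/andP[-> nY] _] /=; rewrite ltnS.
(* Since [2 s >= 3/2], the zeta bound [1 + 1 / (1/2) = 3] applies; with the factor 12 it gives the
   36. *)
have : \sum_(0 <= p < X.+1 | prime p) npow R s p ^+ 2 <= 3.
  apply: (@le_trans _ _ (\sum_(0 <= p < X.+1 | prime p) npow R (3/2) p)).
    apply: ler_sum => p pp; rewrite /npow -expRM_natl ler_expR.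
    have : 0 <= ln p%:R :> R by rewrite ln_ge0 // ler1n prime_gt0.
    by rewrite /s; nra.
  apply: le_trans (_ : _ <= \sum_(1 <= n < X.+1) npow R (3/2) n) _.
    rewrite -big_filter; apply: ler_sum_subset; first by move=> n; rewrite ltW ?npow_gt0.
      by rewrite filter_uniq // iota_uniq.
    by move=> n; rewrite mem_filter !mem_index_iota => /andP[/prime_gt0 -> /andP[_ ->]].
  have h : 1 / (3/2 - 1) = 2 :> R by rewrite (_ : 3/2 - 1 = 2^-1 :> R) ?div1r ?invrK //; lra.
  by have := sum_npow_le R (3/2) X; rewrite h => H; apply: le_trans (H _) _; lra.
by rewrite -mulr_sumr; lra.
Qed.

(* The price for not sieving by the primes dividing m. *)
Definition sieve_loss (m : nat) : R := expR (\sum_(q <- primes m) 4 / q%:R).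

Lemma expR_le_chord (v : R) : 0 <= v -> expR v <= 1 + v * expR v.
Proof.
move=> v0; have := expR_ge1Dx (- v); rewrite expRN.
have e0 := expR_gt0 v => H.
have := ler_wpM2r (ltW e0) H; rewrite mulVf ?lt0r_neq0 // mulrDl mul1r mulNr; lra.
Qed.

Lemma sum_weighted_le X (z : R) : (2 < X)%N -> 0 < z ->
  \sum_(1 <= m < X.+1) (K m)%:R * z ^+ omega m * sieve_loss m / m%:R <=
  E * ((K 1)%:R * expR (z * (ln (1 + ln X%:R) + 4) + z * (20 * expR 2))).
Proof.
(* Rankin's trick again: 1 / n <= e / n^s with s = 1 + 1 / ln X, for n <= X. *)
move=> X2 z0; have lX : 0 < ln X%:R :> R by rewrite ln_gt0 // ltr1n; lia.
pose s : R := 1 + (ln X%:R)^-1.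
have s1 : 1 < s by rewrite /s ltrDl invr_gt0.
have E0 : 0 < E by exact: expR_gt0.
pose f n : R := (K n)%:R * z ^+ omega n * sieve_loss n * npow R s n.
pose F p e : R := z * expR (4 / p%:R) * (kappa R chi p e * npow R s p ^+ e).
have f0 n : 0 <= f n.
  by rewrite /f !mulr_ge0 ?exprn_ge0 ?expR_ge0 // ?ltW // npow_gt0.
have zE p : 0 <= z * expR (4 / p%:R) by rewrite mulr_ge0 ?expR_ge0 // ltW.
have F0 p e : 0 <= F p e.
  by rewrite /F mulr_ge0 // mulr_ge0 ?kappa_ge0 // exprn_ge0 // ltW ?npow_gt0.
apply: (@le_trans _ _ (E * \sum_(1 <= n < X.+1) f n)).
  rewrite mulr_sumr big_seq [leRHS]big_seq; apply: ler_sum => n.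
  rewrite mem_index_iota => /andP[n0 nX]; rewrite /f mulrCA ler_wpM2l //.
    by rewrite !mulr_ge0 ?exprn_ge0 ?expR_ge0 // ltW.
  rewrite -npow1E // /npow -expRD ler_expR /s.
  have -> : 1 + - (1 + (ln X%:R)^-1) * ln n%:R = -1 * ln n%:R + (1 - ln n%:R / ln X%:R) :> R by ring.
  rewrite lerDl subr_ge0 ler_pdivrMr // mul1r ler_ln ?posrE ?ltr0n ?ler_nat //.
  by move: nX; lia.
rewrite ler_wpM2l ?(ltW E0) //.
have f1 : f 1%N = (K 1)%:R.
  by rewrite /f npow1 /sieve_loss /omega /= big_nil expR0 expr0 !mulr1.
have Ff p e m : prime p -> (0 < e)%N -> (0 < m)%N -> ~~ (p %| m)%N ->
    f (p ^ e * m)%N <= F p e * f m.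
  move=> pp e0 m0 pm; have p0 := prime_gt0 pp.
  have pe0 : (0 < p ^ e)%N by rewrite expn_gt0 p0.
  rewrite /f /F; have pe := primes_pexp p e m pp e0 m0 pm.
  have -> : omega (p ^ e * m) = (omega m).+1 by rewrite /omega (perm_size pe).
  have -> : sieve_loss (p ^ e * m) = expR (4 / p%:R) * sieve_loss m.
    by rewrite /sieve_loss (perm_big _ pe) /= big_cons expRD.
  rewrite npowM // npowX // exprS.
  set a := z ^+ _; set b := sieve_loss m; set c := expR _; set t := npow R s p ^+ e.
  have -> : z * c * (kappa R chi p e * t) * ((K m)%:R * a * b * npow R s m) =
     (kappa R chi p e * (K m)%:R) * (z * a * (c * b) * (t * npow R s m)) by ring.
  have -> : (K (p ^ e * m))%:R * (z * a) * (c * b) * (t * npow R s m) =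
     (K (p ^ e * m))%:R * (z * a * (c * b) * (t * npow R s m)) by ring.
  rewrite ler_wpM2r ?HK //.
  rewrite !mulr_ge0 ?exprn_ge0 ?expR_ge0 // ?ltW //.
apply: le_trans (sum_le_euler_product R f F X f0 F0 Ff) _; rewrite f1 ler_wpM2l //.
(* [20 = 8 + 12]: the factor [expR (4 / p)] of [sieve_loss] acting on [deg p / p <= 2 / p] gives 8,
   and [sum_kappa_le] gives 12. *)
pose G p : R := z * (deg R chi p * npow R s p + 20 * expR 2 * (p%:R^-1) ^+ 2).
apply: (@le_trans _ _ (expR (\sum_(0 <= p < X.+1 | prime p) G p))).
  apply: ler_expR_prod => p pp; have p0 := prime_gt0 pp.
  have t0 := npow_gt0 R s p; set t := npow R s p in t0 *.
  apply/andP; split; first by rewrite addr_ge0 // sumr_ge0.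
  apply: le_trans (expR_ge1Dx _); rewrite lerD2l /F -mulr_sumr -mulrA ler_wpM2l ?(ltW z0) // -/t.
  have tp : t <= p%:R^-1 by rewrite -npow1E // npow_le // ltW.
  have /andP[v0 v2] := prime_inv_le R p pp; set v := p%:R^-1 in v0 v2 tp *.
  have t35 : 0 <= t <= 3/5 by rewrite (ltW t0) /=; lra.
  have := sum_kappa_le R chi hchi p t X t35; set S := \sum_(_ <= _ < _) _ => HS.
  apply: le_trans (ler_wpM2l (expR_ge0 _) HS) _.
  have d0 := deg_ge0 R chi hchi p; have d2 := deg_le2 R chi hchi p.
  set d := deg R chi p in d0 d2 *.
  have e2 : expR (4 * v) <= expR 2 by rewrite ler_expR; lra.
  have e1 : expR (4 * v) <= 1 + 4 * v * expR 2.
    apply: le_trans (expR_le_chord _ _) _; first lra.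
    by rewrite lerD2l ler_wpM2l //; lra.
  set e := expR (4 * v) in e1 e2 *; set D := expR 2 in e1 e2 *.
  have D0 : 0 <= D by exact: expR_ge0.
  have h1 : e * (d * t) <= (1 + 4 * v * D) * (d * t).
    by rewrite ler_wpM2r // mulr_ge0 // ltW.
  have h2 : d * t <= 2 * v by apply: ler_pM => //; rewrite ltW.
  have h3 : 4 * v * D * (d * t) <= 4 * v * D * (2 * v).
    by rewrite ler_wpM2l // mulr_ge0 // mulr_ge0.
  have h4 : t ^+ 2 <= v ^+ 2 by rewrite lerXn2r ?nnegrE // ltW.
  have h5 : e * (12 * t ^+ 2) <= D * (12 * v ^+ 2).
    apply: ler_pM => //; [exact: expR_ge0|by rewrite mulr_ge0 ?sqr_ge0|].
    by rewrite ler_wpM2l.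
  rewrite mulrDr; apply: le_trans (lerD h1 h5) _.
  have -> : d * t + 20 * D * v ^+ 2 = d * t + 4 * v * D * (2 * v) + D * (12 * v ^+ 2) by ring.
  by rewrite lerD2r mulrDl mul1r lerD2l.
rewrite ler_expR /G -mulr_sumr -mulrDr ler_wpM2l ?(ltW z0) // big_split /= -mulr_sumr.
apply: lerD.
  have := sum_deg_npow_le R chi hchi s X s1.
  by have -> : 1 / (s - 1) = ln X%:R by rewrite /s addrAC subrr add0r div1r invrK.
rewrite -[leRHS]mulr1 ler_wpM2l ?sum_inv_sqr_le //; by rewrite mulr_ge0 ?expR_ge0.
Qed.

End WeightedSums.

(** * Asymptotics of the sieve and of the sums *)

Section SieveAsymptotics.
Variables (R : realType) (chi : nat -> R).
Hypothesis hchi : unit_character R chi.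
Local Notation E := (expR 1 : R).
Local Notation B := (4 * E ^+ 2 + 2 : R).

(* Throughout, t = ln (ln x). With about B t Bonferroni terms, products of that many
   primes below this level stay smaller than a power of the box side. *)
Definition sieve_level (A t : R) : nat :=
  Num.truncn (expR (expR t / (16 * A * B * t ^+ 2))).

Lemma dens_le1 Om q : dens R Om q <= 1.
Proof.
have [->|q0] := posnP q; first by rewrite /dens /nbad big_ord0 mul0r.
rewrite /dens ler_pdivrMr ?exprn_gt0 ?ltr0n // mul1r -natrX ler_nat.
apply: (@leq_trans (\sum_(u < q) \sum_(v < q) 1)%N).
  by apply: leq_sum => u _; apply: leq_sum => v _; case: (Om _ _ _).
by rewrite !sum_nat_const !card_ord muln1 -mulnn.
Qed.

Lemma expR_ge_pow4 (t : R) : 0 <= t -> t ^+ 4 / 24 <= expR t.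
Proof.
move=> t0; have := expR_ge1Dxn 3 t0; rewrite (_ : 4`! = 24)%N //.
lra.
Qed.

(** [28 = 2 * 13 + 2]: 13 is the Mertens constant, and 2 the price of leaving out the prime 2. The
    primes dividing [m] that are left out cost [sieve_loss]. *)
Lemma prod_dens_le (W m : nat) Om :
  (2 < W)%N -> (0 < m)%N ->
  (forall q, prime q -> (q <= W)%N -> ~~ (q %| 2 * m)%N ->
     1 - dens R Om q <= expR (- 2 * deg R chi q / q%:R)) ->
  \prod_(q < W.+1) (1 - dens R Om q) <=
  expR (- 2 * ln (ln W%:R) + 28) * sieve_loss R m.
Proof.
move=> W2 m0 Hd.
pose P q := prime q && ~~ (q %| 2 * m)%N.
apply: (@le_trans _ _ (expR (\sum_(0 <= q < W.+1 | P q) (- 2 * deg R chi q / q%:R)))).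
  rewrite expR_sum big_mkord [leRHS]big_mkcond /=; apply: ler_prod => q _.
  rewrite subr_ge0 dens_le1 /=; case: ifP => [/andP[pq nq]|_].
    by apply: Hd => //; rewrite -ltnS ltn_ord.
  by rewrite gerBl dens_ge0.
rewrite -expRD ler_expR.
have H := sum_deg_inv_ge R chi hchi W W2.
have : \sum_(0 <= q < W.+1 | prime q) deg R chi q / q%:R <=
       \sum_(0 <= q < W.+1 | P q) deg R chi q / q%:R + (1 + \sum_(q <- primes m) 2 / q%:R).
  rewrite (bigID (fun q => ~~ (q %| 2 * m)%N)) /= lerD2l.
  apply: (@le_trans _ _ (\sum_(q <- 2%N :: primes m) 2 / q%:R)); last first.
    by rewrite big_cons divff.
  rewrite -big_filter; apply: (@le_trans _ _ (\sum_(q <- [seq i <- index_iota 0 W.+1 | prime i & ~~ ~~ (i %| 2 * m)%N]) 2 / q%:R)).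
    apply: ler_sum => q _; rewrite ler_wpM2r ?invr_ge0 //; exact: deg_le2.
  apply: ler_sum_subset; first by move=> n; rewrite mulr_ge0 ?invr_ge0.
    by rewrite filter_uniq // iota_uniq.
  move=> q; rewrite mem_filter negbK => /andP[/andP[pq]]; rewrite Euclid_dvdM // dvdn_prime2 // => h _.
  by rewrite in_cons mem_primes pq m0 /=.
rewrite -[X in _ <= X + _ -> _]mulr1.
have -> : \sum_(0 <= q < W.+1 | P q) (- 2 * deg R chi q / q%:R) =
   - 2 * \sum_(0 <= q < W.+1 | P q) deg R chi q / q%:R.
  by rewrite mulr_sumr; apply: eq_bigr => q _; rewrite mulrA.
have -> : \sum_(q <- primes m) 4 / q%:R = 2 * \sum_(q <- primes m) 2 / q%:R :> R.
  by rewrite mulr_sumr; apply: eq_bigr => q _; rewrite mulrA -natrM.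
lra.
Qed.

Lemma prod_dens_tail_le (W : nat) (Om : nat -> nat -> nat -> bool) : (1 < W)%N ->
  (forall q u v, Om q u v -> prime q && (q <= W)%N) ->
  (forall q, (nbad Om q <= 4 * q)%N) ->
  \prod_(q < W.+1) (1 + E * dens R Om q) <= expR (4 * E ^+ 2 * (ln (1 + ln W%:R) + 4)).
Proof.
move=> W1 Hp Hn; have E0 : 0 < E by exact: expR_gt0.
apply: (@le_trans _ _ (expR (\sum_(0 <= q < W.+1 | prime q) (4 * E * q%:R^-1)))).
  rewrite expR_sum big_mkord [leRHS]big_mkcond /=; apply: ler_prod => q _.
  rewrite addr_ge0 ?mulr_ge0 ?dens_ge0 ?(ltW E0) //=; case: ifP => [pq|npq].
    apply: le_trans (expR_ge1Dx _); rewrite lerD2l.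
    have -> : 4 * E * q%:R^-1 = E * (4 / q%:R) by ring.
    by rewrite ler_wpM2l ?(ltW E0) // dens_le.
  rewrite /dens (nbad_nonprime W Om Hp) ?mul0r ?mulr0 ?addr0 //.
  by rewrite npq.
rewrite ler_expR -mulr_sumr.
have := sum_prime_inv_le R W W1; set S := \sum_(_ <= _ < _ | _) _ => H.
have -> : 4 * E ^+ 2 * (ln (1 + ln W%:R) + 4) = 4 * E * (E * (ln (1 + ln W%:R) + 4)) by ring.
by rewrite ler_wpM2l // mulr_ge0 // ltW.
Qed.

(** As [4 W <= w^2], the error is at most a constant times [w^(2K) L], and [w^(4K) <= L] puts it
    below [L^2] by the factor [w^(2K) >= u]. *)
Lemma brun_error_le (W L K : nat) (w u : R) : (0 < K)%N -> 4 <= w -> W%:R <= w ->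
  w ^+ (4 * K) <= L%:R -> 0 < u -> u <= w ->
  expR 2 * (4 * W%:R) ^+ K * (2 * L%:R + W%:R ^+ K) <= 3 * expR 2 * (L%:R ^+ 2 / u) :> R.
Proof.
move=> K0 w4 Ww wL u0 uw; have w1 : 1 <= w by lra.
have w0 : 0 <= w by lra.
have a1 : 1 <= w ^+ (2 * K) by apply: exprn_ege1.
set a := w ^+ (2 * K) in a1 *.
have a2L : a ^+ 2 <= L%:R by rewrite /a -exprM mulnAC.
have W0 : 0 <= W%:R :> R by [].
have L0 : 0 <= L%:R :> R by [].
have WKL : W%:R ^+ K <= L%:R :> R.
  apply: (@le_trans _ _ (w ^+ K)); first by rewrite lerXn2r ?nnegrE.
  by apply: le_trans wL; rewrite ler_weXn2l //; lia.
have aK : (4 * W%:R) ^+ K <= a.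
  rewrite /a exprM; apply: lerXn2r; rewrite ?nnegrE ?mulr_ge0 ?sqr_ge0 //.
  by rewrite expr2; apply: ler_pM.
have ua : u <= a.
  by apply: le_trans uw _; rewrite /a -[leLHS]expr1 ler_weXn2l // muln_gt0 K0.
have E2 : 0 <= expR 2 :> R by exact: expR_ge0.
have e1 : 0 <= (4 * W%:R) ^+ K :> R by rewrite exprn_ge0 // mulr_ge0.
apply: (@le_trans _ _ (expR 2 * (a * (3 * L%:R)))).
  rewrite -[leLHS]mulrA ler_wpM2l //; apply: ler_pM => //; last by lra.
have -> : expR 2 * (a * (3 * L%:R)) = 3 * expR 2 * (L%:R * a) by ring.
rewrite ler_wpM2l ?mulr_ge0 //.
rewrite expr2 -mulrA ler_wpM2l // ler_pdivlMr //.
by apply: le_trans a2L; rewrite expr2 ler_wpM2l //; lra.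
Qed.

(** [C] adds the product of densities, the tail of the truncation and the box errors. [B] is chosen
    so that [expR (- B t)] absorbs the tail product, of size [expR (4 E^2 t)], and still leaves
    [expR (- 2 t)]. The 16 in the level gives [w^(4K) <= L] for [K <= 2 B t]. *)
Lemma sieve_bound (A : R) : 1 <= A -> exists C T : R, [/\ 0 < C, 1 <= T &
  forall (t : R) (L m : nat) (Om : nat -> nat -> nat -> bool), T <= t -> (0 < m)%N ->
   expR (expR t / (2 * A * t)) <= L%:R ->
   (forall q u v, Om q u v -> prime q && (q <= sieve_level A t)%N) ->
   (forall q u v, Om q (u %% q)%N (v %% q)%N = Om q u v) ->
   (forall q, (nbad Om q <= 4 * q)%N) ->
   (forall q, prime q -> (q <= sieve_level A t)%N -> ~~ (q %| 2 * m)%N ->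
     1 - dens R Om q <= expR (- 2 * deg R chi q / q%:R)) ->
   (unsifted (sieve_level A t) L Om)%:R <=
     C * (L%:R ^+ 2 * t ^+ 4 * expR (- 2 * t) * sieve_loss R m)].
Proof.
move=> A1; have E0 : 0 < E by exact: expR_gt0.
have B2 : 2 <= B by have := sqr_ge0 E; lra.
set D : R := 16 * A * B.
have D16 : 32 <= D.
  have : 1 * 2 <= A * B by apply: ler_pM => //; lra.
  by rewrite /D -mulrA; lra.
exists (4 * D ^+ 2 * expR 28 + expR (16 * E ^+ 2) + 3 * expR 2), (48 * D).
have D0 : 0 < D by lra.
split.
- have e1 : 0 < 4 * D ^+ 2 * expR 28 by rewrite mulr_gt0 ?expR_gt0 // mulr_gt0 ?exprn_gt0.
  have e2 := expR_gt0 (16 * E ^+ 2); have e3 := expR_gt0 (2 : R); lra.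
- lra.
move=> t L m Om tT m0 HL Hp Hmod Hn Hd.
have t0 : 0 < t by lra.
have t1 : 1 <= t by lra.
set l := expR t; have l0 : 0 < l by exact: expR_gt0.
set lw := l / (D * t ^+ 2).
have Dt2 : 0 < D * t ^+ 2 by rewrite mulr_gt0 ?exprn_gt0.
have lw2t : 2 * t <= lw.
  rewrite /lw ler_pdivlMr //; apply: le_trans (expR_ge_pow4 t (ltW t0)).
  have -> : 2 * t * (D * t ^+ 2) = t ^+ 3 * (48 * D) / 24 by field.
  have -> : t ^+ 4 / 24 = t ^+ 3 * t / 24 by rewrite exprSr.
  by rewrite ler_pM2r ?invr_gt0 // ler_pM2l ?exprn_gt0.
have lwl : 1 + lw <= l.
  have : lw <= l / 2.
    rewrite /lw ler_pM2l // lef_pV2 ?posrE //.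
    by have := exprn_ege1 2 t1; nra.
  have := expR_ge1Dx t; rewrite -/l; lra.
set W := sieve_level A t; rewrite -/W in Hp Hd *.
have WE : W = Num.truncn (expR lw) by rewrite /W /sieve_level /lw /D /l !mulrA.
have w0 := expR_gt0 lw.
have Wle : W%:R <= expR lw by rewrite WE truncn_le ltW.
have Wgt : expR lw < W%:R + 1 by rewrite WE natr1 truncnS_gt.
have w4 : 4 <= expR lw by have := expR_ge1Dx lw; lra.
have W2 : (2 < W)%N.
  have : 2%:R < W%:R :> R by lra.
  by rewrite ltr_nat.
have W0R : 0 < W%:R :> R by lra.
have lnWlo : lw / 2 <= ln W%:R.
  have : expR lw / 2 <= W%:R by lra.
  have e2 : 0 < expR lw / 2 by rewrite divr_gt0.
  rewrite -ler_ln ?posrE // lnM ?posrE ?invr_gt0 // expRK lnV ?posrE //.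
  have := ln_le_sub1 R 2 (ltac:(lra)); lra.
have lnWhi : ln W%:R <= lw by rewrite -[leRHS]expRK ler_ln ?posrE.
have Bt0 : 0 <= B * t / 2 by rewrite divr_ge0 // mulr_ge0 //; lra.
(* Doubling makes the truncation even, and [K] lies between [B t] and [2 B t]. *)
set k := (Num.truncn (B * t / 2)).+1; set K := (2 * k)%N.
have Klo : B * t <= K%:R.
  rewrite /K natrM; have := truncnS_gt (B * t / 2); rewrite -/k; lra.
have Khi : K%:R <= 2 * B * t.
  rewrite /K natrM /k -natr1; have : (Num.truncn (B * t / 2))%:R <= B * t / 2 by rewrite truncn_le.
  have : 2 * 1 <= B * t by apply: ler_pM => //; lra.
  lra.
have W0 : (0 < W)%N by rewrite ltnW // ltnW.
have evK : ~~ odd K by rewrite /K mul2n odd_double.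
have := brun_sieve R W L K Om W0 evK Hp Hmod Hn.
have P1 := prod_dens_le W m Om W2 m0 Hd.
have P2 := prod_dens_tail_le W Om (ltnW W2) Hp Hn.
set Q1 := \prod_(q < _) (1 - _) in P1 *; set Q2 := \prod_(q < _) (1 + _) in P2 *.
set h := sieve_loss R m in P1 *.
have h1 : 1 <= h.
  rewrite /h /sieve_loss -[X in X <= _]expR0 ler_expR; apply: sumr_ge0 => q _.
  by rewrite divr_ge0.
have t41 : 1 <= t ^+ 4 by apply: exprn_ege1.
set X := t ^+ 4 * expR (- 2 * t).
have X0 : 0 < X by rewrite mulr_gt0 ?exprn_gt0 ?expR_gt0.
have eX : expR (- 2 * t) <= X by rewrite /X ler_peMl ?expR_ge0.
have lnW0 : 0 < ln W%:R :> R by lra.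
have G1 : Q1 <= 4 * D ^+ 2 * expR 28 * (X * h).
  apply: le_trans P1 _.
  have e1 : expR (- 2 * ln (ln W%:R)) <= 4 * D ^+ 2 * X.
    have -> : 4 * D ^+ 2 * X = ((lw / 2)^-1) ^+ 2.
      rewrite /X mulNr expRN (expRM_natl 2 t) -/l /lw; field.
      by rewrite !lt0r_neq0.
    rewrite mulNr expRN (expRM_natl 2) lnK ?posrE // -exprVn lerXn2r ?nnegrE ?invr_ge0 ?(ltW lnW0) //.
      by rewrite divr_ge0 //; lra.
    by rewrite lef_pV2 ?posrE //; lra.
  rewrite (expRD (- 2 * ln (ln W%:R))).
  have -> : 4 * D ^+ 2 * expR 28 * (X * h) = 4 * D ^+ 2 * X * (expR 28 * h) by ring.
  by rewrite -mulrA ler_wpM2r // mulr_ge0 ?expR_ge0 //; lra.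
have G2 : expR (- K%:R) * Q2 <= expR (16 * E ^+ 2) * (X * h).
  apply: (@le_trans _ _ (expR (- (B * t)) * expR (4 * E ^+ 2 * (t + 4)))).
    apply: ler_pM; rewrite ?expR_ge0 //.
    - by apply: prodr_ge0 => q _; rewrite addr_ge0 ?mulr_ge0 ?dens_ge0 // ltW.
    - by rewrite ler_expR lerN2.
    apply: le_trans P2 _; rewrite ler_expR ler_wpM2l ?mulr_ge0 ?sqr_ge0 // lerD2r.
    by rewrite -[leRHS]expRK -/l ler_ln ?posrE //; lra.
  rewrite -expRD; have -> : - (B * t) + 4 * E ^+ 2 * (t + 4) = 16 * E ^+ 2 + (- 2 * t) by ring.
  rewrite expRD ler_wpM2l ?expR_ge0 //; apply: le_trans eX _; rewrite ler_peMr // ltW //.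
have k0 : (0 < K)%N by rewrite /K muln_gt0.
have G3 : expR 2 * (4 * W%:R) ^+ K * (2 * L%:R + W%:R ^+ K) <=
    3 * expR 2 * (L%:R ^+ 2 * (X * h)).
  have wKL : expR lw ^+ (4 * K) <= L%:R.
    apply: le_trans HL; rewrite -expRM_natl ler_expR natrM.
    have -> : l / (2 * A * t) = 4 * (2 * B * t) * lw.
      by rewrite /lw /D; field; rewrite ?lt0r_neq0 //; lra.
    by rewrite ler_wpM2r ?ler_wpM2l //; lra.
  have lwt : expR (2 * t) <= expR lw by rewrite ler_expR.
  apply: le_trans (brun_error_le _ _ _ _ _ k0 w4 Wle wKL (expR_gt0 _) lwt) _.
  rewrite ler_wpM2l ?mulr_ge0 ?expR_ge0 // ler_wpM2l ?sqr_ge0 //.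
  rewrite -expRN -mulNr; apply: le_trans eX _; rewrite ler_peMr // ltW //.
move=> H; apply: le_trans H _.
have L20 : 0 <= L%:R ^+ 2 :> R by apply: sqr_ge0.
have := ler_wpM2l L20 (lerD G1 G2).
set c1 := 4 * D ^+ 2 * expR 28; set c2 := expR (16 * E ^+ 2).
have -> : (c1 + c2 + 3 * expR 2) * (L%:R ^+ 2 * t ^+ 4 * expR (- 2 * t) * h) =
   L%:R ^+ 2 * (c1 * (X * h) + c2 * (X * h)) + 3 * expR 2 * (L%:R ^+ 2 * (X * h)).
  by rewrite /X; ring.
by move=> H1; apply: lerD.
Qed.

End SieveAsymptotics.

(** * Smooth sums and cofactor sums in terms of ln (ln x) *)

Section SumAsymptotics.
Variables (R : realType) (chi : nat -> R) (K : nat -> nat).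
Hypothesis hchi : unit_character R chi.
Hypothesis HK : forall p e m, prime p -> ~~ (p %| m)%N ->
  (K (p ^ e * m))%:R <= kappa R chi p e * (K m)%:R.
Local Notation E := (expR 1 : R).

Definition smooth_level (A t : R) : nat := Num.truncn (expR (expR t / (A * t))).

(** The range extends to [4 x] because the order of the curve may exceed [p], but never [4 p]. The
    Euler product costs [expR (2 E^2 t)], which is why [A] must exceed [kap] by that much. *)
Lemma smooth_bound (A kap : R) : 2 * E ^+ 2 + kap <= A -> 2 <= A ->
  exists C T : R, [/\ 0 < C, 1 <= T & forall t, T <= t ->
  \sum_(1 <= n < (Num.truncn (4 * expR (expR t))).+1 | chi_smooth R chi (smooth_level A t) n)
    (K n)%:R <= C * (expR (expR t) * expR (- kap * t))].
Proof.
move=> Akap A2.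
exists (4 * ((K 1)%:R + 1) * expR (8 * E ^+ 2 + 36)), (96 * A).
split; first by rewrite !mulr_gt0 ?expR_gt0 // ltr_wpDl.
  lra.
move=> t tT; set l := expR t; have l0 : 0 < l by exact: expR_gt0.
have t0 : 0 < t by lra.
have t1 : 1 <= t by lra.
have At0 : 0 < A * t by rewrite mulr_gt0 //; lra.
have l4 : 4 * (A * t) <= l.
  apply: le_trans (expR_ge_pow4 R t (ltW t0)).
  have -> : t ^+ 4 / 24 = t * t * (t * t) / 24 by congr (_ / _); rewrite !exprS expr0 mulr1 !mulrA.
  have : 1 * (96 * A) <= t * t * t.
    by rewrite -mulrA; apply: ler_pM => //; [lra|apply: (@le_trans _ _ (1 * t)); [lra|rewrite ler_wpM2r //; lra]].
  nra.
set X := Num.truncn (4 * expR l); set Y := smooth_level A t.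
(* This makes [X^(- eta)] a saving of at least [expR (- A t)] up to a constant while keeping
   [eta * ln Y <= 1]. *)
set eta := A * t / l.
have eta0 : 0 < eta by rewrite divr_gt0.
have eta4 : eta <= 1/4 by rewrite /eta ler_pdivrMr //; lra.
set ly := l / (A * t); have ly4 : 4 <= ly by rewrite /ly ler_pdivlMr.
have y0 := expR_gt0 ly; have y5 := expR_ge1Dx ly.
have YE : Y = Num.truncn (expR ly) by [].
have Yle : Y%:R <= expR ly by rewrite YE truncn_le ltW.
have Y1 : (1 < Y)%N.
  have : expR ly < Y%:R + 1 by rewrite YE natr1 truncnS_gt.
  by move=> ?; rewrite -(ltr_nat R); lra.
have Y0R : 0 < Y%:R :> R by rewrite ltr0n ltnW.
have lnY : ln Y%:R <= ly by rewrite -[leRHS]expRK ler_ln ?posrE.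
have etaY : eta * ln Y%:R <= 1.
  apply: (@le_trans _ _ (eta * ly)); first by rewrite ler_wpM2l // ltW.
  by rewrite /eta /ly; set a := A * t in At0 *; rewrite mulrA divfK ?lt0r_neq0 // divff ?lt0r_neq0.
have x1 : 1 <= expR l by have := expR_ge1Dx l; lra.
have X0 : (0 < X)%N by rewrite truncn_gt0; lra.
have Xle : X%:R <= 4 * expR l by rewrite truncn_le; lra.
have := sum_smooth_le R chi K hchi HK X Y eta X0; rewrite eta0 eta4 => /(_ isT etaY) H.
apply: le_trans H _.
have S1 := sum_prime_inv_le R Y Y1.
have lY1 : ln (1 + ln Y%:R) <= t.
  have ly2 : ly <= l / 2.
    rewrite /ly ler_pM2l // lef_pV2 ?posrE //.
    have : 2 * 1 <= A * t by apply: ler_pM => //; lra.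
    lra.
  have l0Y : 0 <= ln Y%:R :> R by rewrite ln_ge0 // ler1n ltnW.
  rewrite -[leRHS]expRK ler_ln ?posrE //; [|lra].
  by rewrite -/l; have := expR_ge1Dx t; rewrite -/l; lra.
have E0 : 0 < E by exact: expR_gt0.
have S2 : 2 * E * \sum_(0 <= p < Y.+1 | prime p) p%:R^-1 + 36 <= 2 * E ^+ 2 * t + (8 * E ^+ 2 + 36).
  have : 2 * E * \sum_(0 <= p < Y.+1 | prime p) p%:R^-1 <= 2 * E * (E * (t + 4)).
    rewrite ler_wpM2l ?mulr_ge0 ?(ltW E0) //; apply: le_trans S1 _.
    by rewrite ler_wpM2l ?(ltW E0) // lerD2r.
  rewrite (_ : 2 * E * (E * (t + 4)) = 2 * E ^+ 2 * t + 8 * E ^+ 2); last by ring.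
  lra.
have S3 : (1 - eta) * ln X%:R <= ln 4 + l - A * t.
  have lX : ln X%:R <= ln 4 + l.
    rewrite -[X in _ + X]expRK -lnM ?posrE ?expR_gt0 // ler_ln ?posrE ?ltr0n ?mulr_gt0 ?expR_gt0 //.
  apply: (@le_trans _ _ ((1 - eta) * (ln 4 + l))); first by rewrite ler_wpM2l //; lra.
  have -> : (1 - eta) * (ln 4 + l) = ln 4 + l - A * t - eta * ln 4.
    by rewrite /eta; field; rewrite lt0r_neq0.
  by rewrite gerBl mulr_ge0 ?(ltW eta0) // ln_ge0 //; lra.
apply: (@le_trans _ _ (expR (ln 4 + l - A * t) *
   (((K 1)%:R + 1) * expR (2 * E ^+ 2 * t + (8 * E ^+ 2 + 36))))).
  apply: ler_pM; rewrite ?expR_ge0 ?mulr_ge0 ?expR_ge0 ?ler_expR //.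
  by apply: ler_pM; rewrite ?expR_ge0 ?ler_expR // lerDl.
set k1 := (K 1)%:R + 1; set c := expR (8 * E ^+ 2 + 36).
rewrite (expRD (2 * E ^+ 2 * t)) -/c -addrA (expRD (ln 4)) (expRD l) lnK ?posrE //.
have -> : 4 * (expR l * expR (- (A * t))) * (k1 * (expR (2 * E ^+ 2 * t) * c)) =
  4 * k1 * c * (expR l * (expR (- (A * t)) * expR (2 * E ^+ 2 * t))) by ring.
rewrite ler_wpM2l ?mulr_ge0 ?expR_ge0 ?addr_ge0 //.
rewrite ler_wpM2l ?expR_ge0 // -expRD ler_expR.
have := ler_wpM2r (ltW t0) Akap; lra.
Qed.

Lemma main_bound (z : R) : 0 < z ->
  exists C : R, 0 < C /\ forall t, 1 <= t ->
  \sum_(1 <= m < (Num.truncn (4 * expR (expR t))).+1)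
    (K m)%:R * z ^+ omega m * sieve_loss R m / m%:R <= C * expR (z * t).
Proof.
move=> z0.
exists (E * (((K 1)%:R + 1) * expR (z * (ln 4 + 4) + z * (20 * expR 2)))).
split; first by rewrite !mulr_gt0 ?expR_gt0 // ltr_wpDl.
move=> t t1; set l := expR t; have l2 : 2 <= l by have := expR_ge1Dx t; rewrite -/l; lra.
have x3 : 3 <= expR l by have := expR_ge1Dx l; lra.
set X := Num.truncn (4 * expR l).
have X2 : (2 < X)%N by rewrite truncn_gt_nat; lra.
have Xle : X%:R <= 4 * expR l by rewrite truncn_le; lra.
apply: le_trans (sum_weighted_le R chi K hchi HK X z X2 z0) _.
rewrite -!mulrA ler_wpM2l ?expR_ge0 //; apply: ler_pM; rewrite ?mulr_ge0 ?expR_ge0 //.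
  by rewrite lerDl.
rewrite -expRD ler_expR.
have X0 : 0 < X%:R :> R by rewrite ltr0n ltnW // ltnW.
have lnX : ln X%:R <= ln 4 + l.
  rewrite -[X in _ + X]expRK -lnM ?posrE ?expR_gt0 // ler_ln ?posrE ?mulr_gt0 ?expR_gt0 //.
have ln43 : ln 4 <= 3 :> R by have := ln_le_sub1 R 4 (ltac:(lra)); lra.
have lnX0 : 0 <= ln X%:R :> R by rewrite ln_ge0 // ler1n ltnW // ltnW.
have : ln (1 + ln X%:R) <= ln 4 + t.
  rewrite -[X in _ <= _ + X]expRK -/l -lnM ?posrE ?expR_gt0 // ler_ln ?posrE ?mulr_gt0 ?expR_gt0 //; lra.
move=> H; have := ler_wpM2l (ltW z0) H; lra.
Qed.

End SumAsymptotics.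

(** * Local densities and assembly *)

Section LocalDensities.

Lemma sum_Fp (q : nat) (G : 'F_q -> nat) : prime q ->
  (\sum_(u < q) G u%:R = \sum_(x : 'F_q) G x)%N.
Proof.
move=> pq; rewrite [RHS](reindex (fun u : 'I_q => u%:R : 'F_q)) //=.
apply: onW_bij; apply: inj_card_bij; last by rewrite card_Fp // card_ord.
move=> u v /(congr1 val) /=; rewrite !val_Fp_nat // !modn_small // => e.
exact: val_inj.
Qed.

Lemma card_two (F : finFieldType) (a b : F) : a != b ->
  (\sum_(x : F) ((x == a) || (x == b)) = 2)%N.
Proof.
move=> ab; transitivity #|[set a; b]|; last by rewrite cards2 ab.
rewrite -sum1_card [RHS]big_mkcond /=; apply: eq_bigr => x _; rewrite !inE.
by case: (_ || _).
Qed.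

(** The map [(c, d) -> (c + i d, c - i d)] is invertible and separates the conditions: each new
    coordinate has to avoid 0 and one further nonzero value. *)
Lemma card_unsifted_residues (F : finFieldType) (i al be : F) :
  i ^+ 2 = -1 -> (2%:R : F) != 0 -> al != 0 -> be != 0 ->
  (\sum_(c : F) \sum_(d : F)
    (((c + i * d) * (c - i * d) * ((1 + al * (c + i * d)) * (1 + be * (c - i * d))))%R == 0%R)
   + (#|F| - 2) ^ 2 = #|F| ^ 2)%N.
Proof.
move=> i2 t0 a0 b0; pose good (a x : F) := (x != 0) && (1 + a * x != 0).
have i0 : i != 0.
  by apply: contra_eq_neq i2 => ->; rewrite expr0n /= eq_sym oppr_eq0 oner_eq0.
have cgood (a : F) : a != 0 -> (\sum_(x : F) good a x = #|F| - 2)%N.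
  move=> an0; have : (\sum_(x : F) ((x == 0%R) || (x == - a^-1)) = 2)%N.
    by apply: card_two; rewrite eq_sym oppr_eq0 invr_eq0.
  move=> e; have : (\sum_(x : F) good a x + \sum_(x : F) ((x == 0%R) || (x == (- a^-1)%R)) = #|F|)%N.
    rewrite -big_split /= -sum1_card; apply: eq_bigr => x _; rewrite /good.
    have -> : (x == - a^-1) = (1 + a * x == 0).
      apply/eqP/eqP => [->|h]; first by rewrite mulrN divff // subrr.
      by apply: (mulfI an0); rewrite mulrN divff //; apply/eqP; rewrite -addr_eq0 addrC h.
    by case: (x == 0); case: (1 + a * x == 0).
  by rewrite e; lia.
have -> : ((#|F| - 2) ^ 2 = \sum_(c : F) \sum_(d : F)
    (good al (c + i * d)%R && good be (c - i * d)%R))%N.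
  rewrite -mulnn -{1}(cgood al a0) -(cgood be b0) big_distrlr /= !pair_bigA /=.
  rewrite (reindex (fun cd : F * F => (cd.1 + i * cd.2, cd.1 - i * cd.2))) /=.
    by apply: eq_bigr => cd _; rewrite mulnb.
  exists (fun xy : F * F => ((xy.1 + xy.2) / 2%:R, (xy.1 - xy.2) / (2%:R * i))) => -[x y] _ /=;
    congr (_, _); field; by rewrite ?t0 ?i0.
rewrite -big_split /= -mulnn -[in RHS]sum1_card big_distrlr /=.
apply: eq_bigr => c _; rewrite -big_split /=; apply: eq_bigr => d _.
rewrite !mulf_eq0 /good; do 4 case: (_ == 0) => //=.
Qed.

End LocalDensities.

(** * Choice of constants and addition of the three counts *)

Section Combination.
Variables (R : realType) (chi : nat -> R) (K : nat -> nat) (gamma : R).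
Hypothesis hchi : unit_character R chi.
Hypothesis HK : forall p e m, prime p -> ~~ (p %| m)%N ->
  (K (p ^ e * m))%:R <= kappa R chi p e * (K m)%:R.
Hypothesis gamma0 : 0 < gamma.
Local Notation E := (expR 1 : R).

Definition exponent : R := 2 + gamma * ln gamma - gamma.
(** Rankin's saving [expR (- depth * t)] has to pay for the Euler product and still reach
    [expR (- exponent * t)]; the final 2 ensures [2 <= depth]. *)
Definition depth : R := 2 * E ^+ 2 + `|exponent| + 2.

(* What the condition on [omega] of the order says about the cofactor [m] left after
   removing one prime; the factor 1 + gamma >= max 1 gamma accounts for that prime. *)
Definition heavy (t : R) (m : nat) : bool :=
  expR (gamma * ln gamma * t) <= (1 + gamma) * gamma ^+ omega m.

Lemma depth_ge2 : 2 <= depth.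
Proof. by rewrite /depth; have := sqr_ge0 E; have := normr_ge0 exponent; lra. Qed.

(* [N0], [N1] and [N2] count the p below the sieve level, those with a smooth order,
   and the remaining ones. *)
Lemma combine_counts (c : R) : 0 < c -> exists C T : R, [/\ 0 < C, 1 <= T &
  forall t (N0 N1 N2 : nat) (P : pred nat), T <= t ->
   (N0 <= sieve_level R depth t)%N ->
   N1%:R <= \sum_(1 <= n < (Num.truncn (4 * expR (expR t))).+1 |
                   chi_smooth R chi (smooth_level R depth t) n) (K n)%:R :> R ->
   (forall m, P m -> heavy t m) ->
   N2%:R <= \sum_(1 <= m < (Num.truncn (4 * expR (expR t))).+1 | P m)
      (K m)%:R * (c * (expR (expR t) / m%:R * t ^+ 4 * expR (- 2 * t) * sieve_loss R m)) ->
   (N0 + N1 + N2)%:R <= C * (expR (expR t) * t ^+ 5 * expR (- exponent * t))].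
Proof.
move=> c0.
have [C1 [T1 [C10 T11 H1]]] := smooth_bound R chi K hchi HK depth exponent
   (ltac:(rewrite /depth; have := ler_norm exponent; lra)) depth_ge2.
have [C2 [C20 H2]] := main_bound R chi K hchi HK gamma gamma0.
exists (1 + C1 + c * (1 + gamma) * C2), (T1 + 48 * (`|exponent| + 1)).
have n0 := normr_ge0 exponent.
have g1 : 0 < 1 + gamma by rewrite addr_gt0.
split; first by rewrite !addr_gt0 // !mulr_gt0.
  by lra.
move=> t N0 N1 N2 P tT HN0 HN1 HP HN2.
have t1 : 1 <= t by lra.
have tT1 : T1 <= t by lra.
have t0 : 0 <= t by lra.
set x := expR (expR t) in HN1 HN2 *.
have x0 : 0 < x by exact: expR_gt0.
set e := expR (- exponent * t).
have e0 : 0 < e by exact: expR_gt0.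
have xe0 : 0 <= x * e by rewrite mulr_ge0 // ltW.
have t4 : 1 <= t ^+ 4 by apply: exprn_ege1.
(* The argument gives [t ^+ 4]; the fifth power of the conclusion is reached by weakening. *)
have t45 : t ^+ 4 <= t ^+ 5 by rewrite ler_weXn2l.
have xet : x * e <= x * t ^+ 5 * e.
  by rewrite mulrAC ler_peMr //; lra.
have B0 : N0%:R <= x * e.
  apply: (@le_trans _ _ (expR (expR t / 2))).
    apply: (@le_trans _ _ (sieve_level R depth t)%:R); first by rewrite ler_nat.
    rewrite /sieve_level; set lw := _ / _.
    apply: (@le_trans _ _ (expR lw)); first by rewrite truncn_le ltW ?expR_gt0.
    rewrite ler_expR /lw ler_pM2l ?expR_gt0 // lef_pV2 ?posrE //.
      have B2 : 2 <= 4 * E ^+ 2 + 2 by have := sqr_ge0 E; lra.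
      have d2 := depth_ge2.
      have h1 : 2 * 2 <= depth * (4 * E ^+ 2 + 2) by apply: ler_pM.
      have h2 : 1 <= t ^+ 2 by apply: exprn_ege1.
      have : 1 * 1 <= (depth * (4 * E ^+ 2 + 2)) * t ^+ 2 by apply: ler_pM => //; lra.
      by rewrite -!mulrA; lra.
    rewrite !mulr_gt0 ?exprn_gt0 //; [have := depth_ge2; lra|have := sqr_ge0 E; lra|lra].
  rewrite /x /e -expRD ler_expR.
  have := expR_ge_pow4 R t t0.
  have h3 : exponent * t <= `|exponent| * t by rewrite ler_wpM2r // ler_norm.
  have h4 : 48 * `|exponent| * t <= t ^+ 4.
    rewrite exprSr ler_wpM2r //; apply: (@le_trans _ _ t); first lra.
    by rewrite -[leLHS]expr1 ler_weXn2l.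
  rewrite mulNr; lra.
have B1 : N1%:R <= C1 * (x * e) by apply: le_trans HN1 _; apply: H1.
have B2 : N2%:R <= c * (1 + gamma) * C2 * (x * t ^+ 4 * e).
  apply: le_trans HN2 _.
  set w := expR (- (gamma * ln gamma * t)).
  have w0 : 0 <= w by exact: expR_ge0.
  (* For heavy [m], [w * (1 + gamma) * gamma ^+ omega m >= 1], so the condition on [m] is traded for
     this weight and the sum runs over all cofactors. *)
  apply: (@le_trans _ _ (c * (1 + gamma) * (x * t ^+ 4 * (expR (- 2 * t) * w)) *
    \sum_(1 <= m < (Num.truncn (4 * x)).+1) (K m)%:R * gamma ^+ omega m * sieve_loss R m / m%:R)).
    rewrite mulr_sumr big_mkcond; apply: ler_sum => m _.
    have h0 : 0 <= sieve_loss R m by exact: expR_ge0.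
    have g0 : 0 <= gamma ^+ omega m by rewrite exprn_ge0 // ltW.
    have e2 : 0 <= expR (- 2 * t) by exact: expR_ge0.
    have t40 : 0 <= t ^+ 4 by rewrite exprn_ge0.
    case: ifP => [/HP Hm|_]; last first.
      by rewrite !mulr_ge0 ?invr_ge0 // ltW.
    set A := (K m)%:R * (c * (x / m%:R * t ^+ 4 * expR (- 2 * t) * sieve_loss R m)).
    have A0 : 0 <= A by rewrite /A !mulr_ge0 ?invr_ge0 // ltW.
    have -> : c * (1 + gamma) * (x * t ^+ 4 * (expR (- 2 * t) * w)) *
       ((K m)%:R * gamma ^+ omega m * sieve_loss R m / m%:R) =
       A * (w * ((1 + gamma) * gamma ^+ omega m)) by rewrite /A; ring.
    rewrite ler_peMr // /w expRN mulrC ler_pdivlMr ?expR_gt0 // mul1r //.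
  have := ler_wpM2l (_ : 0 <= c * (1 + gamma) * (x * t ^+ 4 * (expR (- 2 * t) * w))) (H2 t t1).
  have -> : 0 <= c * (1 + gamma) * (x * t ^+ 4 * (expR (- 2 * t) * w)).
    by rewrite !mulr_ge0 ?expR_ge0 ?exprn_ge0 // ltW.
  move=> /(_ isT) h; apply: le_trans h _.
  (* The three parts of [exponent]: sieve, Rankin weight on [omega], and size of the cofactor
     sum. *)
  have -> : e = expR (- 2 * t) * w * expR (gamma * t).
    by rewrite /e /w -!expRD /exponent; congr expR; ring.
  by rewrite le_eqVlt; apply/orP; left; apply/eqP; ring.
rewrite !natrD.
have B0' := le_trans B0 xet.
have B1' : N1%:R <= C1 * (x * t ^+ 5 * e).
  by apply: le_trans B1 _; rewrite ler_wpM2l // ltW.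
have B2' : N2%:R <= c * (1 + gamma) * C2 * (x * t ^+ 5 * e).
  apply: le_trans B2 _; rewrite ler_wpM2l ?mulr_ge0 ?(ltW c0) ?(ltW g1) ?(ltW C20) //.
  by rewrite ler_wpM2r ?(ltW e0) // ler_wpM2l // ltW.
lra.
Qed.

End Combination.

(** * Primes congruent to 3 modulo 4 *)

Section Counting.

Lemma size_flatten_map (T U : Type) (F : T -> seq U) (r : seq T) :
  size (flatten [seq F a | a <- r]) = (\sum_(a <- r) size (F a))%N.
Proof. by rewrite size_flatten /shape -map_comp sumnE big_map. Qed.

Lemma size_filter_iota L (a : pred nat) :
  size [seq u <- iota 0 L | a u] = (\sum_(u < L) a u)%N.
Proof.
rewrite size_filter -sum1_count big_mkcond /=.
rewrite -(big_mkord xpredT (fun u => nat_of_bool (a u))) /index_iota subn0.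
by apply: eq_bigr => u _; case: (a u).
Qed.

Lemma size_split3 (a b : pred nat) (s : seq nat) :
  size s = (size [seq p <- s | a p] + size [seq p <- s | ~~ a p && b p]
            + size [seq p <- s | ~~ a p && ~~ b p])%N.
Proof.
elim: s => //= p s ->; case: (a p); case: (b p) => /=; lia.
Qed.

End Counting.

Section Levels.
Variable R : realType.
Local Notation E := (expR 1 : R).

(** With the sieve level below the smooth level, a prime factor above the latter survives the sieve;
    the bound 2 makes this factor odd. *)
Lemma levels (A t : R) : 2 <= A -> 24 * A <= t ->
  (sieve_level R A t <= smooth_level R A t)%N /\ (2 <= smooth_level R A t)%N.
Proof.
move=> A2 tA; have t1 : 1 <= t by lra.
have t0 : 0 < t by lra.
have B2 : 2 <= 4 * E ^+ 2 + 2 by have := sqr_ge0 E; lra.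
have At0 : 0 < A * t by rewrite mulr_gt0 //; lra.
split.
  rewrite /sieve_level /smooth_level; apply: le_truncn.
  rewrite ler_expR ler_pM2l ?expR_gt0 // lef_pV2 ?posrE //; last first.
    by rewrite !mulr_gt0 ?exprn_gt0 //; lra.
  have -> : 16 * A * (4 * E ^+ 2 + 2) * t ^+ 2 = A * t * (16 * (4 * E ^+ 2 + 2) * t) by ring.
  rewrite ler_peMr ?(ltW At0) //.
  have : 2 * 1 <= (4 * E ^+ 2 + 2) * t by apply: ler_pM => //; lra.
  lra.
rewrite /smooth_level truncn_ge_nat ?expR_ge0 //.
suff : 1 <= expR t / (A * t) by have := expR_ge1Dx (expR t / (A * t)); lra.
rewrite ler_pdivlMr // mul1r; apply: le_trans (expR_ge_pow4 R t (ltW t0)).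
rewrite ler_pdivlMr // exprSr mulrAC ler_wpM2r ?(ltW t0) //.
apply: (@le_trans _ _ t); first lra.
by rewrite -[leLHS]expr1 ler_weXn2l.
Qed.

Lemma smooth_level_lt (A t : R) (P : nat) : (smooth_level R A t < P)%N ->
  expR (expR t / (A * t)) <= P%:R.
Proof.
rewrite /smooth_level; set y := expR _ => H; apply/ltW.
by apply: lt_le_trans (truncnS_gt y) _; rewrite ler_nat.
Qed.

End Levels.

Section ShiftedPrimes.
Variables (R : realType) (gamma : R).
Hypothesis gamma0 : 0 < gamma.
Local Notation A := (depth R gamma).

(* The second coordinate [v] is free, which embeds the one-dimensional problem into the
   two-dimensional sieve. *)
Definition shifted_bad (W m q u v : nat) : bool :=
  [&& prime q, (q <= W)%N, ~~ (q %| 2 * m)%N & (q %| u)%N || (m * u == 1 %[mod q])%N].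

Lemma eqn_mod_Fp q a b : prime q -> (a == b %[mod q])%N = (a%:R == b%:R :> 'F_q).
Proof. by move=> pq; rewrite -val_eqE /= !val_Fp_nat. Qed.

Lemma nbad_shifted W m q : prime q -> (q <= W)%N -> ~~ (q %| 2 * m)%N ->
  nbad (shifted_bad W m) q = (2 * q)%N.
Proof.
move=> pq qW nq; have nm : ~~ (q %| m)%N by apply: contra nq => h; rewrite dvdn_mull.
have m0 : (m%:R : 'F_q) != 0 by rewrite -(dvdn_pcharf (pchar_Fp pq)).
rewrite /nbad -(card_two _ (0 : 'F_q) (m%:R^-1)); last by rewrite eq_sym invr_eq0.
rewrite -(sum_Fp q (fun x => nat_of_bool ((x == 0) || (x == m%:R^-1)))) // big_distrl /=.
apply: eq_bigr => u _; rewrite /shifted_bad pq qW nq /=.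
rewrite sum_nat_const card_ord mulnC (dvdn_pcharf (pchar_Fp pq)) eqn_mod_Fp // natrM.
congr ((_ || _) * _)%N; apply/eqP/eqP => [h|->]; last by rewrite divff.
by apply: (mulfI m0); rewrite divff.
Qed.

Lemma shifted_unsifted_le : exists C T : R, [/\ 0 < C, 1 <= T &
  forall (t : R) (L m : nat), T <= t -> (0 < m)%N ->
   expR (expR t / (2 * A * t)) <= L%:R ->
   (unsifted (sieve_level R A t) L (shifted_bad (sieve_level R A t) m))%:R <=
     C * (L%:R ^+ 2 * t ^+ 4 * expR (- 2 * t) * sieve_loss R m)].
Proof.
have A1 : 1 <= A by have := depth_ge2 R gamma; lra.
have [C [T [C0 T1 H]]] := sieve_bound R (chi1 R) (unit_character_chi1 R) A A1.
exists C, T; split=> // t L m tT m0 HL; set W := sieve_level R A t.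
have nb q : nbad (shifted_bad W m) q = 0%N \/ nbad (shifted_bad W m) q = (2 * q)%N.
  have [pq|npq] := boolP (prime q && (q <= W)%N); last first.
    by left; apply: (nbad_nonprime W _ _ q npq) => ? ? ? /and3P[-> ->].
  have [nq|nq] := boolP (q %| 2 * m)%N.
    left; rewrite /nbad big1 // => u _; rewrite big1 // => v _.
    by rewrite /shifted_bad nq /= !andbF.
  by right; case/andP: pq => pq qW; apply: nbad_shifted.
apply: H => //.
- by move=> q u v /and3P[-> ->].
- move=> q u v; rewrite /shifted_bad; congr [&& _, _, _ & _ || _].
    by rewrite /dvdn modn_mod.
  by rewrite modnMmr.
- by move=> q; case: (nb q) => ->; lia.
- move=> q pq qW nq; have q0 := prime_gt0 pq.
  have q0R : 0 < q%:R :> R by rewrite ltr0n.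
  rewrite /dens nbad_shifted // natrM.
  have -> : deg R (chi1 R) q = 1.
    by rewrite /deg /chi1; case: eqP => [e|]; [rewrite e in pq|rewrite addr0].
  apply: le_trans (expR_ge1Dx _).
  rewrite le_eqVlt; apply/orP; left; apply/eqP; field; lra.
Qed.

Lemma shifted_prime_count : exists C T : R, [/\ 0 < C, 1 <= T &
  forall (t : R) (Q : pred nat), T <= t ->
   (forall m P, prime P -> (0 < m)%N -> Q (m * P)%N -> heavy R gamma t m) ->
   (size [seq p <- iota 0 (Num.truncn (expR (expR t))).+1 | prime p && Q p.+1])%:R <=
   C * (expR (expR t) * t ^+ 5 * expR (- exponent R gamma * t))].
Proof.
have [Cs [Ts [Cs0 Ts1 Hs]]] := shifted_unsifted_le.
have HK p e m : prime p -> ~~ (p %| m)%N ->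
    ((fun=> 1%N) (p ^ e * m)%N)%:R <= kappa R (chi1 R) p e * ((fun=> 1%N) m)%:R.
  move=> pp _; rewrite mulr1 /kappa big_ord_recl expr0 lerDl sumr_ge0 // => j _.
  by rewrite exprn_ge0 // /chi1.
have [C [T [C0 T1 H]]] := combine_counts R (chi1 R) (fun=> 1%N) gamma
  (unit_character_chi1 R) HK gamma0 (8 * Cs) (mulr_gt0 (ltr0n _ 8) Cs0).
have A2 := depth_ge2 R gamma.
exists C, (T + Ts + 24 * A); split=> //; first lra.
move=> t Q tT HQ.
have t1 : 1 <= t by lra.
have [WY Y2] := levels R A t A2 (ltac:(lra)).
set x := expR (expR t); set W := sieve_level R A t; set Y := smooth_level R A t.
rewrite -/W -/Y in WY Y2.
have x2 : 2 <= x.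
  have := expR_ge1Dx (expR t); have := expR_ge1Dx t; rewrite -/x; lra.
set X := Num.truncn (4 * x).
set s := [seq p <- iota 0 _ | _].
have us : uniq s by rewrite filter_uniq // iota_uniq.
have sP p : p \in s -> [/\ prime p, Q p.+1 & p%:R <= x].
  rewrite mem_filter mem_iota /= add0n ltnS => /andP[/andP[-> ->]].
  by rewrite truncn_ge_nat ?expR_ge0 //.
rewrite (size_split3 (fun p => p <= W)%N (fun p => chi_smooth R (chi1 R) Y p.+1)).
(* The second condition says that [4 x / m] is at least the smooth level, so the box of side [L m]
   is long enough for the sieve. *)
pose P m := heavy R gamma t m && (expR (expR t / (A * t)) * m%:R <= 4 * x).
pose L m := (Num.truncn (4 * x / m%:R)).+1.
apply: (H t _ _ _ P); first lra.
- rewrite -[leqRHS](size_iota 1); apply: uniq_leq_size; first by rewrite filter_uniq.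
  move=> p; rewrite mem_filter mem_iota => /andP[pW /sP[pp _ _]].
  by rewrite prime_gt0 //= add1n ltnS.
- rewrite -(size_map succn) -natr_sum ler_nat sum1_count -size_filter.
  apply: uniq_leq_size; first by rewrite map_inj_uniq ?filter_uniq ?iota_uniq // => a b [].
  move=> n /mapP[p]; rewrite mem_filter => /andP[/andP[_ sm] /sP[pp _ px] ->].
  rewrite mem_filter sm mem_index_iota /= ltnS truncn_ge_nat ?mulr_ge0 ?expR_ge0 // -/x.
  rewrite -natr1; lra.
- by move=> m /andP[].
set s2 := [seq p <- s | _].
pose sift m := [seq u <- iota 0 (L m) | ~~ [exists q : 'I_W.+1, shifted_bad W m q u 0]].
pose big := flatten [seq [seq (m * u).-1 | u <- sift m] | m <- [seq m <- index_iota 1 X.+1 | P m]].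
apply: (@le_trans _ _ (size big)%:R).
  rewrite ler_nat; apply: uniq_leq_size; first by rewrite filter_uniq.
  move=> p; rewrite mem_filter => /andP[/andP[pW nsm] /sP[pp Qp px]].
  rewrite -ltnNge in pW.
  have [q /andP[qp]] : exists q, (q \in primes p.+1) && ~~ ((deg R (chi1 R) q == 0) || (q <= Y)%N).
    by move: nsm; rewrite /chi_smooth -has_predC => /hasP[q q1 q2]; exists q; rewrite q1.
  rewrite negb_or -ltnNge => /andP[_ qY].
  move: qp; rewrite mem_primes => /and3P[pq _ /dvdnP[m Hm]].
  have m0 : (0 < m)%N by case: (m) Hm.
  have m0R : 0 < m%:R :> R by rewrite ltr0n.
  have mq : m%:R * q%:R <= 4 * x by rewrite -natrM -Hm -natr1; lra.
  have q0R : 0 < q%:R :> R by rewrite ltr0n prime_gt0.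
  apply/flatten_mapP; exists m.
    rewrite mem_filter mem_index_iota m0 /= ltnS truncn_ge_nat; last lra.
    apply/andP; split; last first.
      apply: le_trans mq; rewrite ler_peMr ?(ltW m0R) // ler1n prime_gt0 //.
    rewrite /P (HQ m q) // -?Hm //=; apply: le_trans mq.
    by rewrite mulrC ler_wpM2l ?(ltW m0R) // smooth_level_lt.
  apply/mapP; exists q; last by rewrite -Hm.
  rewrite mem_filter mem_iota /= add0n /L ltnS truncn_ge_nat; last by rewrite divr_ge0 //; lra.
  rewrite ler_pdivlMr // mulrC mq andbT.
  (* A sieving prime [r <= W] dividing the prime [q] or [p = m q - 1] would equal it, but
     [q > Y >= W] and [p > W]. *)
  apply/existsPn => r; apply/negP => /and4P[pr rW _ /orP[]].
    rewrite dvdn_prime2 // => /eqP e; move: qY; rewrite -e ltnNge.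
    by rewrite (leq_trans rW WY).
  rewrite -Hm -addn1 -[X in _ == X %[mod _]]add0n eqn_modDr mod0n.
  rewrite -/(dvdn _ _) dvdn_prime2 // => /eqP e; move: pW; rewrite -e ltnNge.
  by rewrite rW.
rewrite /big size_flatten_map natr_sum big_filter.
rewrite big_nat_cond [leRHS]big_nat_cond; apply: ler_sum => m /andP[/andP[m0 mX] /andP[_ Pm]].
rewrite size_map mul1r.
have m0R : 0 < m%:R :> R by rewrite ltr0n.
set z := 4 * x / m%:R.
have zy : expR (expR t / (A * t)) <= z by rewrite ler_pdivlMr.
have y1 : 1 <= expR (expR t / (A * t)).
  rewrite -[X in X <= _]expR0 ler_expR divr_ge0 ?expR_ge0 // mulr_ge0 //; lra.
have zL : z <= (L m)%:R by rewrite ltW // truncnS_gt.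
have Lz : (L m)%:R <= 2 * z.
  have : (Num.truncn z)%:R <= z by rewrite truncn_le; lra.
  by rewrite /L -natr1 -/z; lra.
have HL : expR (expR t / (2 * A * t)) <= (L m)%:R.
  apply: le_trans zL; apply: le_trans zy; rewrite ler_expR ler_pM2l ?expR_gt0 //.
  have At : 0 < A * t by rewrite mulr_gt0 //; lra.
  by rewrite lef_pV2 ?posrE // -mulrA ?mulr_gt0 //; lra.
have := Hs t (L m) m (ltac:(lra)) m0 HL.
(* Each surviving [u] is counted once per value of the free coordinate. Dividing by [L m] leaves one
   factor [L m <= 2 z] with [z = 4 x / m], whence the constant 8. *)
have -> : unsifted W (L m) (shifted_bad W m) = (size (sift m) * L m)%N.
  rewrite /unsifted /sift size_filter_iota big_distrl /=; apply: eq_bigr => u _.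
  rewrite (eq_bigr (fun=> nat_of_bool (~~ [exists q : 'I_W.+1, shifted_bad W m q u 0]))) //.
  by rewrite sum_nat_const card_ord mulnC.
rewrite natrM; set S := (size _)%:R; set l := (L m)%:R in Lz zL *.
have l0 : 0 < l by lra.
have -> : Cs * (l ^+ 2 * t ^+ 4 * expR (- 2 * t) * sieve_loss R m) =
  Cs * (l * t ^+ 4 * expR (- 2 * t) * sieve_loss R m) * l by ring.
rewrite ler_pM2r // => h; apply: le_trans h _.
have -> : 8 * Cs * (x / m%:R * t ^+ 4 * expR (- 2 * t) * sieve_loss R m) =
  Cs * (2 * z * t ^+ 4 * expR (- 2 * t) * sieve_loss R m) by rewrite /z; ring.
rewrite ler_wpM2l ?(ltW Cs0) // !ler_wpM2r ?expR_ge0 ?exprn_ge0 //; lra.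
Qed.

End ShiftedPrimes.

(** * Primes congruent to 1 modulo 4 *)

Section GaussianShiftedPrimes.
Variables (R : realType) (gamma : R).
Hypothesis gamma0 : 0 < gamma.
Local Notation A := (depth R gamma).

Definition gsucc (z : int * int) : int * int := (z.1 + 1, z.2).

Lemma odd_mod4 q : ~~ (2 %| q)%N -> (q %% 4 != 3)%N -> (q %% 4 = 1)%N.
Proof. by move=> q2 q3; lia. Qed.

Lemma gnorm_nat (c d : nat) : gnorm (c%:Z, d%:Z) = (c ^ 2 + d ^ 2)%N%:Z.
Proof. by rewrite /gnorm /= PoszD -!mulnn !PoszM !expr2. Qed.

(** The parallelogram law for [pi = z + 1]: [N(pi - 1) + N(pi + 1) = 2 p + 2]. *)
Lemma gnorm_gsucc_le z n p : gnorm (gsucc z) = p%:Z -> gnorm z = n%:Z -> (0 < p)%N ->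
  (n <= 4 * p)%N.
Proof.
case: z => a b; rewrite /gnorm /gsucc /= => e1 e2 p0.
have h : n%:Z = 2 * p%:Z + 2 - ((a + 2) ^+ 2 + b ^+ 2) by rewrite -e1 -e2; ring.
have := sqr_ge0 (a + 2); have := sqr_ge0 b; lia.
Qed.

(** [w] is [mu] and [u + i v] is [rho], so the last norm is that of [pi = 1 + mu rho]. Sieving by
    split primes suffices: they have [deg q = 2], while inert primes have [deg q = 0]. *)
Definition gauss_bad (W m : nat) (w : int * int) (q u v : nat) : bool :=
  [&& prime q, (q <= W)%N, (q %% 4 == 1)%N, ~~ (q %| m)%N &
      (q %| gnorm (u%:Z, v%:Z) * gnorm (gsucc (gmul w (u%:Z, v%:Z))))%Z].

Lemma exists_sqrtN1 q : prime q -> (q %% 4 = 1)%N -> exists i : 'F_q, i ^+ 2 = -1.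
Proof.
move=> pq q1; have card := card_Fp pq.
have oddq : odd #|'F_q| by rewrite card; lia.
have := card_sqrt 'F_q oddq (-1); rewrite qcharN1 // card -signr_odd.
rewrite (_ : odd q./2 = false); last by lia.
rewrite expr0; pose S := [set y : 'F_q | y ^+ 2 == -1]; rewrite -/S => e.
have [S0|] := posnP #|S|; first by move: e; rewrite S0.
by case/card_gt0P => i; rewrite inE => /eqP; exists i.
Qed.

Lemma gauss_bad_Fp W m w q u v (i : 'F_q) : prime q -> (q <= W)%N -> (q %% 4 = 1)%N ->
  ~~ (q %| m)%N -> i ^+ 2 = -1 ->
  gauss_bad W m w q u v =
  (((u%:R + i * v%:R) * (u%:R - i * v%:R) *
   ((1 + (w.1%:~R + i * w.2%:~R) * (u%:R + i * v%:R)) *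
    (1 + (w.1%:~R - i * w.2%:~R) * (u%:R - i * v%:R)))) == 0 :> 'F_q).
Proof.
move=> pq qW q1 nm i2; rewrite /gauss_bad pq qW q1 eqxx nm /=.
rewrite (dvdz_pcharf (pchar_Fp pq)) /gnorm /gsucc /gmul /=.
rewrite !(rmorphM, rmorphD, rmorphXn, rmorphB) /= -!pmulrn.
set e : 'F_q := w.1%:~R; set f : 'F_q := w.2%:~R; set c : 'F_q := u%:R; set d : 'F_q := v%:R.
have -> : (c + i * d) * (c - i * d) = c ^+ 2 - i ^+ 2 * d ^+ 2 by ring.
have -> : (1 + (e + i * f) * (c + i * d)) * (1 + (e - i * f) * (c - i * d)) =
  (1 + e * c + i ^+ 2 * f * d) ^+ 2 - i ^+ 2 * (e * d + f * c) ^+ 2 by ring.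
by rewrite i2; congr (_ == _); ring.
Qed.

Lemma nbad_gauss W m w q : prime q -> (q <= W)%N -> (q %% 4 = 1)%N -> ~~ (q %| m)%N ->
  gnorm w = m%:Z -> (nbad (gauss_bad W m w) q + (q - 2) ^ 2 = q ^ 2)%N.
Proof.
move=> pq qW q1 nm wm; have [i i2] := exists_sqrtN1 q pq q1.
have wq : (w.1%:~R + i * w.2%:~R) * (w.1%:~R - i * w.2%:~R) != 0 :> 'F_q.
  have -> : (w.1%:~R + i * w.2%:~R) * (w.1%:~R - i * w.2%:~R) =
     w.1%:~R ^+ 2 - i ^+ 2 * w.2%:~R ^+ 2 :> 'F_q by ring.
  rewrite i2 mulN1r opprK -!rmorphXn -rmorphD -/(gnorm w) wm /=.
  by rewrite -pmulrn -(dvdn_pcharf (pchar_Fp pq)).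
move: wq; rewrite mulf_eq0 negb_or => /andP[a0 b0].
have t0 : (2%:R : 'F_q) != 0.
  by rewrite -(dvdn_pcharf (pchar_Fp pq)) dvdn_prime2 //; apply/eqP => e; rewrite e in q1.
have := card_unsifted_residues 'F_q i _ _ i2 t0 a0 b0; rewrite card_Fp // => <-.
congr (_ + _)%N; rewrite /nbad.
pose G (c d : 'F_q) : nat := (((c + i * d) * (c - i * d) *
   ((1 + (w.1%:~R + i * w.2%:~R) * (c + i * d)) *
    (1 + (w.1%:~R - i * w.2%:~R) * (c - i * d))))%R == 0%R :> 'F_q).
rewrite -[RHS](sum_Fp q (fun c => \sum_(d : 'F_q) G c d)%N) //.
apply: eq_bigr => u _; rewrite -(sum_Fp q (G u%:R)) //; apply: eq_bigr => v _.
by rewrite /G -(gauss_bad_Fp W m w q u v i).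
Qed.

Lemma gauss_unsifted_le : exists C T : R, [/\ 0 < C, 1 <= T &
  forall (t : R) (L m : nat) w, T <= t -> (0 < m)%N -> gnorm w = m%:Z ->
   expR (expR t / (2 * A * t)) <= L%:R ->
   (unsifted (sieve_level R A t) L (gauss_bad (sieve_level R A t) m w))%:R <=
     C * (L%:R ^+ 2 * t ^+ 4 * expR (- 2 * t) * sieve_loss R m)].
Proof.
have A1 : 1 <= A by have := depth_ge2 R gamma; lra.
have [C [T [C0 T1 H]]] := sieve_bound R (chi4 R) (unit_character_chi4 R) A A1.
exists C, T; split=> // t L m w tT m0 wm HL; set W := sieve_level R A t.
have nb q : nbad (gauss_bad W m w) q = 0%N \/
   [/\ prime q, (2 < q)%N & (nbad (gauss_bad W m w) q + (q - 2) ^ 2 = q ^ 2)%N].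
  have [/and4P[pq qW /eqP q1 nq]|nq] := boolP [&& prime q, (q <= W)%N, (q %% 4 == 1)%N & ~~ (q %| m)%N].
    right; split=> //; last exact: nbad_gauss.
    by have := prime_gt1 pq; rewrite leq_eqVlt => /orP[/eqP e|//]; rewrite -e in q1.
  left; rewrite /nbad big1 // => u _; rewrite big1 // => v _.
  apply/eqP; rewrite eqb0; apply: contra nq.
  by rewrite /gauss_bad => /and5P[-> -> -> ->].
apply: H => //.
- by move=> q u v /and3P[-> ->].
- move=> q u v; have [/and4P[pq qW /eqP q1 nq]|nq] :=
     boolP [&& prime q, (q <= W)%N, (q %% 4 == 1)%N & ~~ (q %| m)%N].
    have [i i2] := exists_sqrtN1 q pq q1.
    by rewrite !(gauss_bad_Fp W m w q _ _ i) // !Fp_nat_mod.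
  by rewrite /gauss_bad; move: nq; do 4 (case: (X in X && _) => //=).
- move=> q; case: (nb q) => [->//|[pq q2]]; nia.
- move=> q pq qW nq; have q0R : 0 < q%:R :> R by rewrite ltr0n prime_gt0.
  have nm : ~~ (q %| m)%N by apply: contra nq => h; rewrite dvdn_mull.
  have [q1|q1] := eqVneq (q %% 4)%N 1%N; last first.
    have -> : deg R (chi4 R) q = 0.
      rewrite /deg /chi4 (negbTE q1); case: eqVneq => q3; first by rewrite addrN.
      have q2 : ~~ (2 %| q)%N.
        by rewrite dvdn_prime2 //; apply: contraNneq nq => <-; rewrite dvdn_mulr.
      by rewrite (odd_mod4 q q2 q3) in q1.
    by rewrite mulr0 mul0r expR0 gerBl dens_ge0.
  have q2 : (2 < q)%N.
    by have := prime_gt1 pq; rewrite leq_eqVlt => /orP[/eqP e|//]; rewrite -e in q1.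
  have := nbad_gauss W m w q pq qW q1 nm wm => /(congr1 (fun n => n%:R : R)).
  rewrite natrD !natrX natrB 1?ltnW // => e.
  have -> : deg R (chi4 R) q = 2 by rewrite /deg /chi4 q1 eqxx; ring.
  have -> : 1 - dens R (gauss_bad W m w) q = (1 - 2 / q%:R) ^+ 2.
    by rewrite /dens -[_%:R](addrK ((q%:R - 2) ^+ 2)) e; field; lra.
  have -> : - 2 * 2 / q%:R = 2%:R * (- (2 / q%:R)) :> R by ring.
  rewrite expRM_natl lerXn2r ?nnegrE ?expR_ge0 //; last exact: expR_ge1Dx.
  by rewrite subr_ge0 ler_pdivrMr // mul1r ler_nat ltnW.
Qed.

Lemma gauss_shifted_prime_count : exists C T : R, [/\ 0 < C, 1 <= T &
  forall (t : R) (Q : pred nat), T <= t ->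
   (forall m P, prime P -> (0 < m)%N -> Q (m * P)%N -> heavy R gamma t m) ->
   forall s : seq nat, uniq s ->
   (forall p, p \in s -> [/\ prime p, p%:R <= expR (expR t) & exists z n,
       [/\ gnorm (gsucc z) = p%:Z, gnorm z = n%:Z, (0 < n)%N & Q n]]) ->
   (size s)%:R <= C * (expR (expR t) * t ^+ 5 * expR (- exponent R gamma * t))].
Proof.
have [Cs [Ts [Cs0 Ts1 Hs]]] := gauss_unsifted_le.
have HK p e m (pp : prime p) (pm : ~~ (p %| m)%N) := nreps_pexp R p e m pp pm.
have [C [T [C0 T1 H]]] := combine_counts R (chi4 R) nreps gamma
  (unit_character_chi4 R) HK gamma0 (16 * Cs) (mulr_gt0 (ltr0n _ 16) Cs0).
have A2 := depth_ge2 R gamma.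
exists C, (T + Ts + 24 * A); split=> //; first lra.
move=> t Q tT HQ s us sP.
have t1 : 1 <= t by lra.
have [WY Y2] := levels R A t A2 (ltac:(lra)).
set x := expR (expR t) in sP *; set W := sieve_level R A t; set Y := smooth_level R A t.
rewrite -/W -/Y in WY Y2.
have x2 : 2 <= x.
  have := expR_ge1Dx (expR t); have := expR_ge1Dx t; rewrite -/x; lra.
set X := Num.truncn (4 * x).
have nX z p n : gnorm (gsucc z) = p%:Z -> gnorm z = n%:Z -> prime p -> p%:R <= x -> n%:R <= 4 * x.
  move=> e1 e2 /prime_gt0 p0 px; have := gnorm_gsucc_le z n p e1 e2 p0.
  by rewrite -(ler_nat R) natrM; lra.
(* Smoothness of [N(pi - 1)] depends on which [pi] of norm [p] is taken. Asking for some smooth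
   choice means that, when [sm] fails, the choice satisfying [Q] is not smooth either. *)
pose sm (p : nat) : bool := `[< exists z n, [/\ gnorm (gsucc z) = p%:Z, gnorm z = n%:Z, (0 < n)%N &
   chi_smooth R (chi4 R) Y n] >].
rewrite (size_split3 (fun p => p <= W)%N sm).
pose P m := heavy R gamma t m && (expR (expR t / (A * t)) * m%:R <= 4 * x).
(* A [rho] of norm at most [4 x / m] has both coordinates below this side. *)
pose L m := (Num.truncn (Num.sqrt (4 * x / m%:R))).+1.
apply: (H t _ _ _ P); first lra.
- rewrite -[leqRHS](size_iota 1); apply: uniq_leq_size; first by rewrite filter_uniq.
  move=> p; rewrite mem_filter mem_iota => /andP[pW /sP[pp _ _]].
  by rewrite prime_gt0 //= add1n ltnS.
- rewrite -natr_sum ler_nat -big_filter -size_flatten_map.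
  rewrite -(size_map (fun z => absz (gnorm (gsucc z)))).
  apply: uniq_leq_size; first by rewrite filter_uniq.
  move=> p; rewrite mem_filter => /andP[/andP[_ /asboolP[z [n [e1 e2 n0 smn]]]] /sP[pp px _]].
  apply/mapP; exists z; last by rewrite e1.
  apply/flatten_mapP; exists n; last by rewrite mem_reps e2.
  rewrite mem_filter smn mem_index_iota n0 /= ltnS truncn_ge_nat ?mulr_ge0 ?expR_ge0 // -/x.
  exact: nX e1 e2 pp px.
- by move=> m /andP[].
set s2 := [seq p <- s | _].
pose sift m w := flatten [seq [seq (u, v) | v <- [seq v <- iota 0 (L m) |
   ~~ [exists q : 'I_W.+1, gauss_bad W m w q u v]]] | u <- iota 0 (L m)].
pose F w (uv : nat * nat) := absz (gnorm (gsucc (gmul w (uv.1%:Z, uv.2%:Z)))).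
pose big := flatten [seq flatten [seq [seq F w uv | uv <- sift m w] | w <- reps m]
   | m <- [seq m <- index_iota 1 X.+1 | P m]].
apply: (@le_trans _ _ (size big)%:R).
  rewrite ler_nat; apply: uniq_leq_size; first by rewrite filter_uniq.
  move=> p; rewrite mem_filter => /andP[/andP[pW nsm] /sP[pp px [z [n [e1 e2 n0 Qn]]]]].
  rewrite -ltnNge in pW.
  have {nsm} nsm : ~~ chi_smooth R (chi4 R) Y n.
    by apply: contra nsm => smn; apply/asboolP; exists z, n.
  have [q /andP[qp]] : exists q, (q \in primes n) && ~~ ((deg R (chi4 R) q == 0) || (q <= Y)%N).
    by move: nsm; rewrite /chi_smooth -has_predC => /hasP[q q1 q2]; exists q; rewrite q1.
  rewrite negb_or -ltnNge => /andP[dq qY].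
  move: qp; rewrite mem_primes => /and3P[pq _ /dvdnP[m Hm]].
  have q2 : ~~ (2 %| q)%N.
    by rewrite dvdn_prime2 // eq_sym neq_ltn (leq_trans _ qY) ?orbT // ltnW.
  have q1 : (q %% 4 = 1)%N.
    have : (q %% 4 != 3)%N.
      by apply: contraNneq dq => q3; rewrite /deg /chi4 q3 /= addrN.
    exact: odd_mod4.
  have m0 : (0 < m)%N by move: n0; rewrite Hm muln_gt0 => /andP[].
  have m0R : 0 < m%:R :> R by rewrite ltr0n.
  have mq : m%:R * q%:R <= 4 * x by rewrite -natrM -Hm; apply: nX e1 e2 pp px.
  have q0R : 0 < q%:R :> R by rewrite ltr0n prime_gt0.
  have [w [c [d [cd wm zE]]]] := gauss_factor q m z pq q1 (ltac:(by rewrite e2 Hm)).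
  have zp : 0 <= 4 * x / m%:R by rewrite divr_ge0 //; lra.
  have cL k : (k ^ 2 <= q)%N -> (k < L m)%N.
    move=> kq; rewrite /L ltnS truncn_ge_nat ?sqrtr_ge0 //.
    rewrite -(@ler_pXn2r _ 2) ?nnegrE ?sqrtr_ge0 // sqr_sqrtr //.
    apply: (@le_trans _ _ q%:R); last by rewrite ler_pdivlMr // mulrC.
    by rewrite -natrX ler_nat.
  apply/flatten_mapP; exists m.
    rewrite mem_filter mem_index_iota m0 /= ltnS truncn_ge_nat; last lra.
    apply/andP; split; last first.
      apply: le_trans mq; rewrite ler_peMr ?(ltW m0R) // ler1n prime_gt0 //.
    rewrite /P (HQ m q) // -?Hm //=; apply: le_trans mq.
    by rewrite mulrC ler_wpM2l ?(ltW m0R) // smooth_level_lt.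
  apply/flatten_mapP; exists w; first by rewrite mem_reps wm.
  apply/mapP; exists (c, d); last by rewrite /F /= -zE e1.
  have [cdq] : (c ^ 2 + d ^ 2)%N%:Z = q%:Z by rewrite -gnorm_nat.
  apply/flatten_mapP; exists c.
    by rewrite mem_iota /= add0n; apply: cL; rewrite -cdq leq_addr.
  apply/mapP; exists d => //.
  rewrite mem_filter mem_iota /= add0n (cL d) ?andbT; last by rewrite -cdq leq_addl.
  apply/existsPn => r; apply/negP => /and5P[pr rW _ _].
  rewrite -zE cd e1 dvdzE abszM Euclid_dvdM //= => /orP[].
    rewrite dvdn_prime2 // => /eqP e; move: qY; rewrite -e ltnNge.
    by rewrite (leq_trans rW WY).
  by rewrite dvdn_prime2 // => /eqP e; move: pW; rewrite -e ltnNge rW.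
rewrite /big size_flatten_map natr_sum big_filter.
rewrite big_nat_cond [leRHS]big_nat_cond; apply: ler_sum => m /andP[/andP[m0 mX] /andP[_ Pm]].
have m0R : 0 < m%:R :> R by rewrite ltr0n.
set z := 4 * x / m%:R.
have zy : expR (expR t / (A * t)) <= z by rewrite ler_pdivlMr.
have y1 : 1 <= expR (expR t / (A * t)).
  rewrite -[X in X <= _]expR0 ler_expR divr_ge0 ?expR_ge0 // mulr_ge0 //; lra.
have z0 : 0 <= z by lra.
have rz : 1 <= Num.sqrt z by rewrite -[X in X <= _]sqrtr1 ler_sqrt //; lra.
have zL : Num.sqrt z <= (L m)%:R by rewrite ltW // truncnS_gt.
(* Both coordinates now matter, so the area of the box is bounded; with [z = 4 x / m] this gives the
   constant 16. *)
have Lz : (L m)%:R ^+ 2 <= 4 * z.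
  have h : (L m)%:R <= 2 * Num.sqrt z.
    have : (Num.truncn (Num.sqrt z))%:R <= Num.sqrt z by rewrite truncn_le sqrtr_ge0.
    by rewrite /L -natr1 -/z; lra.
  have -> : 4 * z = (2 * Num.sqrt z) ^+ 2 by rewrite exprMn sqr_sqrtr //; ring.
  by rewrite lerXn2r ?nnegrE // mulr_ge0 // sqrtr_ge0.
(* The side is a square root, which is the origin of the 2 in the length condition of the sieve. *)
have HL : expR (expR t / (2 * A * t)) <= (L m)%:R.
  apply: le_trans zL; rewrite -[leLHS]ger0_norm ?expR_ge0 // -sqrtr_sqr ler_wsqrtr //.
  apply: le_trans zy; rewrite -expRM_natl ler_expR le_eqVlt; apply/orP; left; apply/eqP.
  field; have := A2; lra.
rewrite size_flatten_map natr_sum.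
set b := 16 * Cs * _.
apply: (@le_trans _ _ (\sum_(w <- reps m) b)); last first.
  by rewrite big_const_seq count_predT iter_addr addr0 -[X in X <= _]mulr_natl.
rewrite big_seq [leRHS]big_seq; apply: ler_sum => w; rewrite mem_reps => /eqP wm.
rewrite size_map.
have -> : size (sift m w) = unsifted W (L m) (gauss_bad W m w).
  rewrite /sift size_flatten_map /unsifted -(big_mkord xpredT
    (fun u => \sum_(v < L m) ~~ [exists q : 'I_W.+1, gauss_bad W m w q u v])%N).
  by rewrite /index_iota subn0; apply: eq_bigr => u _; rewrite size_map size_filter_iota.
apply: le_trans (Hs t (L m) m w (ltac:(lra)) m0 wm HL) _.
rewrite /b.
have -> : 16 * Cs * (x / m%:R * t ^+ 4 * expR (- 2 * t) * sieve_loss R m) =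
  Cs * (4 * z * t ^+ 4 * expR (- 2 * t) * sieve_loss R m) by rewrite /z; ring.
rewrite ler_wpM2l ?(ltW Cs0) // !ler_wpM2r ?expR_ge0 ?exprn_ge0 //; lra.
Qed.

End GaussianShiftedPrimes.

(** * The theorem *)

Lemma omega_mul_prime (m P : nat) : (0 < m)%N -> prime P ->
  (omega m <= omega (m * P) <= (omega m).+1)%N.
Proof.
move=> m0 pP; have P0 := prime_gt0 pP; apply/andP; split.
  by apply: uniq_leq_size; [exact: primes_uniq|move=> q; rewrite primesM // => ->].
rewrite -[(omega m).+1]/(size (P :: primes m)); apply: uniq_leq_size; first exact: primes_uniq.
move=> q qm; have : (q \in primes m) || (q \in primes P) by rewrite -primesM.
by rewrite (primes_prime pP) mem_seq1 orbC -in_cons.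
Qed.

Section HeavyCofactors.
Variables (R : realType) (gamma t : R).

Lemma powR_omega (n : nat) : 0 < gamma -> gamma ^+ n = expR (ln gamma * n%:R).
Proof. by move=> g0; rewrite mulrC expRM_natl lnK. Qed.

Lemma heavy_of_many_primes (m P : nat) : 1 < gamma -> (0 < m)%N -> prime P ->
  gamma * t < (omega (m * P))%:R -> heavy R gamma t m.
Proof.
move=> g1 m0 pP H; have g0 : 0 < gamma by lra.
have /andP[_ om] := omega_mul_prime m P m0 pP.
rewrite /heavy; apply: (@le_trans _ _ (gamma ^+ (omega m).+1)).
  rewrite powR_omega // ler_expR mulrAC mulrC ler_wpM2l ?ln_ge0 ?(ltW g1) //.
  by apply/ltW/(lt_le_trans H); rewrite ler_nat.
by rewrite exprS ler_wpM2r ?exprn_ge0 ?(ltW g0) // lerDr.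
Qed.

(** For [gamma < 1] two monotonicities reverse together: removing [P] cannot raise [omega], and
    powers of [gamma] decrease with the exponent. *)
Lemma heavy_of_few_primes (m P : nat) : 0 < gamma < 1 -> (0 < m)%N -> prime P ->
  (omega (m * P))%:R < gamma * t -> heavy R gamma t m.
Proof.
move=> /andP[g0 g1] m0 pP H.
have /andP[om _] := omega_mul_prime m P m0 pP.
rewrite /heavy; apply: (@le_trans _ _ (gamma ^+ omega m)).
  rewrite powR_omega // ler_expR mulrAC mulrC ler_wnM2l //.
    by rewrite ln_le0 // ltW.
  by apply/ltW/(le_lt_trans _ H); rewrite ler_nat.
by rewrite ler_peMl ?exprn_ge0 ?(ltW g0) // lerDl ltW.
Qed.

End HeavyCofactors.

Lemma curve_prime_count (R : realType) (gamma : R) : 0 < gamma ->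
  exists C T : R, [/\ 0 < C, 1 <= T & forall (t : R) (Q : pred nat), T <= t ->
   (forall m P, prime P -> (0 < m)%N -> Q (m * P)%N -> heavy R gamma t m) ->
   (count_good_primes (expR (expR t)) (fun p => Q #|E_points 'F_p|))%:R <=
   C * (expR (expR t) * t ^+ 5 * expR (- exponent R gamma * t))].
Proof.
move=> g0.
have [C1 [T1 [C10 T11 H1]]] := gauss_shifted_prime_count R gamma g0.
have [C3 [T3 [C30 T31 H3]]] := shifted_prime_count R gamma g0.
exists (C1 + C3), (T1 + T3); split; [lra|lra|move=> t Q tT HQ].
set x := expR (expR t); set N := (Num.truncn x).+1.
pose s1 := [seq p <- iota 0 N | [&& prime p, (p %% 4 == 1)%N & Q #|E_points 'F_p|]].
pose s3 := [seq p <- iota 0 N | prime p && Q p.+1].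
have count_le : (count_good_primes x (fun p => Q #|E_points 'F_p|) <= size s1 + size s3)%N.
  rewrite /count_good_primes -sum1_card big_mkcond /s1 /s3 !size_filter_iota -big_split /=.
  apply: leq_sum => p _; rewrite inE /good_prime.
  have [pp|] //= := boolP (prime p); case: ifP => // /andP[op Qp].
  have [p1|p1] := eqVneq (p %% 4)%N 1%N; first by rewrite /= Qp.
  have p3 : (p %% 4)%N = 3%N by move: op p1; lia.
  have e : #|E_points 'F_p| = p.+1 by rewrite card_E_points_3mod4 card_Fp.
  by rewrite e in Qp; rewrite /= Qp.
have B1 := H1 t Q (ltac:(lra)) HQ s1 (filter_uniq _ (iota_uniq 0 N)).
have {}B1 : (size s1)%:R <= C1 * (x * t ^+ 5 * expR (- exponent R gamma * t)).
  apply: B1 => p; rewrite mem_filter mem_iota /= add0n ltnS truncn_ge_nat ?expR_ge0 //.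
  move=> /andP[/and3P[pp /eqP p1 Qp] px]; split=> //.
  have card := card_Fp pp.
  have [a [b [ab E]]] : exists a b : int, a ^+ 2 + b ^+ 2 = #|'F_p|%:Z /\
     #|E_points 'F_p|%:Z = (a - 1) ^+ 2 + b ^+ 2.
    by apply: card_E_points_1mod4; rewrite card.
  exists (a - 1, b), #|E_points 'F_p|; split=> //.
    by rewrite /gsucc /gnorm /= subrK ab card.
  by apply/card_gt0P; exists None; rewrite inE.
have B3 := H3 t Q (ltac:(lra)) HQ.
apply: (@le_trans _ _ (size s1 + size s3)%:R); first by rewrite ler_nat.
by rewrite natrD mulrDl lerD.
Qed.

Local Open Scope classical_set_scope.

Theorem theorem3p1 (R : realType) (gamma : R) :
  (1 < gamma ->
     exists C : R, 0 < C /\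
       \forall x \near +oo,
         (count_good_primes x
            (fun p => gamma * ln (ln x) < (omega #|E_points 'F_p|)%:R))%:R
         <= C * omega_bound gamma x)
  /\
  (0 < gamma < 1 ->
     exists C : R, 0 < C /\
       \forall x \near +oo,
         (count_good_primes x
            (fun p => (omega #|E_points 'F_p|)%:R < gamma * ln (ln x)))%:R
         <= C * omega_bound gamma x).
Proof.
have reduce (Q : R -> pred nat) : 0 < gamma ->
    (forall t m P, (0 < m)%N -> prime P -> Q t (m * P)%N -> heavy R gamma t m) ->
    exists C : R, 0 < C /\ \forall x \near +oo,
      (count_good_primes x (fun p => Q (ln (ln x)) #|E_points 'F_p|))%:R
      <= C * omega_bound gamma x.
  move=> g0 HQ; have [C [T [C0 T1 H]]] := curve_prime_count R gamma g0.
  exists C; split=> //; exists (expR (expR T)); split; first exact: num_real.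
  move=> x xT; have x0 : 0 < x by apply: lt_trans xT; exact: expR_gt0.
  have lx : expR T < ln x by rewrite -ltr_expR lnK.
  have lx0 : 0 < ln x by apply: lt_trans lx; exact: expR_gt0.
  have tT : T <= ln (ln x) by rewrite -ler_expR lnK // ltW.
  have := H (ln (ln x)) (Q (ln (ln x))) tT (fun m P pP m0 => HQ _ m P m0 pP).
  rewrite !lnK // /omega_bound => h; apply: le_trans h _.
  rewrite -[ln x `^ _](_ : expR (exponent R gamma * ln (ln x)) = _); last first.
    by rewrite mulrC expRM lnK.
  by rewrite mulNr expRN.
split=> g.
  apply: (reduce (fun t n => gamma * t < (omega n)%:R)); first by lra.
  by move=> t m P m0 pP; apply: heavy_of_many_primes.
apply: (reduce (fun t n => (omega n)%:R < gamma * t)); first by case/andP: g.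
by move=> t m P m0 pP; apply: heavy_of_few_primes.
Qed.
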